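(* Let $\sigma$ be a measurable function on $\mathfrak X\times\Omega\times[0,\tau]$ such that $T_\sigma:L^2(\mathfrak X)\to L^2(\mathfrak X)$ is nuclear. Then $T_\sigma:L^2(\mathfrak X)\to L^2(\mathfrak X)$ is self-adjoint if and only if $$\sigma(y,\omega_1,s_1)=q^{-(\frac12-is_1)h_{\omega_1}(y)}\sum_{x\in\mathfrak X}q^{(\frac12-is_1)h_{\omega_1}(x)}\int_\Omega\int_0^\tau\overline{\sigma(x,\omega,s)}\,q^{(\frac12+is)h_\omega(x)}\,q^{(\frac12-is)h_\omega(y)}\,d\nu(\omega)\,d\mu(s)$$ for all $(y,\omega_1,s_1)\in\mathfrak X\times\Omega\times[0,\tau]$.
   Context: Let $q\ge 2$ be an integer and let $\mathfrak X$ be (the vertex set of) the homogeneous tree of degree $q+1$: the connected graph without loops (cycles) in which every vertex has exactly $q+1$ neighbours. $d(x,y)$ is the number of edges between $x$ and $y$; a reference vertex $o$ is fixed and $|x|=d(o,x)$. $\mathfrak X$ carries the counting measure and $L^2(\mathfrak X)$ is taken with respect to it. $\Omega$ is the set of infinite geodesic rays $\omega=(\omega_0,\omega_1,\dots)$ with $\omega_0=o$. The height function is $h_\omega(x)=\lim_{m\to\infty}(m-d(x,\omega_m))=2|c(x,\omega)|-|x|$, where $c(x,\omega)$ is the last vertex on the geodesic path $[o,x]$ that lies on $\omega$. $\nu$ is the probability measure on $\Omega$ (with the $\sigma$-algebra generated by the sets $E(x)=\{\omega:\omega\text{ passes through }x\}$) with $\nu(E(x))=\frac{q}{(q+1)q^{|x|}}$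 for $x\neq o$. Put $\tau=\pi/\log q$ and $d\mu(s)=c_P|c(s)|^{-2}ds$ on $[0,\tau]$, with $c_P=\frac{q\log q}{4\pi(q+1)}$ and $c(z)=\frac{q^{1/2}}{q+1}\,\frac{q^{1/2+iz}-q^{-1/2-iz}}{q^{iz}-q^{-iz}}$. The Fourier-Helgason transform of a finitely supported $f:\mathfrak X\to\mathbb C$ is $\mathcal Hf(\omega,s)=\sum_{y\in\mathfrak X}f(y)q^{(\frac12+is)h_\omega(y)}$, $\omega\in\Omega$, $s\in[0,\tau]$. For a measurable function $\sigma$ (the symbol) and finitely supported $f$, the pseudo-differential operator $T_\sigma$ is defined formally by $T_\sigma f(x)=\int_\Omega\int_0^\tau q^{(\frac12-is)h_\omega(x)}\sigma(x,\omega,s)\mathcal Hf(\omega,s)\,d\nu(\omega)\,d\mu(s)$, $x\in\mathfrak X$. A bounded linear operator $T:X\to Y$ of complex Banach spaces is nuclear if there are sequences $\{x_n'\}$ in the dual $X'$ and $\{y_n\}$ in $Y$ with $\sum_n\|x_n'\|_{X'}\|y_n\|_Y<\infty$ and $Tx=\sum_n x_n'(x)y_n$ for all $x\in X$.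
   Formalization: The measure μ is given an extra factor 2 (density 2c_P|c(s)|^-2, total mass 1), since with the printed c_P the claim is off by a factor 2; the sum over x is taken in L^2(Ω×[0,τ],ν×μ), and the formula is asserted for every y and almost every (ω_1,s_1). *)

(* Defs.v *)
From HB Require Import structures.
From mathcomp Require Import all_boot all_order all_algebra finmap complex.
From mathcomp Require Import all_classical all_reals all_analysis.
From mathcomp Require summability.

Set Implicit Arguments.
Unset Strict Implicit.
Unset Printing Implicit Defensive.

Import Order.TTheory GRing.Theory Num.Theory.
Import numFieldNormedType.Exports.
Import ComplexField.Normc.

Local Open Scope classical_set_scope.
Local Open Scope ring_scope.
Local Open Scope complex_scope.

Record homTree (q : nat) := HomTree {
  vertex :> choiceType;
  adj : rel vertex;
  homTree_q : (2 <= q)%N;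
  adj_sym : symmetric adj;
  adj_irr : irreflexive adj;
  adj_degree : forall x, exists2 s : seq vertex,
    uniq s /\ size s = q.+1 & forall y, adj x y = (y \in s);
  adj_connected : forall x y, exists2 p, path adj x p & last x p = y;
  (* ucycle also accepts a single edge traversed back and forth, hence the
     bound on the size *)
  adj_acyclic : forall c, ucycle adj c -> (size c <= 2)%N }.
Arguments adj {q h}.

Section Distance.
Variables (q : nat) (X : homTree q).
Implicit Types x y z : X.

Definition has_path x y (n : nat) : bool :=
  `[< exists p, [/\ path adj x p, last x p = y & size p = n] >].

Lemma has_path_ex x y : exists n, has_path x y n.
Proof.
have [p pp pl] := adj_connected x y.
by exists (size p); apply/asboolP; exists p.
Qed.

Definition dist x y : nat := ex_minn (has_path_ex x y).

Lemma distP x y : exists p, [/\ path adj x p, last x p = y & size p = dist x y].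
Proof. by rewrite /dist; case: ex_minnP => n /asboolP. Qed.

Lemma dist_le x p : path adj x p -> (dist x (last x p) <= size p)%N.
Proof.
move=> pp; rewrite /dist; case: ex_minnP => n _; apply.
by apply/asboolP; exists p.
Qed.

Lemma distxx x : dist x x = 0%N.
Proof. by apply/eqP; rewrite -leqn0; exact: (@dist_le x [::]). Qed.

Lemma dist0_eq x y : dist x y = 0%N -> x = y.
Proof. by have [[|a p] [_ <- <-]] := distP x y. Qed.

Lemma dist_sym x y : dist x y = dist y x.
Proof.
suff le a b : (dist a b <= dist b a)%N by apply/eqP; rewrite eqn_leq !le.
have [p [pp pl <-]] := distP b a.
have := @dist_le a (rev (belast b p)).
rewrite -pl rev_path.
have -> : path (fun z => adj^~ z) b p = path adj b p.
  by apply: eq_path => u v; rewrite adj_sym.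
move=> /(_ pp); rewrite size_rev size_belast.
suff -> : last (last b p) (rev (belast b p)) = b by [].
by case: p {pp pl} => //= c p; rewrite rev_cons last_rcons.
Qed.

Lemma dist_triangle x y z : (dist x z <= dist x y + dist y z)%N.
Proof.
have [p [pp pl <-]] := distP x y; have [r [rp rl <-]] := distP y z.
rewrite -rl -pl -last_cat -size_cat; apply: dist_le.
by rewrite cat_path pp pl.
Qed.

Lemma dist_adj x y : adj x y -> (dist x y <= 1)%N.
Proof. by move=> xy; apply: (@dist_le x [:: y]); rewrite /= xy. Qed.

Lemma avoid_path o x y : x != y -> (dist o y <= dist o x)%N ->
  exists p, [/\ path adj y p, last y p = o & x \notin y :: p].
Proof.
rewrite ![dist o _]dist_sym => xy yx; have [p [pp pl ps]] := distP y o.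
exists p; split=> //; rewrite in_cons negb_or xy /=; apply/negP => xp.
move: yx; rewrite -ps -pl; move: pp; case/splitPr: xp => p1 p2.
rewrite cat_path => /andP[_ /=/andP[_ pp2]].
rewrite last_cat /= size_cat /= => yx.
by have := leq_trans yx (dist_le pp2); rewrite addnS -addSn ltnNge leq_addl.
Qed.

Lemma adj_uniq_parent o x y z : adj x y -> adj x z -> y != z ->
  (dist o y <= dist o x)%N -> (dist o z <= dist o x)%N -> False.
Proof.
move=> xy xz yz oy oz.
have xDy : x != y by apply: contraTneq xy => ->; rewrite adj_irr.
have xDz : x != z by apply: contraTneq xz => ->; rewrite adj_irr.
have [p [pp pl xp]] := avoid_path xDy oy.
have [r [rp rl xr]] := avoid_path xDz oz.
have rp' : path adj (last y p) (rev (belast z r)).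
  rewrite pl -rl rev_path.
  by rewrite (eq_path (e' := adj)) // => u v; rewrite adj_sym.
have w : path adj y (p ++ rev (belast z r)) by rewrite cat_path pp.
have wl : last y (p ++ rev (belast z r)) = z.
  rewrite last_cat; case: r {rp xr rp' w} rl => [|c r] /= rl.
    by rewrite pl -rl.
  by rewrite rev_cons last_rcons.
have xw : x \notin y :: (p ++ rev (belast z r)).
  rewrite -cat_cons mem_cat negb_or xp mem_rev.
  by apply: contra xr; exact: mem_belast.
case/shortenP: w wl xw => s sp su sw sl xw.
have xs : x \notin y :: s.
  apply: contra xw; rewrite !in_cons => /orP[->//|xs].
  by rewrite (sw _ xs) orbT.
have /adj_acyclic : ucycle adj (x :: y :: s).
  rewrite /ucycle cons_uniq xs su andbT /= xy /= rcons_path sp sl.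
  by rewrite adj_sym xz.
by case: s {sp su sw xs} sl => //= yz'; move: yz; rewrite yz' eqxx.
Qed.

Lemma farther_neighbour o x : exists y, adj x y && (dist o y == (dist o x).+1).
Proof.
have [s [su ss] sP] := adj_degree x.
have : (2 < size s)%N by rewrite ss ltnS (homTree_q X).
case: s su {ss} sP => [|y [|z s]] //= su sP _.
have xy : adj x y by rewrite sP mem_head.
have xz : adj x z by rewrite sP !in_cons eqxx orbT.
have yz : y != z by move: su; rewrite in_cons negb_or -andbA => /andP[].
have ub v : adj x v -> (dist o v <= (dist o x).+1)%N.
  move=> xv; apply: leq_trans (dist_triangle o x v) _.
  by rewrite -addn1 leq_add2l dist_adj.
have [oy|oy] := leqP (dist o y) (dist o x).
  have [oz|oz] := leqP (dist o z) (dist o x).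
    by case: (adj_uniq_parent xy xz yz oy oz).
  by exists z; rewrite xz eqn_leq ub.
by exists y; rewrite xy eqn_leq ub.
Qed.

End Distance.

Record ray (q : nat) (X : homTree q) (o : X) := Ray {
  ray_fun :> nat -> X;
  ray0 : ray_fun 0%N = o;
  ray_geodesic : forall m n, (m <= n)%N ->
    dist (ray_fun m) (ray_fun n) = (n - m)%N }.

Section RayInhabited.
Variables (q : nat) (X : homTree q) (o : X).

Let next (x : X) : X := xchoose (farther_neighbour o x).
Let ray_fun0 (n : nat) : X := iter n next o.

Let ray_fun0_adj n : adj (ray_fun0 n) (ray_fun0 n.+1).
Proof. by have /andP[] := xchooseP (farther_neighbour o (ray_fun0 n)). Qed.

Let ray_fun0_dist n : dist o (ray_fun0 n) = n.
Proof.
elim: n => [|n IH]; first exact: distxx.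
by have /andP[_ /eqP ->] := xchooseP (farther_neighbour o (ray_fun0 n)); rewrite IH.
Qed.

Let ray_fun0_geodesic m n : (m <= n)%N ->
  dist (ray_fun0 m) (ray_fun0 n) = (n - m)%N.
Proof.
move=> mn; apply/eqP; rewrite eqn_leq; apply/andP; split.
  rewrite -{1}(subnKC mn); elim: (n - m)%N => [|k IH].
    by rewrite addn0 distxx.
  rewrite addnS; apply: leq_trans (dist_triangle _ (ray_fun0 (m + k)) _) _.
  by apply: leq_trans (leq_add IH (dist_adj (ray_fun0_adj _))) _; rewrite addn1.
have := dist_triangle o (ray_fun0 m) (ray_fun0 n).
by rewrite !ray_fun0_dist leq_subLR.
Qed.

Definition ray_default : ray o :=
  @Ray q X o ray_fun0 (erefl : ray_fun0 0%N = o) ray_fun0_geodesic.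

HB.instance Definition _ := gen_eqMixin (ray o).
HB.instance Definition _ := gen_choiceMixin (ray o).
HB.instance Definition _ := isPointed.Build (ray o) ray_default.

End RayInhabited.

Section Boundary.
Variables (q : nat) (X : homTree q) (o : X).

Definition through (x : X) : set (ray o) := [set w : ray o | exists n, w n = x].

Definition Omega := g_sigma_algebraType (range through).

End Boundary.
Arguments through {q X} o x.

Section ComplexIntegral.
Variables (R : realType) (d : measure_display) (T : measurableType d).
Variable m : {measure set T -> \bar R}.

Definition cmeasurable (D : set T) (f : T -> R[i]) :=
  measurable_fun D (fun t => complex.Re (f t)) /\
  measurable_fun D (fun t => complex.Im (f t)).

Definition cintegrable (D : set T) (f : T -> R[i]) :=
  m.-integrable D (EFin \o (fun t => complex.Re (f t))) /\
  m.-integrable D (EFin \o (fun t => complex.Im (f t))).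

Definition cintegral (D : set T) (f : T -> R[i]) : R[i] :=
  Rintegral m D (fun t => complex.Re (f t)) +i*
  Rintegral m D (fun t => complex.Im (f t)).

End ComplexIntegral.

Section L2.
Variables (R : realType) (X : choiceType).
Implicit Types f g : X -> R[i].

Definition sqnorm f : \bar R := \esum_(x in [set: X]) ((normc (f x) ^+ 2)%:E).

Definition L2 f : Prop := (sqnorm f < +oo)%E.

Definition norm2 f : R := Num.sqrt (fine (sqnorm f)).

Definition csum f : R[i] :=
  summability.sum (fun x => complex.Re (f x)) +i*
  summability.sum (fun x => complex.Im (f x)).

Definition inner f g : R[i] := csum (fun x => f x * conjc (g x)).

(* The operators and functionals below are functions on all of X -> R[i], but
   only their values on L2 matter. *)
Definition bounded_functional (phi : (X -> R[i]) -> R[i]) : Prop :=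
  (forall (a : R[i]) f g, L2 f -> L2 g ->
     phi (fun x => a * f x + g x) = a * phi f + phi g) /\
  exists M : R, forall f, L2 f -> normc (phi f) <= M * norm2 f.

Definition dual_norm (phi : (X -> R[i]) -> R[i]) : R :=
  sup [set normc (phi f) | f in [set f | L2 f /\ norm2 f <= 1]].

Definition bounded_operator (T : (X -> R[i]) -> X -> R[i]) : Prop :=
  [/\ forall f, L2 f -> L2 (T f),
      forall (a : R[i]) f g, L2 f -> L2 g -> forall x,
        T (fun y => a * f y + g y) x = a * T f x + T g x &
      exists M : R, forall f, L2 f -> norm2 (T f) <= M * norm2 f].

Definition nuclear (T : (X -> R[i]) -> X -> R[i]) : Prop :=
  bounded_operator T /\
  exists (phi : nat -> (X -> R[i]) -> R[i]) (g : nat -> X -> R[i]),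
    [/\ forall n, bounded_functional (phi n),
        forall n, L2 (g n),
        (\sum_(0 <= n <oo) (dual_norm (phi n) * norm2 (g n))%:E < +oo)%E &
        forall f, L2 f ->
          norm2 (fun x => T f x - \sum_(0 <= n < N) phi n f * g n x)
            @[N --> \oo] --> (0 : R)].

Definition self_adjoint (T : (X -> R[i]) -> X -> R[i]) : Prop :=
  forall f g, L2 f -> L2 g -> inner (T f) g = inner f (T g).

End L2.

Section Helgason.
Variables (R : realType) (q : nat) (X : homTree q) (o : X).
Local Notation C := R[i].

Definition height (w : Omega o) (x : X) : R :=
  lim ((m%:R - (dist x (w m))%:R : R) @[m --> \oo]).

(* t ^ z = exp (z * ln t), for t > 0 *)
Definition cpow (t : R) (z : C) : C :=
  (expR (complex.Re z * ln t))%:C *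
  (cos (complex.Im z * ln t) +i* sin (complex.Im z * ln t)).

Definition qpow (z : C) : C := cpow q%:R z.

(* q^((1/2 - is) h_w(x)) and q^((1/2 + is) h_w(x)) *)
Definition wave_minus (w : Omega o) (s : R) (x : X) : C :=
  qpow ((2^-1 -i* s) * (height w x)%:C).
Definition wave_plus (w : Omega o) (s : R) (x : X) : C :=
  qpow ((2^-1 +i* s) * (height w x)%:C).

Definition tau : R := pi / ln q%:R.

Definition cfun (z : C) : C :=
  let half := (2^-1)%:C in let iz := (0 +i* 1) * z in
  (Num.sqrt (q%:R : R) / (q.+1)%:R)%:C *
  ((qpow (half + iz) - qpow (- half - iz)) / (qpow iz - qpow (- iz))).

Definition cP : R := q%:R * ln q%:R / (4 * pi * (q.+1)%:R).

(* The constant cP is the one for which cP |c(s)|^-2 ds has mass 1 on a full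
   period [-tau, tau]; on [0, tau] it has mass 1/2. The factor 2, which comes
   from identifying s and -s, makes this the density of the Plancherel
   (probability) measure mu on [0, tau], the measure for which the inversion
   formula f(x) = int int Hf(w, s) q^((1/2 - is) h_w(x)) dnu(w) dmu(s) holds. *)
Definition plancherel_density (s : R) : R :=
  2 * cP * (normc (cfun s%:C) ^+ 2)^-1.

Definition OmegaTau : set (Omega o * measurableTypeR R) := setT `*` `[0, tau].

Variable nu : probability (Omega o) R.

Definition base_measure : {measure set (Omega o * measurableTypeR R) -> \bar R} :=
  (nu \x @lebesgue_measure R)%E.

(* integration against dnu(w) dmu(s) over Omega x [0, tau] *)
Definition nu_mu_integrable (F : Omega o -> R -> C) : Prop :=
  cintegrable base_measure OmegaTau
    (fun p => F p.1 p.2 * (plancherel_density p.2)%:C).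

Definition nu_mu_integral (F : Omega o -> R -> C) : C :=
  cintegral base_measure OmegaTau
    (fun p => F p.1 p.2 * (plancherel_density p.2)%:C).

Definition helgason (f : X -> C) (w : Omega o) (s : R) : C :=
  \sum_(y \in [set: X]) f y * wave_plus w s y.

Definition measurable_symbol (sigma : X -> Omega o -> R -> C) : Prop :=
  forall x, cmeasurable OmegaTau (fun p => sigma x p.1 p.2).

Definition psido_integrand (sigma : X -> Omega o -> R -> C) (f : X -> C) (x : X)
    (w : Omega o) (s : R) : C :=
  wave_minus w s x * sigma x w s * helgason f w s.

(* T is (the extension to L2 of) T_sigma, which is given by absolutely
   convergent integrals on the finitely supported functions. *)
Definition is_psido (sigma : X -> Omega o -> R -> C)
    (T : (X -> C) -> X -> C) : Prop :=
  forall f : X -> C, finite_set [set x | f x != 0] -> forall x,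
    nu_mu_integrable (psido_integrand sigma f x) /\
    T f x = nu_mu_integral (psido_integrand sigma f x).

(* F is the sum of the series of functions u x, x in X, in
   L2(Omega x [0, tau], nu x mu): the net of the sums over the finite subsets
   of X converges to F in the L2 norm. *)
Definition L2_series_sum (u : X -> Omega o -> R -> C) (F : Omega o -> R -> C) :
    Prop :=
  cmeasurable OmegaTau (fun p => F p.1 p.2) /\
  (\int[base_measure]_(p in OmegaTau)
     (normc (F p.1 p.2 - summability.partial_sum (fun x => u x p.1 p.2) A) ^+ 2
        * plancherel_density p.2)%:E)%E
    @[A --> summability.totally] --> (0 : \bar R).

End Helgason.

(* Main.v *)
(* T_sigma is determined by its kernel K(x, y) = T delta_y x, the integral of
   wave_minus x * sigma x * wave_plus y against nu x mu, and a bounded T is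
   self-adjoint if and only if K(x, y) = conj K(y, x).

   The waves are an orthonormal basis. Orthonormality comes from the recursion
   u * wave_plus x = wave_plus p off the cylinder of x (p the parent of x,
   u = q^(1/2 + is)), which reduces the integrals over the boundary to spherical
   functions of the distance, and these to cosine integrals in s. Completeness:
   if F is orthogonal to all waves, the eigenvalue equation for the sum of the
   waves over the neighbours of x shows that multiplying F by cos(s log q), hence
   by limits of polynomials in it, keeps F orthogonal; this gives multiplication
   by u and by indicators of intervals in s, so F integrates to zero over all
   rectangles (cylinder) x (interval).

   The coefficients of the series in the theorem are conj K(x, y), a square
   summable function of x, so its sum S exists and S integrated against
   wave_plus x is conj K(x, y), whereas wave_minus y * sigma y integrated against
   wave_plus x is K(y, x). By completeness all these agree if and only if
   S = wave_minus y * sigma y almost everywhere. *)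
Require Import Defs.
From mathcomp Require Import all_boot all_order all_algebra finmap complex.
From mathcomp Require Import all_classical all_reals all_analysis.
From mathcomp Require Import measurable_realfun.
From mathcomp Require summability.
From mathcomp Require Import ring lra zify.

Set Implicit Arguments.
Unset Strict Implicit.
Unset Printing Implicit Defensive.

Import Order.TTheory GRing.Theory Num.Theory.
Import numFieldNormedType.Exports.
Import ComplexField.Normc.

Local Open Scope classical_set_scope.
Local Open Scope ring_scope.
Local Open Scope complex_scope.

(** * Rays and heights *)

(** The absolute convergence in [is_psido] says that [wave_minus y * sigma y] is integrable for the
    Plancherel measure; square integrability is not given. Completeness is therefore proved for
    functions that are merely integrable, where Hilbert space arguments do not apply: the
    multipliers in [s] are bounded, and limits are taken by dominated convergence.

    The half period [[0, tau]] is what makes the cosine sufficient. There it is injective in [s], so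
    that polynomials in it approximate indicators of intervals, and the sine is the nonnegative root
    of [1 - cos^2].

    For orthonormality the obstacle is the squared modulus of [1 / c(s)]. With
    [W = q / ((q + 1) c(s))] one has [W + conj W = (q + 1) / q * |W|^2], so the density is linear in
    [W] and [conj W], and its product with a spherical function is a multiple of [W u^-n] plus its
    conjugate. A geometric series of [W] in [u^-2] would leave cosine integrals; a telescoping
    relation with geometric decay replaces the series.

    Sums over [X] are compared with finite sums, and inequalities between arithmetic and geometric
    means with a free parameter do the work of Cauchy-Schwarz. *)

Section Tree.
Variables (q : nat) (X : homTree q).
Implicit Types x y z r o : X.

Lemma closer_neighbour r x : x != r ->
  exists2 p, adj x p & dist r x = (dist r p).+1.
Proof.
have [[|y p] [/= pp pl ps]] := distP x r; first by rewrite pl eqxx.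
case/andP: pp => xy pp _; exists y => //.
have ly := dist_le pp; rewrite pl in ly.
have := dist_triangle r y x; have := dist_adj xy.
rewrite (dist_sym r x) (dist_sym r y) (dist_sym y x) -ps; lia.
Qed.

(** A tree is bipartite: if adjacent [x] and [y] were equally far from [r], then [y] and the
    neighbour of [x] towards [r] would be two neighbours of [x] that are not farther from [r] than
    [x], against [adj_uniq_parent]. *)
Lemma adj_dist r x y : adj x y ->
  dist r y = (dist r x).+1 \/ dist r x = (dist r y).+1.
Proof.
move=> xy.
have := dist_triangle r x y; have := dist_triangle r y x.
have := dist_adj xy; rewrite (dist_sym y x) => d1.
suff : dist r x <> dist r y by lia.
move=> e; have [xr|xr] := eqVneq x r.
  move: e; rewrite xr distxx => /esym /dist0_eq e.
  by move: xy; rewrite xr e adj_irr.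
have [p xp e'] := closer_neighbour xr.
apply: (@adj_uniq_parent _ _ r x y p) => //; rewrite ?e' ?e //.
  by apply: contra_eq_neq e' => <-; rewrite e; apply/eqP; lia.
by rewrite -e e'.
Qed.

(* A geodesic that starts by moving away from r never turns back. *)
Lemma dist_away r x y z : adj x y -> dist r y = (dist r x).+1 ->
  dist z x = (dist z y).+1 -> dist r z = (dist r x + dist x z)%N.
Proof.
rewrite (dist_sym x); move: {1}(dist z y) (erefl (dist z y)) => n.
elim: n x y => [|n IH] x y e axy ry zxy.
  by rewrite zxy -e (dist0_eq (esym e)) ry; lia.
have yz : y != z by apply: contra_eq_neq e => ->; rewrite distxx.
have [y' yy' zyy'] := closer_neighbour yz.
rewrite (IH y y') //; first by rewrite ry zxy; lia.
  by move: zyy'; rewrite -e => -[].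
have [//|e2] := adj_dist r yy'.
case: (@adj_uniq_parent _ _ r y y' x) => //; rewrite 1?adj_sym ?ry ?e2 //.
  by apply: contra_eq_neq zyy' => ->; rewrite zxy; apply/eqP; lia.
by rewrite -ltnS -e2 ry.
Qed.

End Tree.

Section Rays.
Variables (q : nat) (X : homTree q) (o : X) (w : ray o).
Implicit Types x y p : X.

Lemma ray_dist0 n : dist o (w n) = n.
Proof. by have := ray_geodesic w (leq0n n); rewrite ray0 subn0. Qed.

Lemma ray_adj n : adj (w n) (w n.+1).
Proof.
have [p [pp pl ps]] := distP (w n) (w n.+1).
move: ps; rewrite ray_geodesic // subSn // subnn.
by case: p pp pl => [//|y [|//]] /=; rewrite andbT => h <-.
Qed.

Lemma through_eq x : through o x w -> w (dist o x) = x.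
Proof. by case=> n <-; rewrite ray_dist0. Qed.

Lemma ray_dist_stable x n : dist x (w n.+1) = (dist x (w n)).+1 ->
  forall j, (n <= j)%N -> dist x (w j) = (dist x (w n) + (j - n))%N.
Proof.
move=> xn j; rewrite leq_eqVlt => /orP[/eqP <-|nj].
  by rewrite subnn addn0.
rewrite -(ray_geodesic w (ltnW nj)); apply: dist_away (ray_adj n) xn _.
by rewrite !(dist_sym (w j)) !ray_geodesic ?(ltnW nj)//; lia.
Qed.

(** From its vertex of level [dist o x] on, the ray recedes from [x]. If it still approached [x]
    there, [x] would lie beyond that vertex as seen from [o], at a distance greater than [dist o x].
    Hence the limit in [height] is attained from this index on. *)
Lemma ray_dist_large x j : (dist o x <= j)%N ->
  dist x (w j) = (dist x (w (dist o x)) + (j - dist o x))%N.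
Proof.
move=> xj; apply: ray_dist_stable xj.
have [//|e] := adj_dist x (ray_adj (dist o x)).
have := @dist_away _ _ o _ _ x (ray_adj (dist o x)).
by rewrite !ray_dist0 (dist_sym (w _) x) => /(_ erefl e); rewrite e; lia.
Qed.

Variable R : realType.

Lemma heightE x j : (dist o x <= j)%N ->
  height R w x = j%:R - (dist x (w j))%:R.
Proof.
move=> xj; apply/cvg_lim => //; apply: cvg_near_cst.
near=> m; have xm : (dist o x <= m)%N by near: m; exists (dist o x).
rewrite (ray_dist_large xj) (ray_dist_large xm) !natrD !natrB //; ring.
Unshelve. all: by end_near. Qed.

Lemma height_through x : through o x w -> height R w x = (dist o x)%:R.
Proof. by move=> /through_eq e; rewrite (heightE (leqnn _)) e distxx subr0. Qed.

Lemma height_root : height R w o = 0.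
Proof. by rewrite height_through ?distxx //; exists 0%N; rewrite ray0. Qed.

Lemma through_parent x p : adj x p -> dist o x = (dist o p).+1 ->
  through o x w -> through o p w.
Proof.
move=> xp e tx; exists (dist o p); apply/eqP.
have xw : adj x (w (dist o p)).
  by rewrite -[x](through_eq tx) e adj_sym ray_adj.
apply/negPn/negP => neq.
by apply: (adj_uniq_parent xw xp neq (o := o)); rewrite ?ray_dist0 e.
Qed.

(** Both heights are read off at the ray vertex of level [dist o x]. If that vertex were nearer to
    [x] than to [p], it would lie beyond [x] as seen from [o], and having the level of [x] it would
    be [x]. *)
Lemma height_off x p : adj x p -> dist o x = (dist o p).+1 ->
  ~ through o x w -> height R w x = height R w p - 1.
Proof.
move=> xp e ntx.
rewrite (heightE (leqnn _)) (@heightE p (dist o x)) ?e //.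
suff : dist (w (dist o x)) x = (dist (w (dist o x)) p).+1.
  by rewrite e !(dist_sym (w _)) => ->; rewrite -natr1; ring.
have [e'|//] := adj_dist (w (dist o x)) xp.
move: (xp); rewrite adj_sym => px.
have := dist_away px e e'; rewrite ray_dist0 e (dist_sym p) -e e'.
move=> ?; have /dist0_eq wx : dist (w (dist o x)) x = 0%N by lia.
by case: ntx; exists (dist o x).
Qed.

(** When [y] is not below [x], a ray through [x] leaves [y] behind from [x] on, so the height of [y]
    is the same for all these rays. The inequality excludes [x] itself, which the first alternative
    restores. *)
Lemma height_cylinder x y : through o x w ->
  x = y \/ dist o y <> (dist o x + dist x y)%N ->
  height R w y = (dist o x)%:R - (dist x y)%:R.
Proof.
move=> tx xy; have wx := through_eq tx; set m := dist o x in wx *.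
have st : dist y (w m.+1) = (dist y (w m)).+1.
  have [//|e] := adj_dist y (ray_adj m).
  have := @dist_away _ _ o _ _ y (ray_adj m).
  move=> /(_ _ e); rewrite !ray_dist0 wx => /(_ erefl) e'.
  case: xy => [exy|/(_ e')//]; move: e.
  by rewrite wx exy distxx.
rewrite (@heightE y (m + dist o y)) ?leq_addl //.
rewrite (ray_dist_stable st) ?leq_addr // addKn wx (dist_sym y) !natrD; ring.
Qed.

(** One ray vertex, of level [(dist o x).+1], is deep enough to read off the heights of [x] and of
    all its neighbours; [p] is the neighbour of [x] towards it. *)
Lemma height_neighbours x (s : seq X) : uniq s -> (forall y, adj x y = (y \in s)) ->
  exists2 p, p \in s & height R w p = height R w x + 1 /\
    forall y, y \in s -> y != p -> height R w y = height R w x - 1.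
Proof.
move=> us sP; set j := (dist o x).+1.
have jw y : adj x y -> (dist o y <= j)%N.
  by move=> xy; rewrite /j; have [->|->] := adj_dist o xy; lia.
have xw : x != w j.
  by apply: contra_eq_neq (ray_dist0 j) => <-; rewrite /j; apply/eqP; lia.
have [p xp e] := closer_neighbour xw.
exists p; first by rewrite -sP.
split=> [|y]; rewrite -?sP.
  rewrite (heightE (jw _ xp)) (@heightE x j) // !(dist_sym _ (w j)) e -natr1.
  ring.
move=> xy yp; rewrite (heightE (jw _ xy)) (@heightE x j) // !(dist_sym _ (w j)).
have [->|e'] := adj_dist (w j) xy; first by rewrite -natr1; ring.
by case: (adj_uniq_parent xy xp yp (o := w j)); rewrite ?e ?e'//; lia.
Qed.

End Rays.

(** * Complex-valued integrals *)

Section ComplexScalars.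
Variable R : realType.
Implicit Types z w : R[i].

Lemma ReM z w : complex.Re (z * w) =
  complex.Re z * complex.Re w - complex.Im z * complex.Im w.
Proof. by case: z w => [a b] [c e]. Qed.

Lemma ImM z w : complex.Im (z * w) =
  complex.Re z * complex.Im w + complex.Im z * complex.Re w.
Proof. by case: z w => [a b] [c e]. Qed.

Lemma ReJ z : complex.Re (conjc z) = complex.Re z. Proof. by case: z. Qed.

Lemma ImJ z : complex.Im (conjc z) = - complex.Im z. Proof. by case: z. Qed.

Lemma sqr_normcE z :
  normc z ^+ 2 = complex.Re z ^+ 2 + complex.Im z ^+ 2.
Proof. by case: z => a b /=; rewrite sqr_sqrtr // addr_ge0 ?sqr_ge0. Qed.

Lemma mul_conjc z : z * conjc z = (normc z ^+ 2)%:C.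
Proof.
rewrite sqr_normcE; apply/eqP; rewrite eq_complex ReM ImM ReJ ImJ /=.
by apply/andP; split; apply/eqP; ring.
Qed.

Lemma normc_ge0 z : 0 <= normc z.
Proof. by case: z => a b; exact: sqrtr_ge0. Qed.

Lemma normcJ z : normc (conjc z) = normc z.
Proof. by case: z => a b /=; rewrite sqrrN. Qed.

Lemma ler_Re_normc z : `|complex.Re z| <= normc z.
Proof.
rewrite -(@ler_pXn2r _ 2) ?nnegrE ?normc_ge0 // sqr_normcE real_normK ?num_real//.
by rewrite lerDl sqr_ge0.
Qed.

Lemma ler_Im_normc z : `|complex.Im z| <= normc z.
Proof.
rewrite -(@ler_pXn2r _ 2) ?nnegrE ?normc_ge0 // sqr_normcE real_normK ?num_real//.
by rewrite lerDr sqr_ge0.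
Qed.

Lemma normc_le_ReIm z : normc z <= `|complex.Re z| + `|complex.Im z|.
Proof.
rewrite -(@ler_pXn2r _ 2) ?nnegrE ?normc_ge0 ?addr_ge0 // sqr_normcE sqrrD.
rewrite !real_normK ?num_real// addrAC lerDl mulrn_wge0 // mulr_ge0 //.
Qed.

Lemma normcR (r : R) : normc r%:C = `|r|.
Proof. by rewrite /= expr0n addr0 sqrtr_sqr. Qed.

Lemma complex_eqP z w : complex.Re z = complex.Re w ->
  complex.Im z = complex.Im w -> z = w.
Proof. by case: z w => [a b] [c e] /= -> ->. Qed.

Lemma normc_eq0 z : (normc z == 0) = (z == 0).
Proof. by apply/eqP/eqP => [/eq0_normc|->] //; rewrite normc0. Qed.

Lemma conjcD z w : conjc (z + w) = conjc z + conjc w.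
Proof. exact: rmorphD. Qed.

Lemma conjcB z w : conjc (z - w) = conjc z - conjc w.
Proof. exact: rmorphB. Qed.

Lemma conjcM z w : conjc (z * w) = conjc z * conjc w.
Proof. exact: rmorphM. Qed.

Lemma conjcX z n : conjc (z ^+ n) = conjc z ^+ n.
Proof. exact: rmorphXn. Qed.

Lemma natc (n : nat) : (n%:R : R)%:C = n%:R.
Proof. exact: (rmorph_nat (real_complex R)). Qed.

Lemma realcM (a b : R) : (a * b)%:C = a%:C * b%:C.
Proof. exact: (rmorphM (real_complex R)). Qed.

Lemma realcD (a b : R) : (a + b)%:C = a%:C + b%:C.
Proof. exact: (rmorphD (real_complex R)). Qed.

Lemma realcV (a : R) : (a^-1)%:C = a%:C^-1.
Proof. exact: (fmorphV (real_complex R)). Qed.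

Lemma realcX (a : R) n : (a ^+ n)%:C = a%:C ^+ n.
Proof. exact: (rmorphXn (real_complex R)). Qed.

Lemma realc_eq0 (a : R) : (a%:C == 0) = (a == 0).
Proof. by rewrite -(rmorph0 (real_complex R)) (inj_eq (@complexI _)). Qed.

End ComplexScalars.

Section ComplexIntegralTheory.
Variables (R : realType) (d : measure_display) (T : measurableType d).
Variables (m : {measure set T -> \bar R}) (D : set T).
Hypothesis mD : measurable D.
Implicit Types f g : T -> R[i].

Definition cbounded f := exists M : R, forall t, D t -> normc (f t) <= M.

Lemma cmeasurable_cst (c : R[i]) : cmeasurable D (fun=> c).
Proof. by split; exact: measurable_cst. Qed.

Lemma cmeasurableD f g : cmeasurable D f -> cmeasurable D g ->
  cmeasurable D (fun t => f t + g t).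
Proof.
move=> [f1 f2] [g1 g2]; split.
  rewrite (_ : (fun _ => _) = (fun t => complex.Re (f t) + complex.Re (g t))).
    exact: measurable_funD.
  by apply/funext => t; case: (f t) (g t) => [a b] [].
rewrite (_ : (fun _ => _) = (fun t => complex.Im (f t) + complex.Im (g t))).
  exact: measurable_funD.
by apply/funext => t; case: (f t) (g t) => [a b] [].
Qed.

Lemma cmeasurableM f g : cmeasurable D f -> cmeasurable D g ->
  cmeasurable D (fun t => f t * g t).
Proof.
move=> [f1 f2] [g1 g2]; split.
  under eq_fun do rewrite ReM.
  by apply: measurable_funB; exact: measurable_funM.
under eq_fun do rewrite ImM.
by apply: measurable_funD; exact: measurable_funM.
Qed.

Lemma cmeasurable_real (f : T -> R) : measurable_fun D f ->
  cmeasurable D (fun t => (f t)%:C).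
Proof. by move=> mf; split => //; exact: measurable_cst. Qed.

Lemma cmeasurableJ f : cmeasurable D f -> cmeasurable D (fun t => conjc (f t)).
Proof.
move=> [f1 f2]; split; first by under eq_fun do rewrite ReJ.
by under eq_fun do rewrite ImJ; exact: measurable_funN.
Qed.

Lemma cmeasurableN f : cmeasurable D f -> cmeasurable D (fun t => - f t).
Proof.
move=> mf; under eq_fun do rewrite -mulN1r.
exact: cmeasurableM (cmeasurable_cst _) mf.
Qed.

Lemma cmeasurableB f g : cmeasurable D f -> cmeasurable D g ->
  cmeasurable D (fun t => f t - g t).
Proof. by move=> mf mg; exact: cmeasurableD (cmeasurableN mg). Qed.

Lemma cmeasurable_sum I (s : seq I) (f : I -> T -> R[i]) :
  (forall i, cmeasurable D (f i)) -> cmeasurable D (fun t => \sum_(i <- s) f i t).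
Proof.
move=> mf; elim: s => [|i s IH].
  by under eq_fun do rewrite big_nil; exact: cmeasurable_cst.
by under eq_fun do rewrite big_cons; exact: cmeasurableD.
Qed.

Lemma measurable_sqr_normc f : cmeasurable D f ->
  measurable_fun D (fun t => normc (f t) ^+ 2).
Proof.
move=> [f1 f2]; under eq_fun do rewrite sqr_normcE.
by apply: measurable_funD; exact: measurable_funX.
Qed.

Lemma measurable_normc f : cmeasurable D f ->
  measurable_fun D (fun t => normc (f t)).
Proof.
move=> mf; rewrite (_ : (fun _ => _) = Num.sqrt \o (fun t => normc (f t) ^+ 2)).
  apply: measurableT_comp (measurable_sqr_normc mf).
  by apply: continuous_measurable_fun; exact: sqrt_continuous.
by apply/funext => t /=; rewrite sqrtr_sqr ger0_norm // normc_ge0.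
Qed.

(** The inverse is [conjc f] divided by the squared modulus, which leaves the real inverse,
    continuous on the open set of nonzero reals. *)
Lemma cmeasurableV f : cmeasurable D f -> (forall t, D t -> f t != 0) ->
  cmeasurable D (fun t => (f t)^-1).
Proof.
move=> mf f0.
have nz t : D t -> normc (f t) ^+ 2 != 0 by move=> /f0; rewrite sqrf_eq0 normc_eq0.
suff : cmeasurable D (fun t => conjc (f t) * ((normc (f t) ^+ 2)^-1)%:C).
  have e : {in D, (fun t => conjc (f t) * ((normc (f t) ^+ 2)^-1)%:C) =1
      (fun t => (f t)^-1)}.
    move=> t; rewrite inE => Dt; have := nz t Dt; have := f0 t Dt => f1 n1.
    by apply: (mulfI f1); rewrite divff // mulrA mul_conjc -realcM divff.
  by move=> [m1 m2]; split; [apply: eq_measurable_fun m1|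
    apply: eq_measurable_fun m2] => t Dt; rewrite (e t Dt).
apply: cmeasurableM; first exact: cmeasurableJ.
apply: cmeasurable_real.
apply: (@measurable_comp _ _ _ T (measurableTypeR R) (measurableTypeR R)
  (~` [set 0]) GRing.inv D (fun t => normc (f t) ^+ 2)).
- by apply: measurableC; exact: measurable_set1.
- by move=> _ [t Dt <-] /eqP; apply/negP; exact: nz.
- apply: open_continuous_measurable_fun.
    by apply: closed_openC; exact: closed_eq.
  move=> x; rewrite inE => /eqP x0; exact: inv_continuous.
- exact: measurable_sqr_normc.
Qed.

Lemma cbounded_cst (c : R[i]) : cbounded (fun=> c).
Proof. by exists (normc c). Qed.

Lemma cboundedD f g : cbounded f -> cbounded g ->
  cbounded (fun t => f t + g t).
Proof.
move=> [M fM] [N gN]; exists (M + N) => t Dt.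
by apply: le_trans (le_normcD _ _) _; rewrite lerD ?fM ?gN.
Qed.

Lemma cboundedM f g : cbounded f -> cbounded g ->
  cbounded (fun t => f t * g t).
Proof.
move=> [M fM] [N gN]; exists (M * N) => t Dt.
by rewrite normcM ler_pM ?normc_ge0 ?fM ?gN.
Qed.

Lemma cbounded_sum I (s : seq I) (f : I -> T -> R[i]) :
  (forall i, cbounded (f i)) -> cbounded (fun t => \sum_(i <- s) f i t).
Proof.
move=> mf; elim: s => [|i s IH].
  by under eq_fun do rewrite big_nil; exact: cbounded_cst.
by under eq_fun do rewrite big_cons; exact: cboundedD.
Qed.

Lemma cintegrable_dominated f (g : T -> R) : cmeasurable D f ->
  m.-integrable D (EFin \o g) -> (forall t, D t -> normc (f t) <= g t) ->
  cintegrable m D f.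
Proof.
move=> [f1 f2] ig fg; split; apply: le_integrable ig => //.
- exact/measurable_EFinP.
- move=> t Dt; rewrite /= lee_fin (le_trans (ler_Re_normc _))//.
  by rewrite (le_trans (fg t Dt))// ler_norm.
- exact/measurable_EFinP.
- move=> t Dt; rewrite /= lee_fin (le_trans (ler_Im_normc _))//.
  by rewrite (le_trans (fg t Dt))// ler_norm.
Qed.

Lemma cintegrable_cmeasurable f : cintegrable m D f -> cmeasurable D f.
Proof. by move=> [/measurable_int/measurable_EFinP ? /measurable_int/measurable_EFinP]. Qed.

Lemma integrable_normc f : cintegrable m D f ->
  m.-integrable D (EFin \o (fun t => normc (f t))).
Proof.
move=> If; have [f1 f2] := If.
have i12 := integrableD mD (integrable_norm f1) (integrable_norm f2).
apply: le_integrable i12 => //.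
  exact/measurable_EFinP/measurable_normc/cintegrable_cmeasurable.
move=> t Dt; rewrite /= lee_fin (ger0_norm (normc_ge0 _)).
exact: le_trans (normc_le_ReIm _) (ler_norm _).
Qed.

Lemma cintegrableD f g : cintegrable m D f -> cintegrable m D g ->
  cintegrable m D (fun t => f t + g t).
Proof.
move=> If Ig; apply: cintegrable_dominated
  (integrableD mD (integrable_normc If) (integrable_normc Ig)) _.
  by apply: cmeasurableD; exact: cintegrable_cmeasurable.
by move=> t _; exact: le_normcD.
Qed.

Lemma cintegrableMr f g : cintegrable m D f -> cmeasurable D g -> cbounded g ->
  cintegrable m D (fun t => f t * g t).
Proof.
move=> If mg [M gM].
have iM := integrableZr mD M (integrable_normc If).
apply: cintegrable_dominated iM _.
  exact: cmeasurableM (cintegrable_cmeasurable If) mg.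
by move=> t Dt; rewrite normcM ler_wpM2l ?normc_ge0 ?gM.
Qed.

Lemma cintegrableZr f c : cintegrable m D f -> cintegrable m D (fun t => f t * c).
Proof.
by move=> If; exact: cintegrableMr If (cmeasurable_cst c) (cbounded_cst c).
Qed.

Lemma cintegrable_sum I (s : seq I) (f : I -> T -> R[i]) :
  (forall i, cintegrable m D (f i)) -> cintegrable m D (fun t => \sum_(i <- s) f i t).
Proof.
move=> mf; elim: s => [|i s IH].
  by under eq_fun do rewrite big_nil; split; exact: integrable0.
by under eq_fun do rewrite big_cons; exact: cintegrableD.
Qed.

Lemma cintegrable_bounded f : (m D < +oo)%E -> cmeasurable D f -> cbounded f ->
  cintegrable m D f.
Proof.
move=> Dfin mf [M fM]; apply: (@cintegrable_dominated f (cst M)) => //.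
by apply: measurable_bounded_integrable => //; exact: bounded_cst.
Qed.

Lemma eq_cintegral f g : (forall t, D t -> f t = g t) ->
  cintegral m D f = cintegral m D g.
Proof.
by move=> fg; rewrite /cintegral; congr (_ +i* _); apply: eq_Rintegral => t;
  rewrite inE => Dt; rewrite fg.
Qed.

Lemma eq_cintegrable f g : (forall t, D t -> f t = g t) ->
  cintegrable m D f -> cintegrable m D g.
Proof.
move=> fg [f1 f2]; split.
  by apply: eq_integrable f1 => // t; rewrite inE => Dt /=; rewrite fg.
by apply: eq_integrable f2 => // t; rewrite inE => Dt /=; rewrite fg.
Qed.

Lemma cintegralD f g : cintegrable m D f -> cintegrable m D g ->
  cintegral m D (fun t => f t + g t) = cintegral m D f + cintegral m D g.
Proof.
move=> [f1 f2] [g1 g2]; rewrite /cintegral; apply: complex_eqP => /=.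
  by rewrite -RintegralD //; apply: eq_Rintegral => t _; case: (f t) (g t) => [a b] [].
by rewrite -RintegralD //; apply: eq_Rintegral => t _; case: (f t) (g t) => [a b] [].
Qed.

Lemma cintegralZr f c : cintegrable m D f ->
  cintegral m D (fun t => f t * c) = cintegral m D f * c.
Proof.
move=> If; have [f1 f2] := If; apply: complex_eqP; rewrite ?ReM ?ImM /=.
  rewrite -!RintegralZr // -RintegralB //; last 2 first.
  - by apply: eq_integrable (integrableZr mD _ f1).
  - by apply: eq_integrable (integrableZr mD _ f2).
  by apply: eq_Rintegral => t _; rewrite ReM.
rewrite -!RintegralZr // -RintegralD //; last 2 first.
- by apply: eq_integrable (integrableZr mD _ f1).
- by apply: eq_integrable (integrableZr mD _ f2).
by apply: eq_Rintegral => t _; rewrite ImM.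
Qed.

Lemma cintegralN f : cintegrable m D f ->
  cintegral m D (fun t => - f t) = - cintegral m D f.
Proof.
move=> If; rewrite -mulrN1 -cintegralZr //; apply: eq_cintegral => t _.
by rewrite mulrN1.
Qed.

Lemma cintegrableB f g : cintegrable m D f -> cintegrable m D g ->
  cintegrable m D (fun t => f t - g t).
Proof.
move=> If Ig; apply: eq_cintegrable (cintegrableD If (cintegrableZr (-1) Ig)).
by move=> t _; rewrite mulrN1.
Qed.

Lemma cintegralB f g : cintegrable m D f -> cintegrable m D g ->
  cintegral m D (fun t => f t - g t) = cintegral m D f - cintegral m D g.
Proof.
move=> If Ig; rewrite cintegralD // ?cintegralN //.
apply: eq_cintegrable (cintegrableZr (-1) Ig) => t _; by rewrite mulrN1.
Qed.

Lemma cintegral0 : cintegral m D (fun=> 0) = 0.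
Proof. by apply: complex_eqP => /=; rewrite Rintegral_cst // mul0r. Qed.

Lemma cintegral_sum I (s : seq I) (f : I -> T -> R[i]) :
  (forall i, cintegrable m D (f i)) ->
  cintegral m D (fun t => \sum_(i <- s) f i t) = \sum_(i <- s) cintegral m D (f i).
Proof.
move=> If; elim: s => [|i s IH].
  by rewrite big_nil -[RHS]cintegral0; apply: eq_cintegral => t _; rewrite big_nil.
rewrite big_cons -IH -cintegralD //; last exact: cintegrable_sum.
by apply: eq_cintegral => t _; rewrite big_cons.
Qed.

Lemma cintegralJ f : cintegrable m D f ->
  cintegral m D (fun t => conjc (f t)) = conjc (cintegral m D f).
Proof.
move=> [f1 f2]; apply: complex_eqP; rewrite ?ReJ ?ImJ /=.
  by apply: eq_Rintegral => t _; rewrite ReJ.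
rewrite -mulN1r -RintegralZl //; apply: eq_Rintegral => t _.
by rewrite ImJ mulN1r.
Qed.

(** The factor 2 comes from estimating real and imaginary parts separately; it is harmless where
    only smallness matters. *)
Lemma normc_cintegral_le f : cintegrable m D f ->
  normc (cintegral m D f) <= 2 * Rintegral m D (fun t => normc (f t)).
Proof.
move=> If; have [f1 f2] := If; apply: le_trans (normc_le_ReIm _) _.
rewrite mulrDl mul1r /=; have In := integrable_normc If.
apply: lerD; (apply: le_trans (le_normr_Rintegral mD _) _; first by []);
  apply: le_Rintegral => //; try exact: integrable_norm; move=> t _.
  exact: ler_Re_normc.
exact: ler_Im_normc.
Qed.

Lemma ae_eq_cintegral f g : cmeasurable D f -> cmeasurable D g ->
  {ae m, forall t, D t -> f t = g t} -> cintegral m D f = cintegral m D g.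
Proof.
move=> [f1 f2] [g1 g2] fg; apply: complex_eqP; rewrite /cintegral /= /Rintegral.
  congr fine; apply: ae_eq_integral => //; try exact/measurable_EFinP.
  by apply: filterS fg => t + Dt => /(_ Dt) ->.
congr fine; apply: ae_eq_integral => //; try exact/measurable_EFinP.
by apply: filterS fg => t + Dt => /(_ Dt) ->.
Qed.

Lemma cvg_cintegral0 (f_ : nat -> T -> R[i]) f (g : T -> R) :
  (forall n, cmeasurable D (f_ n)) -> cmeasurable D f ->
  m.-integrable D (EFin \o g) ->
  (forall n t, D t -> normc (f_ n t) <= g t) ->
  (forall t, D t -> complex.Re (f_ n t) @[n --> \oo] --> complex.Re (f t)) ->
  (forall t, D t -> complex.Im (f_ n t) @[n --> \oo] --> complex.Im (f t)) ->
  (forall n, cintegral m D (f_ n) = 0) -> cintegral m D f = 0.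
Proof.
move=> mf_ mf ig f_g cRe cIm f0.
(* Dominated convergence for the real and the imaginary part at once: [p] is either of them. *)
have key (p : R[i] -> R) (p0 : p 0 = 0) :
    (forall z, `|p z| <= normc z) ->
    (forall n, measurable_fun D (fun t => p (f_ n t))) ->
    measurable_fun D (fun t => p (f t)) ->
    (forall t, D t -> p (f_ n t) @[n --> \oo] --> p (f t)) ->
    (forall n, Rintegral m D (fun t => p (f_ n t)) = 0) ->
    Rintegral m D (fun t => p (f t)) = 0.
  move=> pn mpf_ mpf cp i0.
  have [] := @dominated_convergence _ _ _ m D mD
    (fun n t => (p (f_ n t))%:E) (fun t => (p (f t))%:E) (EFin \o g).
  - by move=> n; exact/measurable_EFinP.
  - exact/measurable_EFinP.
  - apply: aeW => t Dt; apply/fine_cvgP; split; first exact: nearW.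
    exact: cp.
  - by [].
  - apply: aeW => t n Dt; rewrite /= lee_fin; apply: le_trans (pn _) _.
    exact: f_g.
  have -> : [sequence (\int[m]_(t in D) (p (f_ n t))%:E)%E]_n = fun=> 0%E.
    apply/funext => n /=; rewrite -[LHS]fineK ?[fine _]i0 //.
    apply: integrable_fin_num => //.
    apply: le_integrable ig => //; first exact/measurable_EFinP.
    move=> t Dt; rewrite /= lee_fin; apply: le_trans (pn _) _.
    exact: le_trans (f_g n t Dt) (ler_norm _).
  by move=> _ _ /(cvg_lim (@ereal_hausdorff R)); rewrite lim_cst // /Rintegral => <-.
apply: complex_eqP; rewrite /cintegral /=; apply: key => //.
- exact: ler_Re_normc.
- by move=> n; have [] := mf_ n.
- by have [] := mf.
- by move=> n; have /(congr1 (@complex.Re _)) := f0 n.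
- exact: ler_Im_normc.
- by move=> n; have [] := mf_ n.
- by have [] := mf.
- by move=> n; have /(congr1 (@complex.Im _)) := f0 n.
Qed.

End ComplexIntegralTheory.

(** * Plane waves and the Plancherel density *)

Section QPow.
Variables (R : realType) (q : nat).
Hypothesis q2 : (2 <= q)%N.
Local Notation qpow := (@qpow R q).

Lemma lnq_gt0 : 0 < ln (q%:R : R).
Proof. by rewrite ln_gt0 // ltr1n. Qed.

Lemma tau_gt0 : 0 < tau R q.
Proof. by rewrite divr_gt0 ?pi_gt0 ?lnq_gt0. Qed.

Lemma qpowD a b : qpow (a + b) = qpow a * qpow b.
Proof.
case: a b => [a a'] [b b']; rewrite /qpow /cpow /=; apply: complex_eqP => /=;
  rewrite !(mulrDl (_ : R)) expRD cosD sinD; ring.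
Qed.

Lemma qpow0 : qpow 0 = 1.
Proof.
by rewrite /qpow /cpow /= !mul0r expR0 cos0 sin0; apply: complex_eqP => /=; ring.
Qed.

Lemma qpowN a : qpow (- a) = (qpow a)^-1.
Proof.
have e : qpow a * qpow (- a) = 1 by rewrite -qpowD subrr qpow0.
have /unitrPr u : exists y, qpow a * y = 1 by exists (qpow (- a)).
by rewrite -[LHS]mul1r -(mulVr u) -mulrA e mulr1.
Qed.

Lemma qpow_neq0 a : qpow a != 0.
Proof.
apply/eqP => e; have := qpowD a (- a); rewrite subrr qpow0 e mul0r.
by move/eqP; rewrite oner_eq0.
Qed.

Lemma conjc_qpow a : conjc (qpow a) = qpow (conjc a).
Proof.
case: a => a b; rewrite /qpow /cpow /=; apply: complex_eqP => /=;
  rewrite mulNr cosN sinN; ring.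
Qed.

Lemma normc_qpow a : normc (qpow a) = expR (complex.Re a * ln q%:R).
Proof.
rewrite /qpow /cpow normcM normcR ger0_norm ?expR_ge0 //= cos2Dsin2.
by rewrite sqrtr1 mulr1.
Qed.

Lemma Re_qpow a : complex.Re (qpow a) =
  expR (complex.Re a * ln q%:R) * cos (complex.Im a * ln q%:R).
Proof. by rewrite /qpow /cpow /= mul0r subr0. Qed.

Lemma qpow1 : qpow 1 = q%:R.
Proof.
rewrite /qpow /cpow /= mul0r mul1r cos0 sin0 lnK ?posrE ?ltr0n ?(ltnW q2) //.
rewrite -[RHS]mulr1 -(rmorph_nat (real_complex R)); congr (_ * _).
Qed.

(** The factor that [wave_plus] gains when the height rises by one. Everything that follows is
    rational in [uwave] and [vwave], whose product is [q], so that identities become field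
    identities. *)
Definition uwave (s : R) : R[i] := qpow (2^-1 +i* s).
Definition vwave (s : R) : R[i] := qpow (2^-1 -i* s).

Lemma conjc_uwave s : conjc (uwave s) = vwave s.
Proof. by rewrite conjc_qpow. Qed.

Lemma conjc_vwave s : conjc (vwave s) = uwave s.
Proof. by rewrite -conjc_uwave conjcK. Qed.

Lemma uwave_neq0 s : uwave s != 0. Proof. exact: qpow_neq0. Qed.

Lemma vwave_neq0 s : vwave s != 0. Proof. exact: qpow_neq0. Qed.

Lemma uvwave s : uwave s * vwave s = q%:R.
Proof.
rewrite -qpowD -qpow1; congr qpow; apply: complex_eqP => /=; last by rewrite subrr.
by rewrite [RHS](splitr 1) mul1r.
Qed.

Lemma q_neq0 : (q%:R : R[i]) != 0.
Proof. by rewrite -(uvwave 0) mulf_neq0 ?uwave_neq0 ?vwave_neq0. Qed.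

Lemma uwaveE s : uwave s =
  (Num.sqrt q%:R)%:C * (cos (s * ln q%:R) +i* sin (s * ln q%:R)).
Proof.
rewrite /uwave /qpow /cpow /=; congr (_%:C * _).
apply/eqP; rewrite -(@eqrXn2 _ 2) ?sqrtr_ge0 ?expR_ge0 //.
rewrite sqr_sqrtr ?ler0n // -expRM_natl mulrA mulfV ?mul1r ?pnatr_eq0 //.
by rewrite lnK ?posrE ?ltr0n ?(ltnW q2).
Qed.

Lemma uDvwave s : uwave s + vwave s =
  (2 * Num.sqrt q%:R * cos (s * ln q%:R))%:C.
Proof.
rewrite -conjc_uwave uwaveE; apply: complex_eqP => /=; ring.
Qed.

(** The square has modulus [q], which is not 1; so this denominator never vanishes, the endpoints of
    [[0, tau]] included. *)
Lemma sqr_uwave_neq1 s : uwave s ^+ 2 - 1 != 0.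
Proof.
apply: contraTneq (lnq_gt0) => /eqP; rewrite subr_eq0 => /eqP e.
have : normc (uwave s ^+ 2) = 1 by rewrite e normc1.
rewrite expr2 normcM normc_qpow /= -expRD -mulrDl [2^-1 + _](_ : _ = 1) ?mul1r;
  last by rewrite [RHS](splitr 1) mul1r.
by move/(congr1 (@ln R)); rewrite expRK ln1 => ->; rewrite ltxx.
Qed.

Lemma sqr_vwave_neq1 s : vwave s ^+ 2 - 1 != 0.
Proof.
have := sqr_uwave_neq1 s; apply: contra_neq => e.
by rewrite -conjc_vwave -conjcX -[1]conjc1 -conjcB e conjc0.
Qed.

Lemma normc_uwave s : normc (uwave s) = Num.sqrt q%:R.
Proof.
rewrite uwaveE normcM normcR ger0_norm ?sqrtr_ge0 //=.
by rewrite cos2Dsin2 sqrtr1 mulr1.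
Qed.

(* [plancherel_wave] is q / ((q + 1) c(s)), with value 0 when c(s) has a pole. *)
Definition plancherel_wave (s : R) : R[i] :=
  uwave s * (uwave s - vwave s) / (uwave s ^+ 2 - 1).

Lemma conjc_plancherel_wave s : conjc (plancherel_wave s) =
  vwave s * (vwave s - uwave s) / (vwave s ^+ 2 - 1).
Proof.
rewrite /plancherel_wave -conjc_uwave; move: (uwave s) => u.
by rewrite !(conjcM, conjc_inv, conjcB, conjcX) conjcK conjc1.
Qed.

(** This linearises the density: the squared modulus of [1 / c(s)] becomes, up to a constant, a sum
    of two conjugate terms. *)
Lemma plancherel_wave_sum s : plancherel_wave s + conjc (plancherel_wave s) =
  (q%:R + 1) / q%:R * (plancherel_wave s * conjc (plancherel_wave s)).
Proof.
rewrite conjc_plancherel_wave /plancherel_wave -(uvwave s).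
have := uwave_neq0 s; have := vwave_neq0 s; have := sqr_uwave_neq1 s.
have := sqr_vwave_neq1 s; move: (uwave s) (vwave s) => u v v1 u1 v0 u0.
by field; rewrite u0 v0 u1 v1.
Qed.

Lemma cfunE s : cfun q s%:C = q%:R / (q%:R + 1) / plancherel_wave s.
Proof.
rewrite /cfun.
have -> : (2^-1)%:C + (0 +i* 1) * s%:C = 2^-1 +i* s :> R[i].
  by apply: complex_eqP => /=; ring.
have -> : - (2^-1)%:C - (0 +i* 1) * s%:C = - (2^-1 +i* s) :> R[i].
  by apply: complex_eqP => /=; ring.
have r0 : (Num.sqrt q%:R : R)%:C != 0.
  by rewrite realc_eq0 sqrtr_eq0 -ltNge ltr0n (ltnW q2).
have es t : qpow ((0 +i* 1) * t%:C) = uwave t / (Num.sqrt q%:R)%:C.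
  rewrite uwaveE mulrAC divff // mul1r /qpow /cpow /=.
  by apply: complex_eqP => /=;
    rewrite !(mul0r, mulr0, mulr1, mul1r, subr0, sub0r, oppr0, expR0, addr0, add0r, mulN1r).
have -> : - ((0 +i* 1) * s%:C) = (0 +i* 1) * (- s)%:C :> R[i].
  by apply: complex_eqP => /=; ring.
rewrite qpowN !es -/(uwave s).
have -> : uwave (- s) = vwave s by [].
have r2 : (Num.sqrt q%:R : R)%:C ^+ 2 = uwave s * vwave s.
  by rewrite uvwave -realcX sqr_sqrtr ?ler0n // natc.
rewrite /plancherel_wave realcM realcV natc -natr1 -(uvwave s) -r2.
(* At a pole of the c-function the convention [x / 0 = 0] makes both sides 0. *)
have [->|neq] := eqVneq (uwave s) (vwave s).
  by rewrite !subrr !(mul0r, mulr0, invr0).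
have q1 : (Num.sqrt q%:R : R)%:C ^+ 2 + 1 != 0.
  by rewrite r2 uvwave natr1 pnatr_eq0.
move: neq; rewrite -subr_eq0 => neq.
have := uwave_neq0 s; have := sqr_uwave_neq1 s; move: neq q1 r0 {r2}.
move: (uwave s) (vwave s) (Num.sqrt _)%:C => u v r uv r1 r0 u1 u0.
by field; rewrite u0 u1 r0 uv r1.
Qed.

(** By [cfunE] the density is [2 * cP * ((q + 1) / q) ^+ 2] times the squared modulus of
    [plancherel_wave]. The constant equals [ln q / (2 * pi)] times [(q + 1) / q], and
    [plancherel_wave_sum] absorbs the last factor. *)
Lemma plancherel_densityE s : (plancherel_density q s)%:C =
  (ln q%:R / (2 * pi))%:C * (plancherel_wave s + conjc (plancherel_wave s)).
Proof.
have q0 : (q%:R : R) != 0 by rewrite pnatr_eq0 -lt0n (ltnW q2).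
have q1 : (q%:R + 1 : R) != 0 by rewrite natr1 pnatr_eq0.
rewrite plancherel_wave_sum mul_conjc.
have -> : (q%:R + 1) / q%:R = ((q%:R + 1) / q%:R : R)%:C :> R[i].
  by rewrite realcM realcV realcD !natc.
rewrite -!realcM; congr (_%:C).
rewrite /plancherel_density cfunE; move: (plancherel_wave s) => W.
have nE n : normc (n%:R : R[i]) = n%:R by rewrite -natc normcR normr_nat.
rewrite natr1 !(normcM, normcV) !nE -[q.+1%:R]natr1; move: (normc W : R) => N.
rewrite /cP -[q.+1%:R]natr1; have pi0 : (pi : R) != 0 by rewrite gt_eqF ?pi_gt0.
have [->|N0] := eqVneq N 0; first by rewrite invr0 mulr0 expr0n /= invr0 !mulr0.
by move: (pi : R) pi0 => P P0; field; rewrite q0 q1 P0 N0.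
Qed.

End QPow.

Local Opaque uwave vwave qpow.

Section BoundedMeasurable.
Variables (R : realType) (d : measure_display) (T : measurableType d).
Variable (D : set T).
Implicit Types f g : T -> R[i].

(** An algebra that contains the waves, the cylinders, the density and the powers of [u] and [u^-1].
    As [OmegaTau] has finite measure, membership gives integrability. *)
Definition bmeasurable f := cmeasurable D f /\ cbounded D f.

Lemma bmeasurable_cst c : bmeasurable (fun=> c).
Proof. by split; [exact: cmeasurable_cst|exact: cbounded_cst]. Qed.

Lemma eq_bmeasurable f g : (forall t, g t = f t) -> bmeasurable f -> bmeasurable g.
Proof. by move=> fg; rewrite (_ : g = f) //; exact/funext. Qed.

Lemma bmeasurableD f g : bmeasurable f -> bmeasurable g ->
  bmeasurable (fun t => f t + g t).
Proof. by move=> [? ?] [? ?]; split; [exact: cmeasurableD|exact: cboundedD]. Qed.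

Lemma bmeasurableM f g : bmeasurable f -> bmeasurable g ->
  bmeasurable (fun t => f t * g t).
Proof. by move=> [? ?] [? ?]; split; [exact: cmeasurableM|exact: cboundedM]. Qed.

Lemma bmeasurableB f g : bmeasurable f -> bmeasurable g ->
  bmeasurable (fun t => f t - g t).
Proof.
move=> bf bg; under eq_fun do rewrite -mulN1r.
exact: bmeasurableD bf (bmeasurableM (bmeasurable_cst _) bg).
Qed.

Lemma bmeasurableX f n : bmeasurable f -> bmeasurable (fun t => f t ^+ n).
Proof.
move=> bf; elim: n => [|n IH]; first exact: bmeasurable_cst.
by under eq_fun do rewrite exprS; exact: bmeasurableM.
Qed.

Lemma bmeasurableJ f : bmeasurable f -> bmeasurable (fun t => conjc (f t)).
Proof.
move=> [mf [M fM]]; split; first exact: cmeasurableJ.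
by exists M => t Dt; rewrite normcJ fM.
Qed.

Lemma bmeasurable_sum I (s : seq I) (f : I -> T -> R[i]) :
  (forall i, bmeasurable (f i)) -> bmeasurable (fun t => \sum_(i <- s) f i t).
Proof.
move=> bf; split; first by apply: cmeasurable_sum => i; case: (bf i).
by apply: cbounded_sum => i; case: (bf i).
Qed.

End BoundedMeasurable.

Section Waves.
Variables (R : realType) (q : nat) (X : homTree q) (o : X).
Local Notation u := (@uwave R q).
Local Notation v := (@vwave R q).
Local Notation OT := (@OmegaTau R q X o).
Local Notation plus := (fun x (p : Omega o * measurableTypeR R) => wave_plus p.1 p.2 x).
Let q2 : (2 <= q)%N := homTree_q X.
Implicit Types (w : Omega o) (s : R) (x y : X).

Lemma conjc_wave_plus w s x : conjc (wave_plus w s x) = wave_minus w s x.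
Proof.
rewrite /wave_plus /wave_minus conjc_qpow; congr qpow.
by apply: complex_eqP => /=; ring.
Qed.

Lemma conjc_wave_minus w s x : conjc (wave_minus w s x) = wave_plus w s x.
Proof. by rewrite -conjc_wave_plus conjcK. Qed.

Lemma wave_plus_root w s : wave_plus w s o = 1.
Proof. by rewrite /wave_plus height_root mulr0 qpow0. Qed.

Lemma wave_minus_neq0 w s x : wave_minus w s x != 0.
Proof. exact: qpow_neq0. Qed.

Lemma wave_plusS w s x y : height R w x = height R w y + 1 ->
  wave_plus w s x = wave_plus w s y * u s.
Proof. by move=> e; rewrite /wave_plus e realcD mulrDr mulr1 qpowD. Qed.

Lemma uwaveX s n : u s ^+ n = qpow q ((2^-1 +i* s) * (n%:R : R)%:C).
Proof.
rewrite natc; elim: n => [|n IH]; first by rewrite mulr0 qpow0.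
by rewrite -[n.+1%:R]natr1 mulrDr mulr1 qpowD -IH exprSr.
Qed.

Lemma wave_plus_through w s x : through o x w -> wave_plus w s x = u s ^+ dist o x.
Proof. by move=> xw; rewrite uwaveX /wave_plus height_through. Qed.

Lemma wave_plus_cylinder w s x y : through o x w ->
  x = y \/ dist o y <> (dist o x + dist x y)%N ->
  wave_plus w s y * u s ^+ dist x y = u s ^+ dist o x.
Proof.
move=> xw xy; rewrite /wave_plus !uwaveX -qpowD -mulrDr -realcD.
by rewrite (height_cylinder R xw xy) subrK.
Qed.

Definition cylinder x (p : Omega o * measurableTypeR R) : R[i] :=
  (\1_(through o x) p.1)%:C.

Lemma cylinder_root p : cylinder o p = 1.
Proof.
by rewrite /cylinder indicE mem_set //=; exists 0%N; rewrite ray0.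
Qed.

(** On the cylinder of [x] both waves are powers of [u], and the correction is
    [u ^+ (k + 2) - u ^+ k] with [k = dist o y]; off the cylinder [height_off] applies. *)
Lemma wave_plus_child (p : Omega o * measurableTypeR R) x y : adj x y ->
  dist o x = (dist o y).+1 ->
  u p.2 * wave_plus p.1 p.2 x =
  wave_plus p.1 p.2 y + cylinder x p * ((u p.2 ^+ 2 - 1) * u p.2 ^+ dist o y).
Proof.
case: p => w s /= xy e; rewrite /cylinder indicE; case: (boolP (w \in _)) => /=.
  rewrite inE => xw; rewrite (wave_plus_through s xw).
  rewrite (wave_plus_through s (through_parent xy e xw)) e exprS rmorph1; ring.
rewrite notin_setE => nxw; rewrite rmorph0 mul0r addr0.
rewrite (@wave_plusS w s y x) ?(height_off R xy e nxw) ?subrK //.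
exact: mulrC.
Qed.

(** One neighbour is higher by one and contributes the factor [u]; each of the other [q] is lower by
    one and contributes [u^-1 = v / q]. By [uDvwave] the eigenvalue is a multiple of
    [cos (s * ln q)]. *)
Lemma wave_plus_neighbours w s x (r : seq X) : uniq r -> size r = q.+1 ->
  (forall y, adj x y = (y \in r)) ->
  \sum_(y <- r) wave_plus w s y = (u s + v s) * wave_plus w s x.
Proof.
move=> ur sr rP; have [p pr [hp hr]] := height_neighbours w R ur rP.
rewrite (big_rem p) //= (wave_plusS s hp) mulrDl [u s * _]mulrC; congr (_ + _).
rewrite (eq_big_seq (fun=> wave_plus w s x * (v s / q%:R))); last first.
  move=> y; rewrite mem_rem_uniq // inE => /andP[yp yr].
  have e : wave_plus w s x = wave_plus w s y * u s.
    by apply: wave_plusS; rewrite (hr y yr yp) subrK.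
  have e1 : u s * (v s / q%:R) = 1 by rewrite mulrA uvwave // divff // q_neq0.
  by rewrite e -mulrA e1 mulr1.
rewrite big_const_seq count_predT size_rem // sr /= iter_addr_0.
by rewrite -[LHS]mulr_natr -mulrA divfK ?q_neq0 // mulrC.
Qed.

Lemma measurable_OmegaTau : measurable OT.
Proof. by apply: measurableX => //; exact: measurable_itv. Qed.

Lemma measurable_through x : measurable (through o x : set (Omega o)).
Proof. by apply: sub_sigma_algebra; exists x. Qed.

Lemma bmeasurable_cylinder x : bmeasurable OT (cylinder x).
Proof.
split.
  apply: cmeasurable_real; apply: measurableT_comp (measurable_funTS measurable_fst).
  by apply: measurable_indic; exact: measurable_through.
by exists 1 => p _; rewrite normcR ger0_norm // indicE lern1 leq_b1.
Qed.

Lemma bmeasurable_snd (f : R -> R[i]) M :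
  continuous (fun s => complex.Re (f s)) -> continuous (fun s => complex.Im (f s)) ->
  (forall s, normc (f s) <= M) -> bmeasurable OT (fun p => f p.2).
Proof.
move=> f1 f2 fM; split; last by exists M.
have key (g : R -> R) : continuous g ->
    measurable_fun OT (fun p : Omega o * measurableTypeR R => g p.2).
  move=> /continuous_measurable_fun mg.
  exact: (measurableT_comp mg (measurable_funTS measurable_snd)).
by split; [exact: key f1|exact: key f2].
Qed.

Lemma bmeasurable_uwave : bmeasurable OT (fun p => u p.2).
Proof.
apply: (@bmeasurable_snd _ (Num.sqrt q%:R)) => [s|s|s]; last by rewrite normc_uwave.
  under eq_fun do rewrite uwaveE // /= mul0r subr0.
  apply: cvgMl_tmp; apply: continuous_comp; last exact: continuous_cos.
  exact: mulrr_continuous.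
under eq_fun do rewrite uwaveE // /= mul0r addr0.
apply: cvgMl_tmp; apply: continuous_comp; last exact: continuous_sin.
exact: mulrr_continuous.
Qed.

Lemma bmeasurable_vwave : bmeasurable OT (fun p => v p.2).
Proof.
apply: eq_bmeasurable (bmeasurableJ bmeasurable_uwave) => p.
by rewrite conjc_uwave.
Qed.

Lemma bmeasurable_invuwave : bmeasurable OT (fun p => (u p.2)^-1).
Proof.
apply: eq_bmeasurable (bmeasurableM bmeasurable_vwave (bmeasurable_cst _ q%:R^-1)).
move=> p; apply: (mulfI (uwave_neq0 q p.2)).
by rewrite divff ?uwave_neq0 // mulrA uvwave // divff // q_neq0.
Qed.

(** By induction on the level, [wave_plus_child] builds each wave from indicators of cylinders and
    powers of [u]; the limit that defines [height] never has to be shown measurable. *)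
Lemma bmeasurable_wave_plus x : bmeasurable OT (plus x).
Proof.
have [n] := ubnP (dist o x); elim: n x => // n IH x; rewrite ltnS => xn.
have [->|xo] := eqVneq x o.
  by apply: eq_bmeasurable (bmeasurable_cst _ 1) => p; exact: wave_plus_root.
have [y xy e] := closer_neighbour xo.
apply: (@eq_bmeasurable _ _ _ _ (fun p => (u p.2)^-1 * (wave_plus p.1 p.2 y +
    cylinder x p * ((u p.2 ^+ 2 - 1) * u p.2 ^+ dist o y)))) => [p|].
  by rewrite -wave_plus_child // mulKf ?uwave_neq0.
apply: bmeasurableM bmeasurable_invuwave _.
apply: bmeasurableD; first by apply: IH; rewrite -e.
apply: bmeasurableM (bmeasurable_cylinder x) _.
apply: bmeasurableM (bmeasurableX _ bmeasurable_uwave).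
exact: bmeasurableB (bmeasurableX _ bmeasurable_uwave) (bmeasurable_cst _ _).
Qed.

Lemma bmeasurable_wave_minus x :
  bmeasurable OT (fun p => wave_minus p.1 p.2 x).
Proof.
apply: eq_bmeasurable (bmeasurableJ (bmeasurable_wave_plus x)) => p.
by rewrite conjc_wave_plus.
Qed.

Lemma bmeasurable_invsqr : bmeasurable OT (fun p => (u p.2 ^+ 2 - 1)^-1).
Proof.
have [mu2 _] := bmeasurableB (bmeasurableX 2 bmeasurable_uwave) (bmeasurable_cst _ 1).
split; first by apply: cmeasurableV mu2 _ => p _; exact: sqr_uwave_neq1.
exists 1 => p _; rewrite normcV invf_le1; last first.
  by rewrite lt_neqAle eq_sym normc_eq0 normc_ge0 sqr_uwave_neq1.
(* Since [u ^+ 2] has modulus [q >= 2], the difference [u ^+ 2 - 1] has modulus at least 1. *)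
have := le_normcD (u p.2 ^+ 2 - 1) 1; rewrite subrK normc1.
rewrite expr2 normcM !normc_uwave // -expr2 sqr_sqrtr ?ler0n //.
rewrite -lerBlDr; apply: le_trans; rewrite lerBrDr -[leLHS]/(2%:R) ler_nat //.
Qed.

Lemma bmeasurable_plancherel_wave : bmeasurable OT (fun p => plancherel_wave q p.2).
Proof.
apply: bmeasurableM bmeasurable_invsqr; apply: bmeasurableM bmeasurable_uwave _.
exact: bmeasurableB bmeasurable_uwave bmeasurable_vwave.
Qed.

Lemma bmeasurable_density : bmeasurable OT (fun p => (plancherel_density q p.2)%:C).
Proof.
apply: eq_bmeasurable => [p|]; first exact: plancherel_densityE.
apply: bmeasurableM (bmeasurable_cst _ _) _.
apply: bmeasurableD bmeasurable_plancherel_wave _.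
exact: bmeasurableJ bmeasurable_plancherel_wave.
Qed.

Lemma plancherel_density_ge0 s : 0 <= plancherel_density q s.
Proof.
rewrite /plancherel_density mulr_ge0 ?invr_ge0 ?sqr_ge0 //.
rewrite mulr_ge0 // /cP divr_ge0 ?mulr_ge0 ?ler0n ?pi_ge0 ?ltW ?lnq_gt0 //.
Qed.

Lemma sin_lnq_gt0 s : 0 < s < tau R q -> 0 < sin (s * ln q%:R).
Proof.
move=> /andP[s0 st]; apply: sin_gt0_pi; rewrite mulr_gt0 ?lnq_gt0 //=.
by rewrite -ltr_pdivlMr ?lnq_gt0.
Qed.

(** [plancherel_wave] vanishes only where [u = v], and the imaginary part of [u] is a positive
    multiple of [sin (s * ln q)]. *)
Lemma plancherel_density_gt0 s : 0 < s < tau R q -> 0 < plancherel_density q s.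
Proof.
move=> /sin_lnq_gt0 s0; rewrite lt_neqAle plancherel_density_ge0 andbT eq_sym.
rewrite -realc_eq0 plancherel_densityE // plancherel_wave_sum // mul_conjc.
have q0 : (q%:R : R[i]) + 1 != 0 by rewrite natr1 pnatr_eq0.
have W0 : plancherel_wave q s != 0.
  rewrite mulf_neq0 ?invr_eq0 ?sqr_uwave_neq1 // mulf_neq0 ?uwave_neq0 //.
  rewrite -conjc_uwave uwaveE //; apply/eqP => /(congr1 (@complex.Im R)) /=.
  have r0 : 0 < Num.sqrt q%:R :> R by rewrite sqrtr_gt0 ltr0n (ltnW q2).
  by have := mulr_gt0 r0 s0; lra.
rewrite !mulf_neq0 ?invr_eq0 ?q_neq0 ?realc_eq0 ?sqrf_eq0 ?normc_eq0 //.
by rewrite mulf_neq0 ?gt_eqF ?lnq_gt0 ?invr_gt0 ?mulr_gt0 ?pi_gt0.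
Qed.

End Waves.
Arguments measurable_OmegaTau {R q X o}.
Arguments bmeasurable_uwave {R q X o}.
Arguments bmeasurable_vwave {R q X o}.
Arguments bmeasurable_invuwave {R q X o}.
Arguments bmeasurable_invsqr {R q X o}.
Arguments bmeasurable_plancherel_wave {R q X o}.
Arguments bmeasurable_density {R q X o}.

(** * Integrals over rectangles in [Omega x [0, tau]] *)

Section BaseIntegral.
Variables (R : realType) (q : nat) (X : homTree q) (o : X).
Variable nu : probability (Omega o) R.
Local Notation OT := (@OmegaTau R q X o).
Local Notation m := (base_measure nu).
Local Notation leb := (@lebesgue_measure R).
Let q2 : (2 <= q)%N := homTree_q X.

Lemma base_measureX (A : set (Omega o)) (B : set (measurableTypeR R)) :
  measurable A -> measurable B -> m (A `*` B) = (nu A * leb B)%E.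
Proof. by move=> mA mB; rewrite /base_measure /= product_measure1E. Qed.

Lemma base_measure_OmegaTau : m OT = (tau R q)%:E.
Proof.
rewrite base_measureX //.
by rewrite probability_setT mul1e lebesgue_measure_itv /= lte_fin tau_gt0 // sube0.
Qed.

Lemma base_measure_lty : (m OT < +oo)%E.
Proof. by rewrite base_measure_OmegaTau ltry. Qed.

Lemma bmeasurable_cintegrable f : bmeasurable OT f -> cintegrable m OT f.
Proof.
move=> [mf bf]; apply: cintegrable_bounded mf bf; last exact: base_measure_lty.
exact: measurable_OmegaTau.
Qed.

Lemma Rintegral_rectangle (A : set (Omega o)) (g : R -> R) : measurable A ->
  m.-integrable OT (fun p => (g p.2)%:E) ->
  Rintegral m OT (fun p => \1_A p.1 * g p.2) =
  fine (nu A) * Rintegral leb `[0, tau R q] g.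
Proof.
move=> mA ig; pose f := (fun p : Omega o * measurableTypeR R => (\1_A p.1 * g p.2)%:E) \_ OT.
have m1 : measurable_fun OT (fun p : Omega o * measurableTypeR R => \1_A p.1 : R).
  by apply: measurable_funTS; apply: measurableT_comp measurable_fst;
    apply: measurable_indic.
have mg : measurable_fun OT (fun p : Omega o * measurableTypeR R => g p.2).
  by apply/measurable_EFinP; exact: measurable_int ig.
have iA : m.-integrable OT (fun p => (\1_A p.1 * g p.2)%:E).
  apply: le_integrable ig => //; first exact: measurable_OmegaTau.
    apply/measurable_EFinP; exact: measurable_funM.
  by move=> p _; rewrite /= lee_fin normrM ler_piMl // ger0_norm.
have If : m.-integrable setT f.
    exact/(integrable_mkcond _ measurable_OmegaTau).1.
rewrite /Rintegral integral_mkcond -/f -(integral12_prod_meas1 If).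
have -> : fubini_F leb f =
    (cst (\int[leb]_(s in `[0%R, tau R q]) (g s)%:E)%E) \_ A.
  apply/funext => w; rewrite /fubini_F [RHS]patchE.
  transitivity (\int[leb]_(s in `[0%R, tau R q]) (\1_A w * g s)%:E)%E.
    rewrite [RHS]integral_mkcond; apply: eq_integral => s _.
    rewrite /f !patchE; congr (if _ then _ else _).
    by apply/idP/idP; rewrite !inE // => -[].
  rewrite indicE; case: ifPn => _.
    by apply: eq_integral => s _; rewrite mul1r.
  by rewrite integral0_eq // => s _; rewrite mul0r.
rewrite -integral_mkcond integral_cst //.
set x := (X in fine (_ * X)); have xf : x \is a fin_num := fin_num_measure nu A mA.
rewrite -[fine (nu A)]/(fine x); move: x xf => [a| |] // _.
(* The one-dimensional integral is not known to be finite here; [fine] sends infinite values to 0,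
   so both sides vanish in those cases. *)
case: (\int[leb]_(s in _) (g s)%:E)%E => [r| |] /=; first by rewrite mulrC.
  by rewrite mulr0 mulyr /=; case: sgrP => _; rewrite ?mul0e ?mul1e ?mulN1e.
by rewrite mulr0 mulNyr /=; case: sgrP => _; rewrite ?mul0e ?mul1e ?mulN1e.
Qed.

Lemma cintegral_rectangle (A : set (Omega o)) (g : R -> R[i]) : measurable A ->
  bmeasurable OT (fun p => g p.2) ->
  cintegral m OT (fun p => (\1_A p.1)%:C * g p.2) =
  (fine (nu A))%:C * (Rintegral leb `[0, tau R q] (fun s => complex.Re (g s)) +i*
                      Rintegral leb `[0, tau R q] (fun s => complex.Im (g s))).
Proof.
move=> mA /bmeasurable_cintegrable[g1 g2].
apply: complex_eqP; rewrite /cintegral ?ReM ?ImM /= mul0r ?subr0 ?addr0.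
  rewrite -(Rintegral_rectangle mA g1); apply: eq_Rintegral => p _.
  by rewrite ReM /= mul0r subr0.
rewrite -(Rintegral_rectangle mA g2); apply: eq_Rintegral => p _.
by rewrite ImM /= mul0r addr0.
Qed.

Lemma cintegral_snd (g : R -> R[i]) : bmeasurable OT (fun p => g p.2) ->
  cintegral m OT (fun p => g p.2) =
  Rintegral leb `[0, tau R q] (fun s => complex.Re (g s)) +i*
  Rintegral leb `[0, tau R q] (fun s => complex.Im (g s)).
Proof.
move=> bg; rewrite -[RHS]mul1r -[1]/((fine 1%E)%:C) -(@probability_setT _ _ _ nu).
rewrite -cintegral_rectangle //; apply: eq_cintegral => p _.
by rewrite indicT rmorph1 mul1r.
Qed.

Lemma cintegral_cylinder x (g : R -> R[i]) : bmeasurable OT (fun p => g p.2) ->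
  cintegral m OT (fun p => cylinder x p * g p.2) =
  (fine (nu (through o x)))%:C * cintegral m OT (fun p => g p.2).
Proof.
by move=> bg; rewrite cintegral_snd // -cintegral_rectangle //; exact: measurable_through.
Qed.

End BaseIntegral.

(** * Orthonormality of the waves *)

Section Spherical.
Variables (R : realType) (q : nat).
Hypothesis q2 : (2 <= q)%N.
Local Notation u := (@uwave R q).
Local Notation v := (@vwave R q).

(* [spherical (dist x y) s] is the integral of
   [wave_plus w s x * wave_minus w s y] over w. *)
Fixpoint spherical (n : nat) (s : R) : R[i] :=
  if n is n'.+1 then
    (spherical n' s + (u s ^+ 2 - 1) * (v s)^-1 ^+ n' / (q%:R + 1)) / u s
  else 1.

(** The recursion is not symmetric in [u] and [v]. The closed formula [key] for
    [(u^-1 - v^-1) * spherical] says exactly that the recursion and its conjugate give the same next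
    term. It stays multiplied out because [u^-1 - v^-1] vanishes at the endpoints. *)
Lemma conjc_spherical n s : conjc (spherical n s) = spherical n s.
Proof.
pose rhs k := ((v s - (v s)^-1) * (u s)^-1 ^+ k -
  (u s - (u s)^-1) * (v s)^-1 ^+ k) / (q%:R + 1).
have u0 := uwave_neq0 q s; have v0 := vwave_neq0 q s.
have q1 : (q%:R + 1 : R[i]) != 0 by rewrite natr1 pnatr_eq0.
have key k : ((u s)^-1 - (v s)^-1) * spherical k s = rhs k.
  rewrite /rhs; elim: k => [|k IH] /=.
    rewrite !expr0 !mulr1; move: q1; rewrite -(uvwave q2 s).
    move: (u s) (v s) u0 v0 => a b a0 b0 ab.
    by field; rewrite a0 b0 ab.
  rewrite mulrA mulrDr IH !exprS; move: (_ ^+ k) (_ ^+ k) => ak bk.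
  move: (u s) (v s) (q%:R + 1) u0 v0 q1 => a b c a0 b0 c0.
  by field; rewrite a0 b0 c0.
elim: n => [|n IH] /=; first exact: conjc1.
transitivity ((spherical n s + (v s ^+ 2 - 1) * (u s)^-1 ^+ n / (q%:R + 1)) / v s).
  rewrite -[in RHS]IH -conjc_uwave; move: (uwave q s) (spherical n s) => a f.
  by rewrite !(conjcM, conjcB, conjcD, conjc_inv, conjcX) conjcK conjc_nat conjc1.
apply/eqP; rewrite -subr_eq0; apply/eqP.
transitivity (rhs n - ((u s)^-1 - (v s)^-1) * spherical n s);
  last by rewrite key subrr.
rewrite /rhs; move: (_ ^+ n) (_ ^+ n) (spherical n s) => uk vk f.
move: (u s) (v s) (q%:R + 1) u0 v0 q1 => a b c a0 b0 c0.
by field; rewrite a0 b0 c0.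
Qed.

(** This is the expansion [c(s) v^-n + c(-s) u^-n] of the spherical function, multiplied by
    [|c(s)|^-2]; in this form no pole of the c-function is left. *)
Lemma density_spherical n s : (plancherel_density q s)%:C * spherical n s =
  (ln q%:R / (2 * pi))%:C *
  (plancherel_wave q s * (u s)^-1 ^+ n + conjc (plancherel_wave q s) * (v s)^-1 ^+ n).
Proof.
elim: n => [|n IH]; first by rewrite !expr0 !mulr1 plancherel_densityE.
rewrite [spherical _ _]/= mulrA mulrDr IH mulrA.
rewrite plancherel_densityE // plancherel_wave_sum // conjc_plancherel_wave.
rewrite /plancherel_wave -(uvwave q2 s) !exprS.
have u0 := uwave_neq0 q s; have v0 := vwave_neq0 q s.
have u1 := sqr_uwave_neq1 q2 s; have v1 := sqr_vwave_neq1 q2 s.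
have q1 : (u s * v s + 1 : R[i]) != 0 by rewrite uvwave // natr1 pnatr_eq0.
move: (_ ^+ n) (_ ^+ n) (_%:C) => ak bk K.
move: (u s) (v s) u0 v0 u1 v1 q1 => a b a0 b0 a1 b1 ab.
by field; rewrite a0 b0 a1 b1 ab.
Qed.

End Spherical.

(** * Reduction of products of two waves to spherical functions *)

Section Orthogonality.
Variables (R : realType) (q : nat) (X : homTree q) (o : X).
Variable nu : probability (Omega o) R.
Hypothesis nuE : forall x : X, x != o ->
  nu (through o x) = (q%:R / ((q.+1)%:R * q%:R ^+ dist o x))%:E.
Local Notation OT := (@OmegaTau R q X o).
Local Notation m := (base_measure nu).
Local Notation u := (@uwave R q).
Local Notation v := (@vwave R q).
Let q2 : (2 <= q)%N := homTree_q X.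
Implicit Types (x y : X) (g : R -> R[i]).

Lemma bmeasurable_invvwave : bmeasurable OT (fun p => (v p.2)^-1).
Proof.
apply: eq_bmeasurable (bmeasurableJ bmeasurable_invuwave) => p.
by rewrite conjc_inv conjc_uwave.
Qed.

Lemma bmeasurable_spherical n : bmeasurable OT (fun p => spherical q n p.2).
Proof.
elim: n => [|n IH] /=; first exact: bmeasurable_cst.
apply: bmeasurableM bmeasurable_invuwave; apply: bmeasurableD IH _.
apply: bmeasurableM (bmeasurable_cst _ _).
apply: bmeasurableM (bmeasurableX _ bmeasurable_invvwave).
exact: bmeasurableB (bmeasurableX _ bmeasurable_uwave) (bmeasurable_cst _ _).
Qed.

(** The correction terms of the wave recursions carry the factor [q ^+ dist o y], which the mass of
    the cylinder cancels up to a constant. This is why the integrals depend on the distance of the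
    two vertices only. *)
Lemma cylinder_mass x y : dist o x = (dist o y).+1 ->
  (fine (nu (through o x)))%:C * q%:R ^+ dist o y = (q%:R + 1 : R[i])^-1.
Proof.
move=> e; have xo : x != o by apply: contra_eq_neq e => ->; rewrite distxx.
rewrite nuE //= e realcM realcV realcM realcX !natc -[q.+1%:R]natr1.
have q1 : (q%:R + 1 : R[i]) != 0 by rewrite natr1 pnatr_eq0.
have q0 := q_neq0 R q2; have qn0 : (q%:R : R[i]) ^+ dist o y != 0 by rewrite expf_neq0.
by rewrite exprS; field; rewrite q0 qn0 q1.
Qed.

Lemma cylinderM x (p : Omega o * measurableTypeR R) (a b : R[i]) :
  (through o x p.1 -> a = b) -> cylinder x p * a = cylinder x p * b.
Proof.
rewrite /cylinder indicE; case: (boolP (_ \in _)) => [|_ _]; last by rewrite !mul0r.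
by rewrite inE => xw /(_ xw) ->.
Qed.

(** This is [wave_plus_child] times its conjugate, with [u * v = q]. On the cylinder the waves of
    [y] are powers of [u] and [v], which evaluates the cross terms. *)
Lemma wave_diag_child x y (p : Omega o * measurableTypeR R) : adj x y ->
  dist o x = (dist o y).+1 ->
  q%:R * (wave_plus p.1 p.2 x * wave_minus p.1 p.2 x) =
  wave_plus p.1 p.2 y * wave_minus p.1 p.2 y +
  cylinder x p * (q%:R ^+ dist o y * (q%:R ^+ 2 - 1)).
Proof.
move=> xy e; rewrite -(uvwave q2 p.2) mulrACA (wave_plus_child p xy e).
have -> : v p.2 * wave_minus p.1 p.2 x = wave_minus p.1 p.2 y +
    cylinder x p * ((v p.2 ^+ 2 - 1) * v p.2 ^+ dist o y).
  rewrite -!conjc_wave_plus -!conjc_uwave -!conjcX -[1]conjc1 -conjcB -!conjcM.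
  rewrite (wave_plus_child p xy e) conjcD; congr (_ + _).
  by rewrite !conjcM conjc_real.
have cc : cylinder x p * cylinder x p = cylinder x p.
  by rewrite /cylinder indicE; case: (_ \in _); rewrite /= ?mulr1 ?mulr0.
have cu : cylinder x p * wave_plus p.1 p.2 y = cylinder x p * u p.2 ^+ dist o y.
  by apply: cylinderM => /(through_parent xy e); exact: wave_plus_through.
have cv : cylinder x p * wave_minus p.1 p.2 y = cylinder x p * v p.2 ^+ dist o y.
  apply: cylinderM => /(through_parent xy e) /(wave_plus_through p.2) h.
  by rewrite -conjc_wave_plus h conjcX conjc_uwave.
rewrite (exprMn _ (u p.2)); move: cc cu cv.
move: (cylinder x p) (wave_plus _ _ _) (wave_minus _ _ _) => c a b.
move: (u p.2 ^+ dist o y) (v p.2 ^+ dist o y) => uk vk.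
move: (u p.2) (v p.2) => {}u {}v cc cu cv.
transitivity (a * b + (c * a * ((v ^+ 2 - 1) * vk) +
  c * b * ((u ^+ 2 - 1) * uk) + c * c * ((u ^+ 2 - 1) * uk * ((v ^+ 2 - 1) * vk)))).
  by ring.
by rewrite cc cu cv; ring.
Qed.

(** As [z] is not below [x], [height_cylinder] makes [wave_minus] at [z] a function of [s] alone on
    the cylinder of [x]. The correction is then an indicator times a function of [s], and its
    integral factors. *)
Lemma wave_prod_child x y z (p : Omega o * measurableTypeR R) : adj x y ->
  dist o x = (dist o y).+1 -> dist o z <> (dist o x + dist x z)%N ->
  dist x z = (dist y z).+1 ->
  wave_plus p.1 p.2 x * wave_minus p.1 p.2 z =
  (u p.2)^-1 * (wave_plus p.1 p.2 y * wave_minus p.1 p.2 z) +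
  cylinder x p * (q%:R ^+ dist o y *
    ((u p.2 ^+ 2 - 1) * (v p.2)^-1 ^+ dist y z / u p.2)).
Proof.
move=> xy e nxz exz; have u0 := uwave_neq0 q p.2; have v0 := vwave_neq0 q p.2.
have -> : wave_plus p.1 p.2 x = (u p.2)^-1 * (wave_plus p.1 p.2 y +
    cylinder x p * ((u p.2 ^+ 2 - 1) * u p.2 ^+ dist o y)).
  by rewrite -wave_plus_child // mulKf.
transitivity ((u p.2)^-1 * (wave_plus p.1 p.2 y * wave_minus p.1 p.2 z) +
    cylinder x p * ((u p.2)^-1 * ((u p.2 ^+ 2 - 1) * u p.2 ^+ dist o y) *
      wave_minus p.1 p.2 z)); first by ring.
congr (_ + _); apply: cylinderM => xw.
have := congr1 conjc (wave_plus_cylinder p.2 xw (or_intror nxz)).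
rewrite conjcM !conjcX conjc_uwave conjc_wave_plus exz e => h.
have -> : wave_minus p.1 p.2 z = v p.2 ^+ dist o y * (v p.2)^-1 ^+ dist y z.
  apply: (mulIf (expf_neq0 (dist y z).+1 v0)); rewrite h !exprS exprVn.
  have := expf_neq0 (dist y z) v0; move: (_ ^+ dist y z) (_ ^+ dist o y) => a b a0.
  by rewrite mulrCA divfK // mulrC.
rewrite -(uvwave q2 p.2) (exprMn _ (u p.2)).
move: (u p.2 ^+ dist o y) (v p.2 ^+ dist o y) (_ ^+ dist y z) => a b c.
by move: (_^-1) => d; ring.
Qed.

(** Induction on the sum of the two levels: a vertex that does not have the other one below it is
    replaced by its parent. The weight [g] is arbitrary because each such step multiplies it by
    [u^-1]. *)
Lemma cintegral_waves_ordered n : forall x y, (dist o x + dist o y < n)%N ->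
  forall g, bmeasurable OT (fun p => g p.2) ->
  cintegral m OT (fun p => g p.2 * (wave_plus p.1 p.2 x * wave_minus p.1 p.2 y)) =
  cintegral m OT (fun p => g p.2 * spherical q (dist x y) p.2).
Proof.
have mOT := @measurable_OmegaTau R q X o.
elim: n => // n IH x y; rewrite ltnS => xyn g bg.
have bw z z' : bmeasurable OT (fun p => wave_plus p.1 p.2 z * wave_minus p.1 p.2 z').
  by apply: bmeasurableM; [exact: bmeasurable_wave_plus|exact: bmeasurable_wave_minus].
have child z z' t : adj z z' -> dist o z = (dist o z').+1 ->
    dist o t <> (dist o z + dist z t)%N -> (dist o z + dist o t <= n)%N ->
    forall g, bmeasurable OT (fun p => g p.2) ->
    cintegral m OT (fun p => g p.2 * (wave_plus p.1 p.2 z * wave_minus p.1 p.2 t)) =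
    cintegral m OT (fun p => g p.2 * spherical q (dist z t) p.2).
  move=> zz' e nzt ztn g' bg'.
  (* Otherwise a geodesic from [o] through [z'] and [z] would continue to [t], and [t] would be
     below [z]. *)
  have ezt : dist z t = (dist z' t).+1.
    rewrite !(dist_sym _ t); have [e'|//] := adj_dist t zz'.
    move: (zz'); rewrite adj_sym => z'z; have := dist_away z'z e e'.
    by rewrite (dist_sym z' t) e' (dist_sym t z); lia.
  pose G s := g' s * ((u s ^+ 2 - 1) * (v s)^-1 ^+ dist z' t / u s).
  have bG : bmeasurable OT (fun p => G p.2).
    apply: bmeasurableM bg' _; apply: bmeasurableM bmeasurable_invuwave.
    apply: bmeasurableM (bmeasurableX _ bmeasurable_invvwave).
    exact: bmeasurableB (bmeasurableX _ bmeasurable_uwave) (bmeasurable_cst _ _).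
  have bgu : bmeasurable OT (fun p => g' p.2 * (u p.2)^-1).
    exact: bmeasurableM bg' bmeasurable_invuwave.
  transitivity (cintegral m OT (fun p =>
      g' p.2 * (u p.2)^-1 * (wave_plus p.1 p.2 z' * wave_minus p.1 p.2 t) +
      cylinder z p * G p.2 * q%:R ^+ dist o z')).
    apply: eq_cintegral => p _; rewrite (wave_prod_child p zz' e nzt ezt) /G.
    by move: (_ ^+ dist o z') (_^-1 ^+ _) (_^-1) => a b c; ring.
  have bcG : bmeasurable OT (fun p => cylinder z p * G p.2).
    by apply: bmeasurableM bG; exact: bmeasurable_cylinder.
  rewrite cintegralD //; last 2 first.
  - by apply: bmeasurable_cintegrable; exact: bmeasurableM.
  - by apply: bmeasurable_cintegrable; exact: bmeasurableM (bmeasurable_cst _ _).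
  rewrite cintegralZr //; last exact: bmeasurable_cintegrable.
  rewrite cintegral_cylinder // mulrAC (cylinder_mass e).
  rewrite (IH z' t _ (fun s => g' s * (u s)^-1)) //; last by rewrite -ltnS -addSn -e ltnS.
  rewrite mulrC -cintegralZr //; last exact: bmeasurable_cintegrable.
  rewrite -cintegralD //; last 2 first.
  - apply: bmeasurable_cintegrable; apply: bmeasurableM bgu _.
    exact: bmeasurable_spherical.
  - by apply: bmeasurable_cintegrable; exact: bmeasurableM (bmeasurable_cst _ _).
  apply: eq_cintegral => p _; rewrite ezt [spherical _ _.+1 _]/= /G.
  by move: ((v p.2)^-1 ^+ _) (_^-1) => a b; ring.
have [exy|nxy] := eqVneq x y.
  rewrite -{}exy distxx in xyn *; have [xo|xo] := eqVneq x o.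
    apply: eq_cintegral => p _; rewrite xo -conjc_wave_plus wave_plus_root.
    by rewrite conjc1 mulr1.
  have [x' xx' e] := closer_neighbour xo.
  (* On the diagonal, after multiplication by [q], the parent contributes the integral of [g] and
     the cylinder contributes [(q ^+ 2 - 1) / (q + 1) = q - 1] times it. *)
  have q0 := q_neq0 R q2; apply: (mulIf q0).
  rewrite -!cintegralZr //; try exact: bmeasurable_cintegrable.
  - transitivity (cintegral m OT (fun p =>
        g p.2 * (wave_plus p.1 p.2 x' * wave_minus p.1 p.2 x') +
        cylinder x p * g p.2 * (q%:R ^+ dist o x' * (q%:R ^+ 2 - 1)))).
      apply: eq_cintegral => p _; rewrite -mulrA [_ * q%:R]mulrC.
      by rewrite (wave_diag_child p xx' e); ring.
    have bc : bmeasurable OT (fun p => cylinder x p * g p.2).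
      by apply: bmeasurableM bg; exact: bmeasurable_cylinder.
    rewrite cintegralD //; last 2 first.
    + by apply: bmeasurable_cintegrable; exact: bmeasurableM.
    + by apply: bmeasurable_cintegrable; exact: bmeasurableM (bmeasurable_cst _ _).
    rewrite cintegralZr //; last exact: bmeasurable_cintegrable.
    rewrite cintegral_cylinder // [_ * (_ * _)]mulrA [_ * q%:R ^+ _]mulrAC.
    rewrite (cylinder_mass e) IH //; last by move: xyn; rewrite e; lia.
    rewrite distxx.
    have q1 : (q%:R + 1 : R[i]) != 0 by rewrite natr1 pnatr_eq0.
    rewrite -mulrA mulrCA -cintegralZr //; last exact: bmeasurable_cintegrable.
    rewrite -cintegralD //; last 2 first.
    + by apply: bmeasurable_cintegrable; exact: bmeasurableM (bmeasurable_cst _ _).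
    + by apply: bmeasurable_cintegrable; exact: bmeasurableM (bmeasurable_cst _ _).
    by apply: eq_cintegral => p _; field; rewrite q1.
  - by apply: bmeasurable_cintegrable; exact: bmeasurableM (bmeasurable_cst _ _).
  - by apply: bmeasurable_cintegrable; exact: bmeasurableM.
(* If [y] is below [x], then [x] is not below [y]: conjugation exchanges the two waves, the step is
   made at [y], and the result is conjugated back because [spherical] is real. *)
have [a|a] := eqVneq (dist o y) (dist o x + dist x y)%N.
  have d0 : (0 < dist x y)%N.
    by rewrite lt0n; apply: contraNneq nxy => /dist0_eq ->.
  have yo : y != o by apply: contra_eq_neq a => yo; rewrite {1}yo distxx; apply/eqP; lia.
  have [y' yy' e] := closer_neighbour yo.
  have nyx : dist o x <> (dist o y + dist y x)%N by rewrite a dist_sym; lia.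
  have bJ : bmeasurable OT (fun p => conjc (g p.2)) by exact: bmeasurableJ.
  have yxn : (dist o y + dist o x <= n)%N by rewrite addnC.
  have := congr1 conjc (child y y' x yy' e nyx yxn (fun s => conjc (g s)) bJ).
  have I1 : cintegrable m OT (fun p => conjc (g p.2) * spherical q (dist y x) p.2).
    apply: bmeasurable_cintegrable; apply: bmeasurableM bJ _.
    exact: bmeasurable_spherical.
  have I2 := bmeasurable_cintegrable nu (bmeasurableM bJ (bw y x)).
  rewrite -(cintegralJ mOT I1) -(cintegralJ mOT I2) => h; transitivity (cintegral m OT (fun p =>
      conjc (conjc (g p.2) * (wave_plus p.1 p.2 y * wave_minus p.1 p.2 x)))).
    apply: eq_cintegral => p _; rewrite 2!conjcM conjcK conjc_wave_plus conjc_wave_minus.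
    by rewrite [wave_minus _ _ _ * _]mulrC.
  rewrite h; apply: eq_cintegral => p _.
  by rewrite conjcM conjcK conjc_spherical // [dist y x]dist_sym.
have xo : x != o by apply: contraNneq a => ->; rewrite distxx.
have [x' xx' e] := closer_neighbour xo.
by apply: child xx' e _ xyn _ bg; exact/eqP.
Qed.

End Orthogonality.

(** * Cosine integrals over half a period *)

Section CosineIntegral.
Variable R : realType.

Lemma sin_natpi n : sin (n%:R * pi : R) = 0.
Proof.
elim: n => [|n IH]; first by rewrite mul0r sin0.
by rewrite -[n.+1%:R]natr1 mulrDl mul1r sinD IH sinpi mul0r mulr0 addr0.
Qed.

Lemma is_derive_sin_scale (a s : R) : a != 0 ->
  is_derive s 1 (fun t => sin (t * a) / a) (cos (s * a)).
Proof.
move=> a0.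
have da : is_derive s 1 (fun t : R => t * a) a.
  by apply: is_derive_eq; rewrite ?scaler0 ?addr0 ?add0r -[RHS]mulr1.
have dc := @is_derive1_comp R sin (fun t => t * a) s _ _ (is_derive_sin _) da.
apply: is_derive_eq.
by rewrite ?scaler0 ?addr0 ?add0r /GRing.scale /=; field.
Qed.

Lemma Rintegral_cos (c a : R) n : 0 < a ->
  Rintegral lebesgue_measure `[0, pi / a] (fun s => c * cos (s * (n%:R * a))) =
  if n == 0%N then c * (pi / a) else 0.
Proof.
move=> a0; have pa : 0 < pi / a by rewrite divr_gt0 ?pi_gt0.
have [->|n0] := eqVneq n 0%N.
  under eq_Rintegral do rewrite mul0r mulr0 cos0 mulr1.
  rewrite Rintegral_cst //; congr (_ * _).
  transitivity (fine (lebesgue_measure `[0, pi / a]%classic)) => //.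
  by rewrite lebesgue_measure_itv /= lte_fin pa /= subr0.
have na : n%:R * a != 0 by rewrite mulf_neq0 ?pnatr_eq0 // gt_eqF.
have dF (s : R) := is_derive_sin_scale s na.
have cF : continuous (fun t : R => sin (t * (n%:R * a)) / (n%:R * a)).
  by move=> s; apply: differentiable_continuous; apply/derivable1_diffP; case: (dF s).
have cc : continuous (fun t : R => cos (t * (n%:R * a))).
  move=> s; apply: continuous_comp; last exact: continuous_cos.
  exact: mulrr_continuous.
rewrite RintegralZl //; last first.
  apply: continuous_compact_integrable; first exact: segment_compact.
  by apply: continuous_subspaceT.
rewrite /Rintegral (continuous_FTC2 pa (F := fun t : R => sin (t * (n%:R * a)) / (n%:R * a))).
- rewrite /= mul0r sin0 mul0r subr0.
  have -> : pi / a * (n%:R * a) = n%:R * pi by field; rewrite gt_eqF.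
  by rewrite sin_natpi mul0r mulr0.
- exact: continuous_subspaceT.
- split => [s _||]; first by case: (dF s).
    by apply: cvg_at_right_filter; exact: cF.
  by apply: cvg_at_left_filter; exact: cF.
- by move=> s _; rewrite derive1E; case: (dF s).
Qed.

End CosineIntegral.

Section Orthonormality.
Variables (R : realType) (q : nat) (X : homTree q) (o : X).
Variable nu : probability (Omega o) R.
Hypothesis nuE : forall x : X, x != o ->
  nu (through o x) = (q%:R / ((q.+1)%:R * q%:R ^+ dist o x))%:E.
Local Notation OT := (@OmegaTau R q X o).
Local Notation m := (base_measure nu).
Local Notation u := (@uwave R q).
Local Notation v := (@vwave R q).
Let q2 : (2 <= q)%N := homTree_q X.
Let mOT : measurable OT := measurable_OmegaTau.

(** The integrand is [2 * q^(-n/2) * cos (n * s * ln q)], and [tau] is half a period for [n = 1]. *)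
Lemma cintegral_powers n :
  cintegral m OT (fun p => (u p.2)^-1 ^+ n + conjc ((u p.2)^-1 ^+ n)) =
  if n == 0%N then (2 * tau R q)%:C else 0.
Proof.
have b1 : bmeasurable OT (fun p => (u p.2)^-1 ^+ n).
  exact: bmeasurableX bmeasurable_invuwave.
rewrite (@cintegral_snd _ _ _ _ _ (fun s => (u s)^-1 ^+ n + conjc ((u s)^-1 ^+ n)));
  last exact: bmeasurableD b1 (bmeasurableJ b1).
pose c := 2 * expR (- (2^-1 * n%:R * ln q%:R)) : R.
have re s : (u s)^-1 ^+ n + conjc ((u s)^-1 ^+ n) =
    (c * cos (s * (n%:R * ln q%:R)))%:C.
  rewrite addcJ -natc -realcM -(mulrA 2); congr (_%:C); congr (_ * _).
  rewrite exprVn uwaveX // -qpowN Re_qpow /=.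
  rewrite !(mulr0, subr0, addr0, mul0r, oppr0, sub0r) !mulNr cosN.
  by rewrite (mulrA s) add0r.
under eq_Rintegral do rewrite re /=.
rewrite Rintegral_cos ?lnq_gt0 //; apply: complex_eqP => /=.
  by case: ifP => // /eqP e; rewrite /c e mulr0 mul0r oppr0 expR0 mulr1.
under eq_Rintegral do rewrite re /=.
by rewrite Rintegral_cst // mul0r; case: ifP.
Qed.

(** Formally the geometric series of the powers [u^-(n + 2k)]; [plancherel_wave * u^-n] equals
    [H n - q * H n.+2]. *)
Let H n (p : Omega o * measurableTypeR R) : R[i] :=
  (u p.2)^-1 ^+ n * (u p.2 ^+ 2 / (u p.2 ^+ 2 - 1)).

Let bH n : bmeasurable OT (H n).
Proof.
apply: bmeasurableM (bmeasurableX _ bmeasurable_invuwave) _.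
exact: bmeasurableM (bmeasurableX _ bmeasurable_uwave) bmeasurable_invsqr.
Qed.

Let M n := cintegral m OT (fun p => H n p + conjc (H n p)).

(* M n is two-step constant for n > 0 and decays geometrically, hence vanishes. *)
Let M_step n : M n = M n.+2 + (if n == 0%N then (2 * tau R q)%:C else 0).
Proof.
rewrite -cintegral_powers -cintegralD //.
- apply: eq_cintegral => p _; rewrite addrACA -conjcD.
  suff -> : H n p = H n.+2 p + (u p.2)^-1 ^+ n by [].
  rewrite /H !exprS; have u0 := uwave_neq0 q p.2; have u1 := sqr_uwave_neq1 q2 p.2.
  move: (_ ^+ n) u0 u1 => a; move: (u p.2) => b b0 b1.
  by field; rewrite b0 b1.
- by apply: bmeasurable_cintegrable; apply: bmeasurableD (bH _) (bmeasurableJ (bH _)).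
- apply: bmeasurable_cintegrable; apply: bmeasurableD.
    exact: bmeasurableX bmeasurable_invuwave.
  exact: bmeasurableJ (bmeasurableX _ bmeasurable_invuwave).
Qed.

Let M_bound : exists C : R, forall n, normc (M n) <= C / Num.sqrt q%:R ^+ n.
Proof.
have [_ [B hB]] := bmeasurableM (bmeasurableX 2 (@bmeasurable_uwave R q X o)) bmeasurable_invsqr.
(* One factor 2 comes from [normc_cintegral_le], another from adding the conjugate; [tau] is the
   total mass. *)
exists (4 * B * tau R q) => n.
have IH := bmeasurable_cintegrable nu (bmeasurableD (bH n) (bmeasurableJ (bH n))).
apply: le_trans (normc_cintegral_le mOT IH) _.
have : Rintegral m OT (fun p => normc (H n p + conjc (H n p))) <=
    Rintegral m OT (fun=> 2 * B / Num.sqrt q%:R ^+ n).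
  apply: le_Rintegral => //; first exact: integrable_normc.
    apply: measurable_bounded_integrable => //; first exact: base_measure_lty.
    exact: bounded_cst.
  move=> p Dp; apply: le_trans (le_normcD _ _) _; rewrite normcJ.
  suff h : normc (H n p) <= B / Num.sqrt q%:R ^+ n by move: h; lra.
  rewrite /H normcM mulrC ler_pM ?normc_ge0 ?hB //.
  have -> : normc ((u p.2)^-1 ^+ n) = (Num.sqrt q%:R ^+ n)^-1.
    elim: n {IH} => [|k IH]; first by rewrite !expr0 normc1 invr1.
    by rewrite !exprS normcM IH normcV normc_uwave // invfM.
  by [].
rewrite Rintegral_cst // base_measure_OmegaTau /= => h; move: (Rintegral _ _ _) h => I.
lra.
Qed.

Let M_pos n : (0 < n)%N -> M n = 0.
Proof.
move=> n0; have [C hC] := M_bound.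
have Mk k : M n = M (n + k.*2)%N.
  elim: k => [|k IH]; first by rewrite addn0.
  rewrite IH M_step doubleS !addnS -[_ == _]negbK -lt0n ltn_addr //= addr0 //.
apply/eqP; rewrite -normc_eq0 eq_le normc_ge0 andbT leNgt; apply/negP => Mn.
have r1 : 1 <= Num.sqrt q%:R :> R by rewrite -[leLHS]sqrtr1 ler_wsqrtr // ler1n (ltnW q2).
have r0 k : 0 < Num.sqrt q%:R ^+ k :> R by rewrite exprn_gt0 // (lt_le_trans ltr01).
have C0 : 0 <= C.
  by rewrite -(@pmulr_lge0 _ (Num.sqrt q%:R ^+ n)^-1) ?invr_gt0 // (le_trans (normc_ge0 _) (hC n)).
(* With [k > C / normc (M n)], the bound at index [n + 2k] is contradicted by
   [Num.sqrt q ^+ (n + 2k) >= q ^+ k > k]. *)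
have := archi_boundP (divr_ge0 C0 (ltW Mn)); set k := Num.bound _.
rewrite ltr_pdivrMr // ltNge => /negP; apply.
have := hC (n + k.*2)%N; rewrite -Mk ler_pdivlMr // mulrC; apply: le_trans.
rewrite ler_wpM2r ?normc_ge0 // exprD -[leLHS]mul1r ler_pM ?exprn_ege1 //.
rewrite -mul2n exprM sqr_sqrtr ?ler0n // -natrX ler_nat.
by apply: ltnW; apply: leq_ltn_trans (ltn_expl k q2).
Qed.

(** The integral is [ln q / (2 * pi)] times [M n - q * M n.+2] with [n = dist x y]. Only
    [M 0 = 2 * tau] is nonzero, and the constants multiply to 1; this is where the factor 2 in
    [plancherel_density] is needed. *)
Lemma wave_orthonormal x y :
  cintegral m OT (fun p => (plancherel_density q p.2)%:C *
    (wave_plus p.1 p.2 x * wave_minus p.1 p.2 y)) = (x == y)%:R.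
Proof.
rewrite (@cintegral_waves_ordered _ _ _ _ _ nuE _ x y (leqnn _)
  (fun s => (plancherel_density q s)%:C)); last exact: bmeasurable_density.
set n := dist x y.
have -> : (x == y) = (n == 0%N).
  by rewrite /n; apply/eqP/eqP => [->|/dist0_eq//]; rewrite distxx.
transitivity (cintegral m OT (fun p => ((H n p + conjc (H n p)) -
   (H n.+2 p + conjc (H n.+2 p)) * q%:R) * (ln q%:R / (2 * pi))%:C)).
  apply: eq_cintegral => p _; rewrite density_spherical // mulrC; congr (_ * _).
  have e : plancherel_wave q p.2 * (u p.2)^-1 ^+ n = H n p - q%:R * H n.+2 p.
    rewrite /plancherel_wave /H -(uvwave q2 p.2) !exprS.
    have u0 := uwave_neq0 q p.2; have u1 := sqr_uwave_neq1 q2 p.2.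
    move: (_ ^+ n) u0 u1 => a; move: (u p.2) (v p.2) => b c b0 b1.
    by field; rewrite b0 b1.
  have -> : conjc (plancherel_wave q p.2) * (v p.2)^-1 ^+ n =
      conjc (plancherel_wave q p.2 * (u p.2)^-1 ^+ n).
    by rewrite conjcM conjcX conjc_inv conjc_uwave.
  rewrite e; move: (H n p) (H n.+2 p) => a b.
  by rewrite conjcB conjcM conjc_nat; ring.
have I k : cintegrable m OT (fun p => H k p + conjc (H k p)).
  by apply: bmeasurable_cintegrable; apply: bmeasurableD (bH _) (bmeasurableJ (bH _)).
have Iq := cintegrableZr mOT q%:R (I n.+2).
have IB : cintegrable m OT (fun p => (H n p + conjc (H n p)) -
    (H n.+2 p + conjc (H n.+2 p)) * q%:R).
  apply: bmeasurable_cintegrable; apply: bmeasurableB.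
    exact: bmeasurableD (bH _) (bmeasurableJ (bH _)).
  exact: bmeasurableM (bmeasurableD (bH _) (bmeasurableJ (bH _))) (bmeasurable_cst _ _).
rewrite (cintegralZr mOT _ IB) (cintegralB mOT (I n) Iq) (cintegralZr mOT _ (I _)).
rewrite -/(M n) -/(M n.+2) (M_pos (n := n.+2)) // mul0r subr0.
rewrite M_step (M_pos (n := n.+2)) // add0r.
case: ifP => _; last by rewrite mul0r.
have L0 := lnq_gt0 R q2; have p0 := pi_gt0 R.
rewrite -realcM /tau (_ : _ * _ = 1) //; move: p0 L0; move: (pi : R) (ln _) => a b a0 b0.
by field; rewrite !gt_eqF.
Qed.

End Orthonormality.

(** * Completeness of the waves *)

Section ZeroIntegrals.
Variables (R : realType) (d d' : measure_display).
Variables (T : measurableType d) (T' : measurableType d').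
Variables (mu : {measure set T -> \bar R}) (D : set T) (f : T -> R) (h : T -> T').
Hypotheses (mD : measurable D) (If : mu.-integrable D (EFin \o f)).
Hypothesis mh : measurable_fun setT h.

(** The sets whose preimage has zero integral form a Dynkin system, the hypothesis on [D] providing
    the whole space. The map [h] allows one coordinate of a product to be treated at a time. *)
Lemma Rintegral_dynkin (G : set (set T')) : @measurable _ T' = <<s G >> ->
  setI_closed G -> Rintegral mu D f = 0 ->
  (forall A, G A -> Rintegral mu (D `&` h @^-1` A) f = 0) ->
  forall A, measurable A -> Rintegral mu (D `&` h @^-1` A) f = 0.
Proof.
move=> GE GI f0 fG A; rewrite GE => mA.
have mp B : measurable B -> measurable (D `&` h @^-1` B).
  by move=> mB; apply: measurableI => //; rewrite -[_ @^-1` _]setTI; exact: mh.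
have Ip B : measurable B -> mu.-integrable (D `&` h @^-1` B) (EFin \o f).
  by move=> mB; apply: integrableS If => //; exact: mp.
apply: (@dynkin_induction _ T' G (fun B => Rintegral mu (D `&` h @^-1` B) f = 0)) mA => //.
- by rewrite preimage_setT setIT.
- move=> S mS S0; have mSC : measurable (~` S) by exact: measurableC.
  have DE : D = (D `&` h @^-1` S) `|` (D `&` h @^-1` (~` S)).
    by rewrite preimage_setC -setIUr setUv setIT.
  move: f0; rewrite {1}DE Rintegral_setU ?S0 ?add0r //; try exact: mp.
    by rewrite -DE.
  by apply/disj_setPS => t [[_ tS] [_ tnS]].
- move=> F mF tF F0; rewrite preimage_bigcup setI_bigcupr /Rintegral integral_bigcup.
  + rewrite eseries0 // => n _ _; rewrite -[LHS]fineK ?[fine _]F0 //.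
    by apply: integrable_fin_num; [exact: mp|exact: Ip].
  + move=> i j _ _ [t [[_ ti] [_ tj]]]; apply: tF => //.
    by exists (h t).
  + by move=> n; exact: mp.
  + rewrite -setI_bigcupr -preimage_bigcup; apply: Ip.
    exact: bigcupT_measurable.
Qed.

End ZeroIntegrals.

Section Cylinders.
Variables (q : nat) (X : homTree q) (o : X).

(** Climbing from [y] to its ancestors stays on the common ray [w] and reaches [x] at the level of
    [x]. Cylinders that meet are therefore nested. *)
Lemma through_nested (w : ray o) (x y : X) : through o x w -> through o y w ->
  (dist o x <= dist o y)%N -> through o y `<=` through o x.
Proof.
move=> xw; move: {1}(dist o y - dist o x)%N (erefl (dist o y - dist o x)%N) => n.
elim: n y => [|n IH] y ny yw xy.
  have e : dist o x = dist o y by lia.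
  by rewrite -[x](through_eq xw) -[y](through_eq yw) e.
have yo : y != o by apply: contra_eq_neq ny => ->; rewrite distxx.
have [y' yy' e] := closer_neighbour yo.
apply: (@subset_trans _ (through o y')) => [w' yw'|].
  exact: through_parent yy' e yw'.
by apply: IH; [lia|exact: through_parent yy' e yw|lia].
Qed.

(** The empty set joins the generators because disjoint cylinders meet in it and Dynkin induction
    needs closure under intersection. *)
Lemma measurable_cylindersE :
  @measurable _ (Omega o) = <<s range (through o) `|` [set set0] >>.
Proof.
rewrite eqEsubset; split.
  apply: smallest_sub; first exact: smallest_sigma_algebra.
  by move=> A GA; apply: sub_sigma_algebra; left.
apply: smallest_sub; first exact: smallest_sigma_algebra.
by move=> A [GA|->]; [exact: sub_sigma_algebra|exact: measurable0].
Qed.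

Lemma cylinders_setI : setI_closed (range (through o) `|` [set set0]).
Proof.
move=> A B [[x _ <-]|->] [[y _ <-]|->]; rewrite ?set0I ?setI0; try by right.
have [->|/set0P[w [xw yw]]] := eqVneq (through o x `&` through o y) set0.
  by right.
left; have [xy|/ltnW yx] := leqP (dist o x) (dist o y).
  by exists y => //; rewrite setIidr //; exact: through_nested xw yw xy.
by exists x => //; rewrite setIidl //; exact: through_nested yw xw yx.
Qed.

End Cylinders.

Section Rectangles.
Variables (R : realType) (q : nat) (X : homTree q) (o : X).
Variable nu : probability (Omega o) R.
Local Notation OT := (@OmegaTau R q X o).
Local Notation m := (base_measure nu).
Let mOT : measurable OT := measurable_OmegaTau.

(** Three Dynkin inductions: over sets of rays with a half-line fixed, over sets of parameters with
    a set of rays fixed, and from rectangles to all measurable sets. *)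
Lemma Rintegral_cylinders_ae0 (f : Omega o * measurableTypeR R -> R) :
  m.-integrable OT (EFin \o f) ->
  (forall x b, Rintegral m (OT `&` (through o x `*` `]b, +oo[)) f = 0) ->
  {ae m, forall p, OT p -> f p = 0}.
Proof.
move=> If f0.
have mS (B : set (measurableTypeR R)) : measurable B ->
    measurable (OT `&` snd @^-1` B).
  by move=> mB; apply: measurableI => //; rewrite -[_ @^-1` _]setTI;
    exact: measurable_snd.
have mF (A : set (Omega o)) : measurable A -> measurable (OT `&` fst @^-1` A).
  by move=> mA; apply: measurableI => //; rewrite -[_ @^-1` _]setTI;
    exact: measurable_fst.
have root b : OT `&` snd @^-1` `]b, +oo[ = OT `&` (through o o `*` `]b, +oo[).
  apply/seteqP; split=> p [Dp pb]; split=> //; last by case: pb.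
  by split=> //; exists 0%N; rewrite ray0.
have rect A (B : set (measurableTypeR R)) :
    OT `&` snd @^-1` B `&` fst @^-1` A = OT `&` (A `*` B).
  by apply/seteqP; split=> p [] => [[Dp ?] ?|Dp [? ?]].
have rect' A (B : set (measurableTypeR R)) :
    OT `&` fst @^-1` A `&` snd @^-1` B = OT `&` (A `*` B).
  by apply/seteqP; split=> p [] => [[Dp ?] ?|Dp [? ?]].
have s1 b (A : set (Omega o)) : measurable A ->
    Rintegral m (OT `&` (A `*` `]b, +oo[)) f = 0.
  move=> mA; have mb := mS _ (measurable_itv `]b, +oo[).
  rewrite -rect; apply: (Rintegral_dynkin mb _ measurable_fst
    (measurable_cylindersE o) (@cylinders_setI _ _ o)) mA => //.
  - exact: integrableS If.
  - by rewrite root f0.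
  - move=> B [[x _ <-]|->]; first by rewrite rect f0.
    by rewrite preimage_set0 setI0 Rintegral_set0.
have s2 (A : set (Omega o)) (B : set (measurableTypeR R)) :
    measurable A -> measurable B -> Rintegral m (OT `&` (A `*` B)) f = 0.
  move=> mA mB; rewrite -rect'; apply: (Rintegral_dynkin (mF A mA) _ measurable_snd
    (RGenOInfty.measurableE R) _) mB => //.
  - exact: integrableS (mF A mA) _ If.
  - move=> _ _ [a ->] [b ->]; exists (Num.max a b).
    apply/seteqP; split=> t /=; rewrite !in_itv /= !andbT gt_max.
      by move=> [-> ->].
    by move=> /andP[].
  (* Any negative bound would do: the half-line above -1 contains [[0, tau]], so it gives the whole
     fibre over [A]. *)
  - rewrite -(s1 (-1) A mA); congr Rintegral; apply/seteqP; split=> p [Dp]; last by case.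
    move=> Ap; split=> //; split=> //=; case: Dp => _ /=.
    by rewrite !in_itv /= andbT => /andP[p0 _]; exact: lt_le_trans p0.
  - by move=> _ [b ->]; rewrite rect' s1.
have s3 (E : set (Omega o * measurableTypeR R)) : measurable E ->
    Rintegral m (OT `&` E) f = 0.
  move=> mE; apply: (Rintegral_dynkin mOT If (@measurable_id _ _ setT)
    (measurable_prod_measurableType _ _) _) mE.
  - move=> _ _ [A mA [B mB <-]] [A' mA' [B' mB' <-]].
    exists (A `&` A'); first exact: measurableI.
    by exists (B `&` B'); [exact: measurableI|rewrite setXI].
  - by rewrite -[OT]setIT -setXTT s2.
  - by move=> _ [A mA [B mB <-]]; rewrite preimage_id s2.
have := @integral_ae_eq _ _ _ m OT mOT (cst 0%E) (EFin \o f) If.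
move=> /(_ (measurable_cst _)) h.
have : ae_eq m OT (EFin \o f) (cst 0%E).
  apply: h => E ED mE; rewrite integral0 -[LHS]fineK.
    by rewrite -[fine _]/(Rintegral m E f) -(setIidr ED) s3.
  by apply: integrable_fin_num => //; exact: integrableS If.
by apply: filterS => p + Dp => /(_ Dp) [].
Qed.

End Rectangles.

(** * Polynomials that approximate steps and square roots *)

Section PolynomialApproximation.
Variable R : realType.
Implicit Types (x r : R) (n k : nat).

Lemma bernoulli_sub x n : 0 <= x <= 1 -> 1 - n%:R * x <= (1 - x) ^+ n.
Proof.
move=> /andP[x0 x1]; elim: n => [|n IH]; first by rewrite mul0r subr0 expr0.
rewrite exprS; apply: le_trans (ler_wpM2l _ IH); last by rewrite subr_ge0.
rewrite -[n.+1%:R]natr1; have : 0 <= n%:R * x * x by rewrite !mulr_ge0.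
lra.
Qed.

Lemma bernoulli_inv x n : 0 <= x <= 1 -> (1 - x) ^+ n * (1 + n%:R * x) <= 1.
Proof.
move=> /andP[x0 x1].
have : 1 + n%:R * x <= (1 + x) ^+ n.
  elim: n => [|n IH]; first by rewrite mul0r addr0 expr0.
  rewrite exprS; apply: le_trans (ler_wpM2l _ IH); last by rewrite addr_ge0.
  rewrite -[n.+1%:R]natr1; have : 0 <= n%:R * x * x by rewrite !mulr_ge0.
  lra.
move=> h; apply: le_trans (ler_wpM2l _ h) _; first by rewrite exprn_ge0 ?subr_ge0.
by rewrite -exprMn exprn_ile1 //; nra.
Qed.

(* With N = n 2^n the powers (1 - r^n)^N tend to 1 if r < 1/2 and to 0 if r >= 1/2. *)
Definition step_approx n r : R := (1 - r ^+ n) ^+ (n * 2 ^ n).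

Lemma step_approx_itv n r : 0 <= r <= 1 -> 0 <= step_approx n r <= 1.
Proof.
move=> /andP[r0 r1]; have rn0 : 0 <= r ^+ n by exact: exprn_ge0.
have rn1 : r ^+ n <= 1 by exact: exprn_ile1.
by rewrite /step_approx exprn_ge0 ?exprn_ile1 ?subr_ge0 // lerBlDr lerDl.
Qed.

(** Bernoulli for [y = sqrt x] bounds [n * y ^+ n] by [1 / (1 - y)], and the second factor [y ^+ n]
    of [x ^+ n] still tends to 0. *)
Lemma cvg_natM_expr x : 0 <= x < 1 -> n%:R * x ^+ n @[n --> \oo] --> 0.
Proof.
move=> /andP[x0 x1]; have [->|xn0] := eqVneq x 0.
  by apply: cvg_near_cst; apply: nearW => -[|n]; rewrite ?mul0r // expr0n mulr0.
pose y := Num.sqrt x; have xp : 0 < x by rewrite lt_neqAle eq_sym xn0.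
have y0 : 0 < y by rewrite sqrtr_gt0.
have yx : y ^+ 2 = x by rewrite sqr_sqrtr.
have y1 : y < 1 by rewrite -(@ltr_pXn2r _ 2) ?nnegrE ?ltW // yx expr1n.
have bnd n : n%:R * x ^+ n <= y ^+ n * (1 - y)^-1.
  have : (1 - (1 - y)) ^+ n * (1 + n%:R * (1 - y)) <= 1.
    by apply: bernoulli_inv; rewrite subr_ge0 (ltW y1) lerBlDr lerDl ltW.
  rewrite subKr -yx -exprM mulnC exprM expr2 => h.
  have yn : 0 <= y ^+ n by rewrite exprn_ge0 ?ltW.
  rewrite ler_pdivlMr ?subr_gt0 // -[leRHS]mulr1.
  have -> : n%:R * (y ^+ n) ^+ 2 * (1 - y) = y ^+ n * (y ^+ n * (n%:R * (1 - y))) by ring.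
  by apply: ler_wpM2l => //; nra.
apply: (@squeeze_cvgr _ _ _ _ (fun=> 0) (fun n => y ^+ n * (1 - y)^-1)).
- by apply: nearW => n; rewrite bnd mulr_ge0 ?exprn_ge0.
- exact: cvg_cst.
- rewrite -[X in _ --> X](mul0r (1 - y)^-1); apply: cvgMr_tmp.
  by apply: cvg_expr; rewrite ger0_norm // ltW.
Qed.

Lemma step_approx_lt r : 0 <= r < 2^-1 -> step_approx n r @[n --> \oo] --> (1 : R).
Proof.
move=> /andP[r0 r2].
have c0 : n%:R * (2 * r) ^+ n @[n --> \oo] --> 0.
  by apply: cvg_natM_expr; lra.
apply: (@squeeze_cvgr _ _ _ _ (fun n => 1 - n%:R * (2 * r) ^+ n) (fun=> 1)).
- apply: nearW => n; have r01 : 0 <= r <= 1 by lra.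
  have /andP[_ ->] := step_approx_itv n r01; rewrite andbT.
  have rn : 0 <= r ^+ n <= 1 by case/andP: r01 => ? ?; rewrite exprn_ge0 ?exprn_ile1.
  apply: le_trans (bernoulli_sub _ rn); rewrite natrM natrX exprMn; lra.
- by rewrite -[X in _ --> X]subr0; apply: cvgB => //; exact: cvg_cst.
- exact: cvg_cst.
Qed.

(** As [(2 * r) ^+ n >= 1], [bernoulli_inv] gives the bound [1 / (n + 1)]. The value [r = 1/2] is
    included, which matches the open half-lines in [multiplier_step]. *)
Lemma step_approx_ge r : 2^-1 <= r <= 1 -> step_approx n r @[n --> \oo] --> (0 : R).
Proof.
move=> /andP[r2 r1].
apply: (@squeeze_cvgr _ _ _ _ (fun=> 0) (fun n => n.+1%:R^-1)).
- apply: nearW => n; have r01 : 0 <= r <= 1 by lra.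
  have /andP[-> _] := step_approx_itv n r01; rewrite /=.
  have rn : 0 <= r ^+ n <= 1 by case/andP: r01 => ? ?; rewrite exprn_ge0 ?exprn_ile1.
  have := bernoulli_inv (n * 2 ^ n) rn; rewrite -/(step_approx n r) => h.
  have sp : n.+1%:R <= 1 + (n * 2 ^ n)%:R * r ^+ n.
    rewrite -natr1 addrC lerD2l natrM natrX -mulrA -exprMn ler_peMr //.
    by apply: exprn_ege1; lra.
  rewrite -[leRHS]mul1r ler_pdivlMr ?ltr0Sn //; apply: le_trans h.
  by apply: ler_wpM2l => //; have /andP[] := step_approx_itv n r01.
- exact: cvg_cst.
- exact: cvg_harmonic.
Qed.

(* The iteration for the square root of 1 - x^2. *)
Fixpoint sqrt_approx n x : R :=
  if n is n'.+1 then
    sqrt_approx n' x + (1 - x ^+ 2 - sqrt_approx n' x ^+ 2) / 2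
  else 0.

(** Each iteration multiplies the error [y - a] by [1 - (y + a) / 2], which lies between 0 and
    [1 - y / 2]. *)
Lemma sqrt_approx_bound n x y : 0 <= y <= 1 -> x ^+ 2 + y ^+ 2 = 1 ->
  0 <= y - sqrt_approx n x <= y * (1 - y / 2) ^+ n /\ 0 <= sqrt_approx n x.
Proof.
move=> /andP[y0 y1] xy; elim: n => [|n [/andP[h0 h1] a0]] /=.
  by rewrite subr0 expr0 mulr1 y0 lexx.
set a := sqrt_approx n x in h0 h1 a0 *.
have -> : 1 - x ^+ 2 = y ^+ 2 by rewrite -xy; ring.
have e : y - (a + (y ^+ 2 - a ^+ 2) / 2) = (y - a) * (1 - (y + a) / 2) by field.
have ay : a <= y by lra.
split; last by nra.
rewrite e exprSr mulrA; apply/andP; split; first by nra.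
by apply: ler_pM => //; lra.
Qed.

Lemma cvg_sqrt_approx x y : 0 <= y <= 1 -> x ^+ 2 + y ^+ 2 = 1 ->
  sqrt_approx n x @[n --> \oo] --> y.
Proof.
move=> y01 xy; have [y0 y1] := andP y01.
have c : y * (1 - y / 2) ^+ n @[n --> \oo] --> 0.
  have [->|yn0] := eqVneq y 0.
    by under eq_fun do rewrite mul0r; exact: cvg_cst.
  rewrite -[X in _ --> X](mulr0 y); apply: cvgMl_tmp; apply: cvg_expr.
  have yp : 0 < y by rewrite lt_neqAle eq_sym yn0.
  by rewrite ger0_norm; lra.
apply: (@squeeze_cvgr _ _ _ _ (fun n => y - y * (1 - y / 2) ^+ n) (fun=> y)).
- by apply: nearW => n; have [/andP[? ?] _] := sqrt_approx_bound n y01 xy; lra.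
- by rewrite -[X in _ --> X]subr0; apply: cvgB => //; exact: cvg_cst.
- exact: cvg_cst.
Qed.

End PolynomialApproximation.

Section Completeness.
Variables (R : realType) (q : nat) (X : homTree q) (o : X).
Variable nu : probability (Omega o) R.
Local Notation OT := (@OmegaTau R q X o).
Local Notation m := (base_measure nu).
Local Notation u := (@uwave R q).
Local Notation v := (@vwave R q).
Local Notation lnq := (ln (q%:R : R)).
Let q2 : (2 <= q)%N := homTree_q X.
Let mOT : measurable OT := measurable_OmegaTau.
Implicit Types (F : Omega o * measurableTypeR R -> R[i]) (phi psi : R -> R).

(** Here [F] contains the density and is only integrable, which is what [is_psido] yields for
    [wave_minus * sigma * density]. *)
Definition wave_orthogonal F := cintegrable m OT F /\
  forall x, cintegral m OT (fun p => F p * wave_plus p.1 p.2 x) = 0.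

Let bw x : bmeasurable OT (fun p => wave_plus p.1 p.2 x) := bmeasurable_wave_plus R o x.

Lemma cintegrable_wave F x : cintegrable m OT F ->
  cintegrable m OT (fun p => F p * wave_plus p.1 p.2 x).
Proof. by move=> IF; have [? ?] := bw x; exact: cintegrableMr. Qed.

Lemma eq_wave_orthogonal F G : (forall p, OT p -> F p = G p) ->
  wave_orthogonal F -> wave_orthogonal G.
Proof.
move=> FG [IF F0]; split; first exact: eq_cintegrable IF.
by move=> x; rewrite -(F0 x); apply: eq_cintegral => p Dp; rewrite FG.
Qed.

Lemma wave_orthogonalD F G : wave_orthogonal F -> wave_orthogonal G ->
  wave_orthogonal (fun p => F p + G p).
Proof.
move=> [IF F0] [IG G0]; split; first exact: cintegrableD.
move=> x; rewrite -[RHS]addr0 -{1}(F0 x) -(G0 x) -cintegralD //; last 2 first.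
- exact: cintegrable_wave.
- exact: cintegrable_wave.
by apply: eq_cintegral => p _; rewrite mulrDl.
Qed.

Lemma wave_orthogonalZ F c : wave_orthogonal F -> wave_orthogonal (fun p => F p * c).
Proof.
move=> [IF F0]; split; first exact: cintegrableZr.
move=> x; rewrite -[RHS](mul0r c) -(F0 x) -cintegralZr //; last exact: cintegrable_wave.
by apply: eq_cintegral => p _; rewrite mulrAC.
Qed.

(** These functions of [s] form an algebra that is closed under bounded pointwise limits with
    measurable limit, so the cosine alone generates all that is needed. *)
Definition multiplier phi :=
  forall F, wave_orthogonal F -> wave_orthogonal (fun p => F p * (phi p.2)%:C).

Lemma eq_multiplier phi psi : (forall s, 0 <= s <= tau R q -> phi s = psi s) ->
  multiplier phi -> multiplier psi.
Proof.
move=> e mphi F /mphi; apply: eq_wave_orthogonal => -[w s] [_ /=].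
by rewrite in_itv /= => /e ->.
Qed.

Lemma multiplier_cst c : multiplier (fun=> c).
Proof. by move=> F; exact: wave_orthogonalZ. Qed.

Lemma multiplierD phi psi : multiplier phi -> multiplier psi ->
  multiplier (fun s => phi s + psi s).
Proof.
move=> m1 m2 F hF; apply: eq_wave_orthogonal (wave_orthogonalD (m1 _ hF) (m2 _ hF)).
by move=> p _; rewrite realcD mulrDr.
Qed.

Lemma multiplierM phi psi : multiplier phi -> multiplier psi ->
  multiplier (fun s => phi s * psi s).
Proof.
move=> m1 m2 F hF; apply: eq_wave_orthogonal (m2 _ (m1 _ hF)).
by move=> p _; rewrite realcM mulrA.
Qed.

Lemma multiplierX phi n : multiplier phi -> multiplier (fun s => phi s ^+ n).
Proof.
move=> mphi; elim: n => [|n IH]; first exact: multiplier_cst.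
by apply: eq_multiplier (multiplierM mphi IH) => s _; rewrite exprS.
Qed.

Lemma multiplierB phi psi : multiplier phi -> multiplier psi ->
  multiplier (fun s => phi s - psi s).
Proof.
move=> m1 m2; apply: eq_multiplier (multiplierD m1 (multiplierM (multiplier_cst (-1)) m2)).
by move=> s _; rewrite mulN1r.
Qed.

Lemma bmeasurable_cos : bmeasurable OT (fun p => (cos (p.2 * lnq))%:C).
Proof.
pose c : R[i] := (2 * Num.sqrt q%:R)%:C.
have c0 : c != 0 by rewrite realc_eq0 mulf_neq0 // sqrtr_eq0 -ltNge ltr0n (ltnW q2).
apply: eq_bmeasurable (bmeasurableM (bmeasurableD bmeasurable_uwave bmeasurable_vwave)
  (bmeasurable_cst _ c^-1)) => p.
by rewrite uDvwave // realcM -/c mulrAC divff // mul1r.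
Qed.

Lemma multiplier_cos : multiplier (fun s => cos (s * lnq)).
Proof.
move=> F [IF F0]; have [mc bc] := bmeasurable_cos.
split; first exact: cintegrableMr.
move=> x; have [r [ur sr] rP] := adj_degree x.
pose c : R[i] := (2 * Num.sqrt q%:R)%:C.
have c0 : c != 0 by rewrite realc_eq0 mulf_neq0 // sqrtr_eq0 -ltNge ltr0n (ltnW q2).
have Iw y := cintegrable_wave y IF.
have : cintegral m OT (fun p => \sum_(y <- r) F p * wave_plus p.1 p.2 y) = 0.
  by rewrite cintegral_sum // big1 // => y _; rewrite F0.
move=> h; apply: (mulIf c0); rewrite mul0r -h -cintegralZr //.
  apply: eq_cintegral => p _; rewrite -mulr_sumr (wave_plus_neighbours _ _ ur sr rP).
  by rewrite uDvwave // realcM -/c; ring.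
apply: eq_cintegrable (cintegrableMr mOT (Iw x) mc bc) => // p _.
by rewrite mulrAC.
Qed.

Lemma multiplier_lim (phi_ : nat -> R -> R) phi M :
  (forall n, multiplier (phi_ n)) ->
  (forall n s, 0 <= s <= tau R q -> `|phi_ n s| <= M) ->
  (forall s, 0 <= s <= tau R q -> phi_ n s @[n --> \oo] --> phi s) ->
  bmeasurable OT (fun p => (phi p.2)%:C) -> multiplier phi.
Proof.
move=> mphi pM cphi bphi F hF; have [IF _] := hF.
have [mp bp] := bphi; split; first exact: cintegrableMr.
move=> x; have Iw := cintegrable_wave x IF; have iw := integrable_normc mOT Iw.
have ReZ (z : R[i]) (r : R) : complex.Re (z * r%:C) = complex.Re z * r.
  by rewrite ReM /= mulr0 subr0.
have ImZ (z : R[i]) (r : R) : complex.Im (z * r%:C) = complex.Im z * r.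
  by rewrite ImM /= mulr0 add0r.
have tauP (p : Omega o * measurableTypeR R) : OT p -> 0 <= p.2 <= tau R q.
  by case=> _ /=; rewrite in_itv.
have In n : cintegrable m OT (fun p => F p * wave_plus p.1 p.2 x * (phi_ n p.2)%:C).
  have [/(cintegrable_wave x) + _] := mphi n F hF.
  by apply: eq_cintegrable => // p _; rewrite mulrAC.
have h0 : cintegral m OT (fun p => F p * wave_plus p.1 p.2 x * (phi p.2)%:C) = 0.
  apply: (cvg_cintegral0 mOT (f_ := fun n p => F p * wave_plus p.1 p.2 x * (phi_ n p.2)%:C)
    (g := fun p => normc (F p * wave_plus p.1 p.2 x) * M)).
  - by move=> n; apply: (@cintegrable_cmeasurable _ _ _ m).
  - apply: (@cintegrable_cmeasurable _ _ _ m).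
    exact: cintegrableMr.
  - exact: (integrableZr mOT M iw).
  - move=> n p /tauP sp; rewrite normcM normcR ler_wpM2l ?normc_ge0 //.
    exact: pM.
  - move=> p /tauP sp; rewrite ReZ; under eq_cvg do rewrite ReZ.
    by apply: cvgMl_tmp; exact: cphi.
  - move=> p /tauP sp; rewrite ImZ; under eq_cvg do rewrite ImZ.
    by apply: cvgMl_tmp; exact: cphi.
  - move=> n; have [_ /(_ x) e] := mphi n F hF; rewrite -[RHS]e.
    by apply: eq_cintegral => p _; rewrite mulrAC.
by rewrite -[RHS]h0; apply: eq_cintegral => p _; rewrite mulrAC.
Qed.

Lemma angle_itv s : 0 <= s <= tau R q -> 0 <= s * lnq <= pi.
Proof.
move=> /andP[s0 st]; have l0 := lnq_gt0 R q2.
by rewrite mulr_ge0 ?(ltW l0) //= -ler_pdivlMr.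
Qed.

Lemma multiplier_sqrt_approx n : multiplier (fun s => sqrt_approx n (cos (s * lnq))).
Proof.
elim: n => [|n IH] /=; first exact: multiplier_cst.
apply: (multiplierD IH); apply: multiplierM (multiplier_cst _).
apply: multiplierB (multiplierX 2 IH).
exact: multiplierB (multiplier_cst _) (multiplierX 2 multiplier_cos).
Qed.

Lemma bmeasurable_sin : bmeasurable OT (fun p => (sin (p.2 * lnq))%:C).
Proof.
apply: (@bmeasurable_snd R q X o (fun s => (sin (s * lnq))%:C) 1) => [||s].
- move=> s /=; apply: continuous_comp; last exact: continuous_sin.
  exact: mulrr_continuous.
- exact: cst_continuous.
- by rewrite normcR ler_norml sin_geN1 sin_le1.
Qed.

(** On [[0, tau]] the sine is nonnegative, hence the square root of [1 - cos ^+ 2] and a limit of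
    polynomials in the cosine. *)
Lemma multiplier_sin : multiplier (fun s => sin (s * lnq)).
Proof.
have sP s : 0 <= s <= tau R q -> 0 <= sin (s * lnq) <= 1.
  by move=> /angle_itv h; rewrite sin_le1 andbT sin_ge0_pi.
have cs s := cos2Dsin2 (s * lnq).
apply: (multiplier_lim (phi_ := fun n s => sqrt_approx n (cos (s * lnq))) (M := 1)).
- exact: multiplier_sqrt_approx.
- move=> n s /sP s1; have [/andP[h1 h2] h3] := sqrt_approx_bound n s1 (cs s).
  by case/andP: s1 => s0 s1; rewrite ger0_norm //; lra.
- by move=> s /sP s1; exact: cvg_sqrt_approx s1 (cs s).
- exact: bmeasurable_sin.
Qed.

Lemma multiplier_step b : multiplier (\1_(`]b, +oo[%classic : set R)).
Proof.
have [b0|b0] := ltP b 0.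
  apply: eq_multiplier (multiplier_cst 1) => s /andP[s0 _].
  by rewrite indicE mem_set //= in_itv /= andbT (lt_le_trans b0).
have [bt|bt] := leP (tau R q) b.
  apply: eq_multiplier (multiplier_cst 0) => s /andP[_ st].
  by rewrite indicE memNset //= in_itv /= andbT; apply/negP; rewrite -leNgt (le_trans st).
have bi : 0 <= b <= tau R q by rewrite b0 ltW.
(* The cosine decreases on the half period, so [r s < 1/2] exactly when [b < s]; the division by 4
   keeps [r] within [[0, 1]], as [step_approx] requires. *)
pose r s : R := (cos (s * lnq) - cos (b * lnq)) / 4 + 2^-1.
have r01 s : 0 <= r s <= 1.
  have := cos_le1 (s * lnq); have := cos_le1 (b * lnq).
  have := cos_geN1 (s * lnq); have := cos_geN1 (b * lnq).
  rewrite /r; move: (cos _) (cos _) => x y; lra.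
have mr : multiplier r.
  apply: multiplierD (multiplier_cst _); apply: multiplierM (multiplier_cst _).
  exact: multiplierB multiplier_cos (multiplier_cst _).
apply: (multiplier_lim (phi_ := fun n s => step_approx n (r s)) (M := 1)).
- move=> n; apply: multiplierX.
  exact: multiplierB (multiplier_cst _) (multiplierX _ mr).
- by move=> n s _; have /andP[h1 h2] := step_approx_itv n (r01 s); rewrite ger0_norm.
- move=> s si; have e : (r s < 2^-1) = (b < s).
    rewrite -[RHS](ltr_pM2r (lnq_gt0 R q2)) -[RHS]ltr_cos ?in_itv /= ?angle_itv //.
    by rewrite /r; apply/idP/idP; lra.
  rewrite indicE; have [bs|sb] := boolP (b < s).
    rewrite mem_set /=; last by rewrite in_itv /= andbT.
    by apply: step_approx_lt; rewrite e bs andbT; have /andP[] := r01 s.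
  rewrite memNset /=; last by rewrite in_itv /= andbT; exact/negP.
  apply: step_approx_ge; have /andP[_ ->] := r01 s; rewrite andbT.
  by rewrite leNgt e.
- split; last by exists 1 => p _; rewrite normcR ger0_norm // indicE lern1 leq_b1.
  apply: cmeasurable_real; apply: measurableT_comp (measurable_funTS measurable_snd).
  by apply: measurable_indic; exact: measurable_itv.
Qed.

Lemma wave_orthogonal_uwave F : wave_orthogonal F ->
  wave_orthogonal (fun p => F p * u p.2).
Proof.
move=> hF; apply: eq_wave_orthogonal (wave_orthogonalD
  (wave_orthogonalZ (Num.sqrt q%:R)%:C (multiplier_cos hF))
  (wave_orthogonalZ (0 +i* Num.sqrt q%:R) (multiplier_sin hF))) => p _.
rewrite uwaveE // -!mulrA -mulrDr; congr (_ * _).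
by apply: complex_eqP => /=; ring.
Qed.

Lemma wave_orthogonal_vwave F : wave_orthogonal F ->
  wave_orthogonal (fun p => F p * v p.2).
Proof.
move=> hF; apply: eq_wave_orthogonal (wave_orthogonalD
  (wave_orthogonalZ (Num.sqrt q%:R)%:C (multiplier_cos hF))
  (wave_orthogonalZ (0 -i* Num.sqrt q%:R) (multiplier_sin hF))) => p _.
rewrite -conjc_uwave uwaveE // -!mulrA -mulrDr; congr (_ * _).
by apply: complex_eqP => /=; ring.
Qed.

Lemma wave_orthogonal_vwaveX F n : wave_orthogonal F ->
  wave_orthogonal (fun p => F p * v p.2 ^+ n).
Proof.
move=> hF; elim: n => [|n /wave_orthogonal_vwave].
  by apply: eq_wave_orthogonal hF => p _; rewrite expr0 mulr1.
by apply: eq_wave_orthogonal => p _; rewrite exprSr mulrA.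
Qed.

(** With [k = dist o y], the relation [wave_plus_child] is integrated against [F * v ^+ k], which is
    still orthogonal to all waves; [v ^+ k] turns the factor [u ^+ k] of the correction into the
    constant [q ^+ k]. *)
Lemma wave_orthogonal_cylinder F x : wave_orthogonal F ->
  cintegral m OT (fun p => F p * (u p.2 ^+ 2 - 1) * cylinder x p) = 0.
Proof.
move=> hF; have [->|xo] := eqVneq x o.
  have hF2 := wave_orthogonalD (wave_orthogonal_uwave (wave_orthogonal_uwave hF))
    (wave_orthogonalZ (-1) hF).
  have [_ h0] := hF2; rewrite -[RHS](h0 o); apply: eq_cintegral => p _.
  by rewrite cylinder_root wave_plus_root; ring.
have [y xy e] := closer_neighbour xo; set k := dist o y in e.
have hv := wave_orthogonal_vwaveX k hF.
have [I1 h1] := wave_orthogonal_uwave hv; have [I2 h2] := hv.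
have qk : (q%:R : R[i]) ^+ k != 0 by rewrite expf_neq0 ?q_neq0.
have J1 := cintegrable_wave x I1; have J2 := cintegrable_wave y I2.
have : cintegral m OT (fun p => F p * v p.2 ^+ k * u p.2 * wave_plus p.1 p.2 x -
    F p * v p.2 ^+ k * wave_plus p.1 p.2 y) = 0.
  by rewrite cintegralB // h1 h2 subr0.
move=> h; apply: (mulIf qk); rewrite mul0r -[RHS]h -cintegralZr //.
  apply: eq_cintegral => p _.
  rewrite -[_ * u p.2 * _]mulrA (wave_plus_child p xy e) -/k.
  rewrite -(uvwave q2 p.2) (exprMn _ (u p.2)).
  by move: (u p.2 ^+ k) (v p.2 ^+ k) => a b; ring.
have [IF _] := hF.
have [mu2 bu2] := bmeasurableB (bmeasurableX 2 (@bmeasurable_uwave R q X o)) (bmeasurable_cst _ 1).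
have [mc bc] := bmeasurable_cylinder R o x.
by apply: cintegrableMr => //; exact: cintegrableMr.
Qed.

(* Waves are complete: u p = q^(1/2 + is) is generated by cos and sin, and
   u * wave_plus x - wave_plus (parent of x) is supported on the cylinder of x. *)
Lemma wave_complete F : wave_orthogonal F -> {ae m, forall p, OT p -> F p = 0}.
Proof.
(* The factor left over by [wave_orthogonal_cylinder] has no zeros, so it is cancelled at the
   end. *)
move=> hF; pose G p := F p * (u p.2 ^+ 2 - 1).
have [IF _] := hF.
have [mu2 bu2] := bmeasurableB (bmeasurableX 2 (@bmeasurable_uwave R q X o)) (bmeasurable_cst _ 1).
have IG : cintegrable m OT G by exact: cintegrableMr.
have key x b : cintegral m OT (fun p => G p * (\1_(through o x `*` `]b, +oo[) p)%:C) = 0.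
  have := wave_orthogonal_cylinder x (multiplier_step b hF).
  move=> h; rewrite -[RHS]h; apply: eq_cintegral => p _.
  rewrite /G /cylinder !indicE.
  have -> : (p \in through o x `*` `]b, +oo[%classic) =
      (p.1 \in through o x) && (p.2 \in `]b, +oo[%classic) by exact: in_setX.
  by case: (_ \in _); case: (_ \in _); rewrite /=; ring.
have ReI (z : R[i]) (a : bool) : complex.Re (z * (a%:R : R)%:C) = if a then complex.Re z else 0.
  by rewrite ReM /= mulr0 subr0; case: a; rewrite ?mulr1 ?mulr0.
have ImI (z : R[i]) (a : bool) : complex.Im (z * (a%:R : R)%:C) = if a then complex.Im z else 0.
  by rewrite ImM /= mulr0 add0r; case: a; rewrite ?mulr1 ?mulr0.
have [IG1 IG2] := IG.
have a1 := Rintegral_cylinders_ae0 IG1.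
have a2 := Rintegral_cylinders_ae0 IG2.
have {}a1 : {ae m, forall p, OT p -> complex.Re (G p) = 0}.
  apply: a1 => x b; rewrite Rintegral_mkcondr.
  have := congr1 (@complex.Re R) (key x b); rewrite /cintegral /= => h; rewrite -[RHS]h.
  by apply: eq_Rintegral => p _; rewrite patchE indicE ReI.
have {}a2 : {ae m, forall p, OT p -> complex.Im (G p) = 0}.
  apply: a2 => x b; rewrite Rintegral_mkcondr.
  have := congr1 (@complex.Im R) (key x b); rewrite /cintegral /= => h; rewrite -[RHS]h.
  by apply: eq_Rintegral => p _; rewrite patchE indicE ImI.
apply: filterS2 a1 a2 => p h1 h2 Dp.
have /eqP : G p = 0 by apply: complex_eqP; [exact: h1|exact: h2].
by rewrite /G mulf_eq0 (negbTE (sqr_uwave_neq1 q2 p.2)) orbF => /eqP.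
Qed.

End Completeness.

(** * Sums of wave series *)

Section L2Cauchy.
Variables (R : realType) (d : measure_display) (T : measurableType d).
Variables (m : {measure set T -> \bar R}) (D : set T) (w : T -> R).
Hypothesis mD : measurable D.
Hypothesis mw : measurable_fun D w.
Hypothesis w0 : forall t, D t -> 0 <= w t.

Lemma cvgn_telescope_bound (a b : nat -> R) (M : R) :
  (forall n, `|a n.+1 - a n| <= b n) ->
  (forall n, \sum_(0 <= k < n) b k <= M) -> cvgn a.
Proof.
move=> ab bM.
have cs : cvgn (series (telescope a)).
  apply: normed_cvg; apply: nondecreasing_is_cvgn.
    by apply/nondecreasing_seqP => n; rewrite /= seriesSr lerDl.
  exists M => _ [n _ <-]; apply: le_trans (bM n).
  have h : \sum_(0 <= k < n) `|a k.+1 - a k| <= \sum_(0 <= k < n) b k.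
    by apply: ler_sum => k _; exact: ab.
  exact: h.
have -> : a = (fun n => a 0%N + series (telescope a) n).
  by apply/funext => n; exact: eq_sum_telescope.
by apply: is_cvgD => //; exact: is_cvg_cst.
Qed.

Lemma sum_half_expr n : \sum_(0 <= k < n) (2^-1 : R) ^+ k <= 2.
Proof.
have -> : \sum_(0 <= k < n) (2^-1 : R) ^+ k = 2 - 2 * 2^-1 ^+ n.
  elim: n => [|n IH]; first by rewrite big_nil expr0; ring.
  by rewrite big_nat_recr //= IH exprS; field.
by rewrite lerBlDr lerDl mulr_ge0 // exprn_ge0.
Qed.

(** Completeness of a weighted L2 space along a fast Cauchy sequence. The weight may vanish, and
    nothing is controlled at such points. *)
Lemma cvg_ae_of_l2_cauchy (f_ : nat -> T -> R[i]) (C : R) :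
  (forall n, cmeasurable D (f_ n)) ->
  (forall n, (\int[m]_(t in D) (normc (f_ n.+1 t - f_ n t) ^+ 2 * w t)%:E <=
    (C * 4^-1 ^+ n)%:E)%E) ->
  exists2 f, cmeasurable D f & {ae m, forall t, D t -> 0 < w t ->
    complex.Re (f_ n t) @[n --> \oo] --> complex.Re (f t) /\
    complex.Im (f_ n t) @[n --> \oo] --> complex.Im (f t)}.
Proof.
move=> mf cf.
(* The factor [2 ^+ n] leaves integrals of at most [C * 2^-n], still summable, and is large enough
   that finiteness of the sum makes the increments absolutely summable. *)
pose g n t := (2 ^+ n * (normc (f_ n.+1 t - f_ n t) ^+ 2 * w t))%:E.
have g0 n t : D t -> (0 <= g n t)%E.
  by move=> Dt; rewrite lee_fin !mulr_ge0 ?exprn_ge0 ?w0 ?normc_ge0.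
have mn n : measurable_fun D (fun t => normc (f_ n.+1 t - f_ n t) ^+ 2 * w t).
  apply: measurable_funM => //; apply: measurable_sqr_normc.
  exact: cmeasurableB.
have mg n : measurable_fun D (g n).
  by apply/measurable_EFinP; apply: measurable_funM => //; exact: measurable_cst.
have ig n : (\int[m]_(t in D) g n t <= (C * 2^-1 ^+ n)%:E)%E.
  rewrite /g; under eq_integral do rewrite EFinM.
  rewrite ge0_integralZl //.
  - apply: le_trans (lee_wpmul2l _ (cf n)) _; first by rewrite lee_fin exprn_ge0.
    rewrite -EFinM lee_fin mulrCA -exprMn.
    by rewrite (_ : 2 * 4^-1 = 2^-1 :> R) //; field.
  - exact/measurable_EFinP.
  - by move=> t Dt; rewrite lee_fin mulr_ge0 ?exprn_ge0 ?w0 ?normc_ge0.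
have C0 : 0 <= C.
  have := le_trans (integral_ge0 m (g0 0%N)) (ig 0%N).
  by rewrite lee_fin expr0 mulr1.
pose G t := (\sum_(0 <= n <oo) g n t)%E.
have IG : m.-integrable D G.
  apply/integrableP; split.
    apply: ge0_emeasurable_sum => [n t Dt _|n _]; [exact: g0|exact: mg].
  rewrite (eq_integral G) => [|t]; last first.
    by rewrite inE => Dt; rewrite gee0_abs // nneseries_ge0 // => n _ _; exact: g0.
  rewrite integral_nneseries //.
  apply: (@le_lt_trans _ _ (C * 2)%:E); last exact: ltry.
  apply: lime_le.
    by apply: is_cvg_nneseries => n _ _; apply: integral_ge0 => t; exact: g0.
  apply: nearW => n; apply: le_trans (lee_sum _ (fun k _ => ig k)) _.
  by rewrite sumEFin lee_fin -mulr_sumr ler_wpM2l // sum_half_expr.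
(* An upper limit is measurable whether or not the sequence converges, and equals the limit where it
   does. *)
pose re t := fine (limn_esup (fun n => (complex.Re (f_ n t))%:E)).
pose im t := fine (limn_esup (fun n => (complex.Im (f_ n t))%:E)).
have mre : measurable_fun D re.
  apply: measurableT_comp (measurable_fun_limn_esup _) => // n.
  by apply/measurable_EFinP; have [] := mf n.
have mim : measurable_fun D im.
  apply: measurableT_comp (measurable_fun_limn_esup _) => // n.
  by apply/measurable_EFinP; have [] := mf n.
exists (fun t => re t +i* im t) => //.
apply: filterS (integrable_ae mD IG) => t Gfin Dt wt.
have {Gfin} Gfin := Gfin Dt.
have part N : \sum_(0 <= n < N) (2 ^+ n * normc (f_ n.+1 t - f_ n t) ^+ 2) <=
    fine (G t) / w t.
  rewrite ler_pdivlMr // -lee_fin fineK // mulr_suml -sumEFin.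
  apply: (le_trans _ (nneseries_lim_ge N _)) => [|n _ _]; last exact: g0.
  by apply: lee_sum => n _; rewrite lee_fin mulrA.
have key (a : nat -> R) : (forall n, `|a n.+1 - a n| <= normc (f_ n.+1 t - f_ n t)) ->
    a n @[n --> \oo] --> fine (limn_esup (fun n => (a n)%:E)).
  move=> ha; have ca : cvgn a.
    (* The bound comes from [2 * z <= 2^-n + 2^n * z^2]. *)
    apply: (@cvgn_telescope_bound _
      (fun n => (2^-1 ^+ n + 2 ^+ n * normc (f_ n.+1 t - f_ n t) ^+ 2) / 2)
      ((2 + fine (G t) / w t) / 2)) => [n|N].
      apply: le_trans (ha n) _; move: (normc _) => z.
      have p2 : 0 < (2 : R) ^+ n by rewrite exprn_gt0.
      have -> : (2^-1 : R) ^+ n = (2 ^+ n)^-1 by rewrite exprVn.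
      move: (2 ^+ n) p2 => c c0; rewrite ler_pdivlMr // -subr_ge0.
      have -> : c^-1 + c * z ^+ 2 - z * 2 = (c * z - 1) ^+ 2 / c by field; rewrite gt_eqF.
      by rewrite divr_ge0 ?sqr_ge0 ?ltW.
    by rewrite -mulr_suml ler_wpM2r // big_split /= lerD // sum_half_expr.
  have ce : (a n)%:E @[n --> \oo] --> (limn a)%:E by apply: cvg_EFin => //; exact: nearW.
  by rewrite (cvg_limn_einf_sup ce).2.
split; apply: key => n.
  apply: le_trans (ler_Re_normc _); rewrite le_eqVlt; apply/orP; left; apply/eqP.
  by case: (f_ n.+1 t) (f_ n t) => [? ?] [? ?].
apply: le_trans (ler_Im_normc _); rewrite le_eqVlt; apply/orP; left; apply/eqP.
by case: (f_ n.+1 t) (f_ n t) => [? ?] [? ?].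
Qed.

End L2Cauchy.

#[local] Existing Instance summability.totally_filter.

Section SquareSums.
Variables (R : realType) (X : choiceType) (c : X -> R[i]).
Implicit Types A B : {fset X}.

Definition sqsum A : R := \sum_(x <- A) normc (c x) ^+ 2.

Lemma sqsum_ge0 A : 0 <= sqsum A.
Proof. by apply: sumr_ge0 => x _; exact: sqr_ge0. Qed.

Lemma sqsum_le_sqnorm A : ((sqsum A)%:E <= sqnorm c)%E.
Proof.
apply: ereal_sup_ubound; exists [set` A]; first by split.
by rewrite fsbig_finite //= set_fsetK sumEFin.
Qed.

Lemma sqsum_fsetU A B : (forall x, x \in B -> x \notin A) ->
  sqsum (A `|` B)%fset = sqsum A + sqsum B.
Proof.
move=> BA; rewrite /sqsum (big_fsetID _ (mem A)); congr (_ + _).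
  apply: eq_fbigl => x; rewrite !inE /=.
  by case: (x \in A); rewrite ?andbT ?andbF ?orbT.
apply: eq_fbigl => x; rewrite !inE /=; case xA: (x \in A); rewrite ?andbF ?andbT //=.
by apply/esym/negbTE; apply: contraL (xA) => /BA /negbTE ->.
Qed.

(** A finite set whose sum is within [e] of the supremum leaves at most [e] to any finite set
    disjoint from it. *)
Lemma sqnorm_tail : L2 c -> forall e : R, 0 < e ->
  exists A, forall B, (forall x, x \in B -> x \notin A) -> sqsum B <= e.
Proof.
move=> c2 e e0.
have fin : sqnorm c \is a fin_num.
  by rewrite ge0_fin_numE // esum_ge0 // => x _; rewrite lee_fin sqr_ge0.
have [_ [S [fS _] <-]] := ub_ereal_sup_adherent e0 fin.
rewrite -[ereal_sup _]/(sqnorm c) fsbig_finite //= sumEFin => h.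
exists (fset_set S) => B BA.
have := sqsum_le_sqnorm (fset_set S `|` B)%fset; rewrite sqsum_fsetU //.
move: h; rewrite -(fineK fin) -EFinB lte_fin lee_fin -/(sqsum _).
by move: (sqsum _) (sqsum B) => a b; lra.
Qed.

End SquareSums.

Section WaveSeries.
Variables (R : realType) (q : nat) (X : homTree q) (o : X).
Variable nu : probability (Omega o) R.
Hypothesis nuE : forall x : X, x != o ->
  nu (through o x) = (q%:R / ((q.+1)%:R * q%:R ^+ dist o x))%:E.
Local Notation OT := (@OmegaTau R q X o).
Local Notation m := (base_measure nu).
Local Notation density := (plancherel_density q).
Let mOT : measurable OT := measurable_OmegaTau.
Implicit Types (c : X -> R[i]) (A B : {fset X}) (p : Omega o * measurableTypeR R).

Definition wave_sum c A p : R[i] := \sum_(x <- A) wave_minus p.1 p.2 x * c x.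

Lemma partial_sum_waves c A p :
  summability.partial_sum (fun x => wave_minus p.1 p.2 x * c x) A = wave_sum c A p.
Proof. by rewrite /wave_sum big_seq_fsetE. Qed.

Lemma bmeasurable_wave_sum c A : bmeasurable OT (wave_sum c A).
Proof.
apply: bmeasurable_sum => x; apply: bmeasurableM (bmeasurable_cst _ _).
exact: bmeasurable_wave_minus.
Qed.

Lemma cintegral_wave_sum c A x :
  cintegral m OT (fun p => wave_sum c A p * (density p.2)%:C * wave_plus p.1 p.2 x) =
  if x \in A then c x else 0.
Proof.
have I y : cintegrable m OT (fun p =>
    (density p.2)%:C * (wave_plus p.1 p.2 x * wave_minus p.1 p.2 y)).
  apply: bmeasurable_cintegrable; apply: bmeasurableM bmeasurable_density _.
  by apply: bmeasurableM; [exact: bmeasurable_wave_plus|exact: bmeasurable_wave_minus].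
transitivity (cintegral m OT (fun p => \sum_(y <- A)
    (density p.2)%:C * (wave_plus p.1 p.2 x * wave_minus p.1 p.2 y) * c y)).
  apply: eq_cintegral => p _; rewrite /wave_sum !mulr_suml; apply: eq_bigr => y _.
  by ring.
rewrite cintegral_sum // => [|y]; last exact: cintegrableZr.
under eq_bigr do rewrite cintegralZr // wave_orthonormal //.
case: ifPn => xA.
  rewrite (big_fsetD1 x) //= eqxx mul1r big_seq big1 ?addr0 // => y.
  by rewrite !inE eq_sym => /andP[/negbTE -> _]; rewrite mul0r.
rewrite big_seq big1 // => y yA; case: eqVneq => [e|_]; last by rewrite mul0r.
by move: xA; rewrite e yA.
Qed.

Lemma measurable_density : measurable_fun OT (fun p => density p.2 : R).
Proof. by have [[+ _] _] := @bmeasurable_density R q X o. Qed.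

(** Parseval: the conjugate factor is expanded, and [cintegral_wave_sum] extracts the coefficient
    from the other one. *)
Lemma integral_wave_sum c A :
  (\int[m]_(p in OT) (normc (wave_sum c A p) ^+ 2 * density p.2)%:E =
   (sqsum c A)%:E)%E.
Proof.
have bS := bmeasurable_wave_sum c A.
have I x : cintegrable m OT (fun p =>
    wave_sum c A p * (density p.2)%:C * wave_plus p.1 p.2 x).
  apply: bmeasurable_cintegrable; apply: bmeasurableM (bmeasurable_wave_plus _ _ _).
  exact: bmeasurableM bS bmeasurable_density.
have e : cintegral m OT (fun p => (normc (wave_sum c A p) ^+ 2 * density p.2)%:C) =
    (sqsum c A)%:C.
  transitivity (cintegral m OT (fun p => \sum_(x <- A)
      wave_sum c A p * (density p.2)%:C * wave_plus p.1 p.2 x * conjc (c x))).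
    apply: eq_cintegral => p _; rewrite realcM -mul_conjc mulrAC.
    rewrite {2}/wave_sum (rmorph_sum conjc) mulr_sumr; apply: eq_bigr => x _.
    by rewrite /= conjcM conjc_wave_minus mulrA.
  rewrite cintegral_sum // => [|x]; last exact: cintegrableZr.
  rewrite /sqsum (rmorph_sum (real_complex R)); apply: eq_big_seq => x xA.
  by rewrite cintegralZr // cintegral_wave_sum xA mul_conjc.
have Ir : m.-integrable OT (fun p => (normc (wave_sum c A p) ^+ 2 * density p.2)%:E).
  have [[mS [M hM]] [_ [K hK]]] := (bS, @bmeasurable_density R q X o).
  apply: measurable_bounded_integrable => //; first exact: base_measure_lty.
    by apply: measurable_funM; [exact: measurable_sqr_normc|exact: measurable_density].
  exists (M ^+ 2 * K); split; first exact: num_real.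
  move=> r Mr p Dp; apply: le_trans (ltW Mr).
  rewrite normrM normrX ger0_norm ?normc_ge0 // ler_pM ?exprn_ge0 ?normc_ge0 //.
    by rewrite ler_pXn2r ?nnegrE ?normc_ge0 ?hM // (le_trans (normc_ge0 _) (hM p Dp)).
  by rewrite -normcR; exact: hK.
rewrite -[LHS]fineK; last exact: integrable_fin_num.
by move/(congr1 (@complex.Re R)): e => /= <-.
Qed.

Lemma integral_wave_sumB c A B :
  (\int[m]_(p in OT) (normc (wave_sum c B p - wave_sum c A p) ^+ 2 * density p.2)%:E =
   (sqsum c (B `\` A)%fset + sqsum c (A `\` B)%fset)%:E)%E.
Proof.
(* These coefficients are [c] on [B] minus [A], [- c] on [A] minus [B], and 0 elsewhere. *)
pose c' x := (if x \in B then c x else 0) - (if x \in A then c x else 0).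
have sE (E : {fset X}) p : (E `<=` A `|` B)%fset -> wave_sum c E p =
    \sum_(x <- (A `|` B)%fset) wave_minus p.1 p.2 x * (if x \in E then c x else 0).
  move=> sub; rewrite -(big_fset_incl _ sub) => [|x _ /negbTE ->]; last by rewrite mulr0.
  by apply: eq_big_seq => x ->.
transitivity (\int[m]_(p in OT) (normc (wave_sum c' (A `|` B)%fset p) ^+ 2 * density p.2)%:E)%E.
  apply: eq_integral => p _; rewrite (sE B) ?fsubsetUr // (sE A) ?fsubsetUl //.
  by rewrite -sumrB; under eq_bigr do rewrite -mulrBr.
rewrite integral_wave_sum; congr EFin; rewrite /sqsum.
have nE (E : {fset X}) : (E `<=` A `|` B)%fset -> \sum_(x <- E) normc (c x) ^+ 2 =
    \sum_(x <- (A `|` B)%fset) (if x \in E then normc (c x) ^+ 2 else 0).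
  move=> sub; rewrite -(big_fset_incl _ sub) => [|x _ /negbTE -> //].
  by apply: eq_big_seq => x ->.
rewrite (nE (B `\` A)%fset); last by rewrite fsubDset fsetUA fsetUid fsubsetUr.
rewrite (nE (A `\` B)%fset); last by rewrite fsubDset fsetUCA fsubsetUl.
rewrite -big_split; apply: eq_bigr => x _ /=; rewrite /c' !inE.
have n0 : normc (0 : R[i]) = 0 := normc0 _; have nN := @normcN R (c x).
move: (@normc R) n0 nN => N n0 nN.
by case: (x \in A); case: (x \in B) => /=;
  rewrite ?subr0 ?sub0r ?subrr ?nN ?n0 ?expr0n /= ?addr0 ?add0r.
Qed.

Lemma cvg_sqr_normcB (z_ : nat -> R[i]) (z a : R[i]) :
  complex.Re (z_ n) @[n --> \oo] --> complex.Re z ->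
  complex.Im (z_ n) @[n --> \oo] --> complex.Im z ->
  normc (z_ n - a) ^+ 2 @[n --> \oo] --> normc (z - a) ^+ 2.
Proof.
move=> cr ci.
have e z' : normc (z' - a) ^+ 2 = (complex.Re z' - complex.Re a) * (complex.Re z' - complex.Re a) +
    (complex.Im z' - complex.Im a) * (complex.Im z' - complex.Im a).
  by rewrite sqr_normcE !expr2; case: z' a {cr ci} => [? ?] [].
rewrite e (_ : (fun n => _) = (fun n =>
  (complex.Re (z_ n) - complex.Re a) * (complex.Re (z_ n) - complex.Re a) +
  (complex.Im (z_ n) - complex.Im a) * (complex.Im (z_ n) - complex.Im a))); last first.
  by apply/funext => n; rewrite e.
by apply: cvgD; apply: cvgM; apply: cvgB => //; exact: cvg_cst.
Qed.

(** Finite sets [A_ n] with tails at most [4^-n] give a sequence that converges almost everywhere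
    where the density is positive; Fatou then compares its limit with every large finite sum. The
    [A_ n] need not be nested, so both set differences are estimated. *)
Lemma riesz_fischer c : L2 c -> exists S : Omega o -> R -> R[i],
  L2_series_sum nu (fun x w s => wave_minus w s x * c x) S.
Proof.
move=> c2.
have tail n : exists A, forall B, (forall x, x \in B -> x \notin A) ->
    sqsum c B <= 4^-1 ^+ n.
  by apply: (sqnorm_tail c2); rewrite exprn_gt0 // invr_gt0.
have [A_ A_P] := choice tail.
have d0 p : OT p -> 0 <= density p.2 by move=> _; exact: plancherel_density_ge0.
have mS n : cmeasurable OT (wave_sum c (A_ n)) by case: (bmeasurable_wave_sum c (A_ n)).
have cS n : (\int[m]_(p in OT) (normc (wave_sum c (A_ n.+1) p - wave_sum c (A_ n) p) ^+ 2 *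
    density p.2)%:E <= (2 * 4^-1 ^+ n)%:E)%E.
  rewrite integral_wave_sumB lee_fin mulrDl mul1r lerD //.
    by apply: A_P => x; rewrite !inE => /andP[].
  apply: (@le_trans _ _ (4^-1 ^+ n.+1)); first by apply: A_P => x; rewrite !inE => /andP[].
  by rewrite exprS ler_piMl ?exprn_ge0 //; lra.
have [f mf cf] := cvg_ae_of_l2_cauchy mOT measurable_density d0 mS cS.
exists (fun w s => f (w, s)); split.
  by rewrite (_ : (fun p => f (p.1, p.2)) = f) //; apply/funext => -[].
have bnd e : 0 < e -> exists A0, forall A, (A0 `<=` A)%fset ->
    (\int[m]_(p in OT) (normc (f p - wave_sum c A p) ^+ 2 * density p.2)%:E <=
     (2 * e)%:E)%E.
  move=> e0; have [A0 A0P] := sqnorm_tail c2 e0.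
  (* Starting the sequence at [n0] makes the bound hold for every term, so that it passes to the
     lower limit directly. *)
  have [n0 n0P] : exists n0, forall n, (4^-1 : R) ^+ (n0 + n) <= e.
    exists (Num.bound e^-1) => n; have ei : 0 <= e^-1 by rewrite invr_ge0 ltW.
    have := archi_boundP ei; set k := Num.bound _ => ek.
    have k4 : (k%:R : R) <= 4 ^+ k by rewrite -natrX ler_nat ltnW // ltn_expl.
    rewrite exprD; apply: (@le_trans _ _ (4^-1 ^+ k)).
      by rewrite ler_piMr ?exprn_ge0 // exprn_ile1 //; lra.
    rewrite exprVn -[leRHS]invrK lef_pV2 ?posrE ?invr_gt0 ?exprn_gt0 //.
    exact: le_trans (ltW ek) k4.
  exists A0 => A A0A.
  pose h n p := (normc (wave_sum c (A_ (n0 + n)%N) p - wave_sum c A p) ^+ 2 * density p.2)%:E.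
  have h0 n p : OT p -> (0 <= h n p)%E.
    by move=> Dp; rewrite lee_fin mulr_ge0 ?sqr_ge0 ?d0.
  have mh n : measurable_fun OT (h n).
    apply/measurable_EFinP; apply: measurable_funM measurable_density.
    apply: measurable_sqr_normc; apply: cmeasurableB; first exact: mS.
    by case: (bmeasurable_wave_sum c A).
  have hle n : (\int[m]_(p in OT) h n p <= (2 * e)%:E)%E.
    rewrite integral_wave_sumB lee_fin mulrDl mul1r lerD //.
      apply: A0P => x; rewrite !inE => /andP[+ _]; apply: contra.
      exact: (fsubsetP A0A).
    by apply: le_trans (n0P n); apply: A_P => x; rewrite !inE => /andP[].
  apply: (@le_trans _ _ (\int[m]_(p in OT) limn_einf (h^~ p))%E).
    apply: ae_ge0_le_integral => //.
    - by move=> p Dp; rewrite lee_fin mulr_ge0 ?sqr_ge0 ?d0.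
    - apply/measurable_EFinP; apply: measurable_funM measurable_density.
      apply: measurable_sqr_normc; apply: cmeasurableB => //.
      by case: (bmeasurable_wave_sum c A).
    - move=> p Dp; rewrite limn_einf_lim; apply: lime_ge; first exact: is_cvg_einfs.
      by apply: nearW => n; apply: le_ereal_inf_tmp => _ [k _ <-]; exact: h0.
    - have me : measurable_fun OT (fun p => limn_esup (-%E \o (h^~ p))).
        by apply: measurable_fun_limn_esup => n; apply: measurableT_comp.
      exact: (measurableT_comp _ me).
    - apply: filterS cf => p cfp Dp.
      (* Where the density is 0 the sums may diverge, but the left side is 0 there. *)
      have [dp|dp] := leP (density p.2) 0.
        have -> : density p.2 = 0 by apply/eqP; rewrite eq_le dp d0.
        rewrite mulr0 limn_einf_lim; apply: lime_ge; first exact: is_cvg_einfs.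
        by apply: nearW => n; apply: le_ereal_inf_tmp => _ [k _ <-]; exact: h0.
      have [cr ci] := cfp Dp dp.
      have sh (a : nat -> R) (l : R) : a n @[n --> \oo] --> l ->
          a (n0 + n)%N @[n --> \oo] --> l.
        move=> al; rewrite (_ : (fun n => a (n0 + n)%N) = (fun n => a (n + n0)%N)).
          by rewrite (cvg_shiftn n0 a).
        by apply/funext => n; rewrite addnC.
      have ch : h n p @[n --> \oo] --> (normc (f p - wave_sum c A p) ^+ 2 * density p.2)%:E.
        apply: cvg_EFin; first exact: nearW.
        apply: cvgMr_tmp; apply: (cvg_sqr_normcB (z_ := fun n => wave_sum c (A_ (n0 + n)%N) p)).
          exact: (sh (fun n => complex.Re (wave_sum c (A_ n) p))).
        exact: (sh (fun n => complex.Im (wave_sum c (A_ n) p))).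
      by rewrite (cvg_limn_einf_sup ch).1.
  apply: le_trans (fatou m mOT mh h0) _.
  rewrite limn_einf_lim; apply: lime_le; first exact: is_cvg_einfs.
  apply: nearW => n; apply: ge_ereal_inf; exists (\int[m]_(p in OT) h n p)%E => //.
  by exists n => //=.
have I0 A : (0 <= \int[m]_(p in OT) (normc (f p - wave_sum c A p) ^+ 2 * density p.2)%:E)%E.
  by apply: integral_ge0 => p Dp; rewrite lee_fin mulr_ge0 ?sqr_ge0 ?d0.
rewrite (_ : (fun A => _) = fun A =>
    (\int[m]_(p in OT) (normc (f p - wave_sum c A p) ^+ 2 * density p.2)%:E)%E); last first.
  apply/funext => A; apply: eq_integral => p _.
  by rewrite partial_sum_waves -surjective_pairing.
have lim e : 0 < e -> \forall A \near summability.totally,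
    (\int[m]_(p in OT) (normc (f p - wave_sum c A p) ^+ 2 * density p.2)%:E <= e%:E)%E.
  move=> e0; have e2 : 0 < e / 2 by rewrite divr_gt0.
  have [A0 A0P] := bnd _ e2; exists A0 => // A A0A.
  by have := A0P A A0A; rewrite mulrCA divff ?mulr1.
apply/fine_cvgP; split.
  apply: filterS (lim 1 ltr01) => A hA.
  by rewrite ge0_fin_numE //; apply: le_lt_trans hA _; exact: ltry.
apply/cvgrPdist_le => e e0; apply: filterS (lim e e0) => A hA /=.
rewrite sub0r normrN ger0_norm ?fine_ge0 // -lee_fin fineK //.
by rewrite ge0_fin_numE //; apply: le_lt_trans hA _; exact: ltry.
Qed.

End WaveSeries.

Lemma normc_small_eq (R : realType) (a b : R[i]) :
  (forall e : R, 0 < e -> normc (a - b) <= e) -> a = b.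
Proof.
move=> h; apply/eqP; rewrite -subr_eq0 -normc_eq0 eq_le normc_ge0 andbT leNgt.
apply/negP => n0; have := h _ (divr_gt0 n0 (ltr0Sn R 1)).
by move: (normc _) n0 => z z0; lra.
Qed.

(** * Recovering the coefficients from the sum of a wave series *)

Section Coefficients.
Variables (R : realType) (q : nat) (X : homTree q) (o : X).
Variable nu : probability (Omega o) R.
Hypothesis nuE : forall x : X, x != o ->
  nu (through o x) = (q%:R / ((q.+1)%:R * q%:R ^+ dist o x))%:E.
Local Notation OT := (@OmegaTau R q X o).
Local Notation m := (base_measure nu).
Local Notation density := (plancherel_density q).
Let mOT : measurable OT := measurable_OmegaTau.
Variables (c : X -> R[i]) (S : Omega o -> R -> R[i]).
Hypothesis cS : L2_series_sum nu (fun x w s => wave_minus w s x * c x) S.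

Let Z (A : {fset X}) (p : Omega o * measurableTypeR R) := S p.1 p.2 - wave_sum c A p.
Let err A := (\int[m]_(p in OT) (normc (Z A p) ^+ 2 * density p.2)%:E)%E.

Let mS : cmeasurable OT (fun p => S p.1 p.2). Proof. by case: cS. Qed.

Let mZ A : cmeasurable OT (Z A).
Proof. by apply: cmeasurableB mS _; case: (bmeasurable_wave_sum o c A). Qed.

Let err_ge0 A : (0 <= err A)%E.
Proof.
by apply: integral_ge0 => p _; rewrite lee_fin mulr_ge0 ?sqr_ge0 ?plancherel_density_ge0.
Qed.

Let err_small (x : X) (e : R) : 0 < e -> exists A, x \in A /\ (err A <= e%:E)%E.
Proof.
move=> e0; have [_] := cS.
rewrite (_ : (fun A => _) = err); last first.
  apply/funext => A; apply: eq_integral => p _.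
  by rewrite (partial_sum_waves c A p).
move=> /fine_cvgP[fin /cvgrPdist_le/(_ e e0) sm].
have xA : \forall A \near (@summability.totally X), x \in A.
  by exists [fset x]%fset => // A; rewrite /= fsub1set.
have [A [[Af Ae] xA']] := filter_ex (filterI (filterI fin sm) xA).
exists A; split => //; rewrite -(fineK Af) lee_fin; apply: le_trans Ae.
by rewrite sub0r normrN ler_norm.
Qed.

Let ierr A : (err A < +oo)%E ->
  m.-integrable OT (fun p => (normc (Z A p) ^+ 2 * density p.2)%:E).
Proof.
move=> fin; apply/integrableP; split.
  apply/measurable_EFinP; apply: measurable_funM; last exact: measurable_density.
  exact: measurable_sqr_normc.
rewrite (eq_integral (fun p => (normc (Z A p) ^+ 2 * density p.2)%:E)) //.
by move=> p _; rewrite gee0_abs // lee_fin mulr_ge0 ?sqr_ge0 ?plancherel_density_ge0.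
Qed.

Let idens : m.-integrable OT (fun p => (density p.2 : R)%:E).
Proof. by have [] := bmeasurable_cintegrable nu (@bmeasurable_density R q X o). Qed.

Let mZD A : cmeasurable OT (fun p => Z A p * (density p.2)%:C).
Proof. by apply: cmeasurableM (mZ A) _; case: (@bmeasurable_density R q X o). Qed.

(** In place of Cauchy-Schwarz: integrated against the density, it bounds the L1 norm of [Z A] by
    [e] times the total mass plus [err A / e]. *)
Let amgm (z e : R) : 0 <= z -> 0 < e -> z <= e + z ^+ 2 / e.
Proof.
move=> z0 e0; have [ze|/ltW ez] := leP z e.
  by apply: ler_wpDr => //; rewrite divr_ge0 ?sqr_ge0 ?ltW.
by apply: ler_wpDl; [exact: ltW|rewrite ler_pdivlMr // expr2 ler_wpM2l].
Qed.

Let iZ A : (err A < +oo)%E -> cintegrable m OT (fun p => Z A p * (density p.2)%:C).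
Proof.
move=> fin; have i1 := integrableD mOT idens (ierr fin).
apply: (cintegrable_dominated mOT (mZD A) i1) => p _.
rewrite normcM normcR ger0_norm ?plancherel_density_ge0 //.
have d0 := plancherel_density_ge0 X p.2; have := amgm (normc_ge0 (Z A p)) ltr01.
by rewrite divr1; move: (normc _) (density _) d0 => z dd dd0 h; nra.
Qed.

Lemma cintegrable_series_sum : cintegrable m OT (fun p => S p.1 p.2 * (density p.2)%:C).
Proof.
have [A [_ eA]] := err_small o ltr01.
have fin : (err A < +oo)%E by apply: le_lt_trans eA _; exact: ltry.
have I2 := bmeasurable_cintegrable nu
  (bmeasurableM (bmeasurable_wave_sum o c A) bmeasurable_density).
apply: eq_cintegrable (cintegrableD mOT (iZ fin) I2) => // p _.
by rewrite -mulrDl /Z subrK.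
Qed.

(** For any finite set containing [x] the partial sum has coefficient exactly [c x], so the
    discrepancy is the integral of the error [Z A] against a bounded wave. *)
Lemma cintegral_series_sum x :
  cintegral m OT (fun p => S p.1 p.2 * (density p.2)%:C * wave_plus p.1 p.2 x) = c x.
Proof.
have [mw [B hB]] := bmeasurable_wave_plus R o x.
pose K := Rintegral m OT (fun p => density p.2 : R).
have K0 : 0 <= K by apply: Rintegral_ge0 => p _; exact: plancherel_density_ge0.
have B0 : 0 <= B.
  have Dp : OT (ray_default o, 0).
    by split=> //=; rewrite in_itv /= lexx ltW // tau_gt0 // homTree_q.
  exact: le_trans (normc_ge0 _) (hB _ Dp).
(* With [err A <= t^2] the discrepancy is at most [2 * B * (t * K + t)], which this [t] keeps below
   [e]; the added ones avoid division by 0. *)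
apply: normc_small_eq => e e0; pose t : R := e / (2 * (B + 1) * (K + 1)).
have t0 : 0 < t by rewrite divr_gt0 // !mulr_gt0 // ltr_wpDl.
have [A [xA eA]] := err_small x (exprn_gt0 2 t0).
have fin : (err A < +oo)%E by apply: le_lt_trans eA _; exact: ltry.
have I1 : cintegrable m OT (fun p => Z A p * (density p.2)%:C * wave_plus p.1 p.2 x).
  by apply: cintegrableMr => //; [exact: iZ|exists B].
have I2 : cintegrable m OT (fun p => wave_sum c A p * (density p.2)%:C * wave_plus p.1 p.2 x).
  apply: bmeasurable_cintegrable; apply: bmeasurableM (bmeasurable_wave_plus _ _ _).
  exact: bmeasurableM (bmeasurable_wave_sum o _ _) bmeasurable_density.
have -> : cintegral m OT (fun p => S p.1 p.2 * (density p.2)%:C * wave_plus p.1 p.2 x) - c x =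
    cintegral m OT (fun p => Z A p * (density p.2)%:C * wave_plus p.1 p.2 x).
  have := cintegral_wave_sum nuE c A x; rewrite xA => h.
  rewrite -[c x]h; apply/eqP; rewrite subr_eq -cintegralD //; apply/eqP.
  by apply: eq_cintegral => p _; rewrite -!mulrDl /Z subrK.
apply: le_trans (normc_cintegral_le mOT I1) _.
have i2 := integrableZl mOT t^-1 (ierr fin); have i3 := integrableZl mOT t idens.
have i4 := integrableD mOT i3 i2.
have i5 := integrableZl mOT B i4.
have : Rintegral m OT (fun p => normc (Z A p * (density p.2)%:C * wave_plus p.1 p.2 x)) <=
    B * (t * K + t^-1 * fine (err A)).
  have -> : B * (t * K + t^-1 * fine (err A)) = Rintegral m OT (fun p =>
      B * (t * density p.2 + t^-1 * (normc (Z A p) ^+ 2 * density p.2))).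
    rewrite RintegralZl // RintegralD //; congr (_ * (_ + _)); apply/esym.
      exact: RintegralZl t mOT idens.
    exact: RintegralZl t^-1 mOT (ierr fin).
  apply: le_Rintegral => //; first exact: integrable_normc.
  move=> p Dp; rewrite normcM [normc (Z A p * _)]normcM normcR ger0_norm ?plancherel_density_ge0 //.
  have w0 := normc_ge0 (wave_plus p.1 p.2 x); have wB := hB p Dp.
  have z0 := normc_ge0 (Z A p); have h := amgm z0 t0; have d0 := plancherel_density_ge0 X p.2.
  move: (normc (wave_plus _ _ _)) (normc (Z A p)) (density p.2) w0 wB z0 h d0.
  move=> w z dd w0 wB z0 h d0; rewrite mulrC ler_pM ?mulr_ge0 //.
  by rewrite [t^-1 * _]mulrC [z ^+ 2 * dd / t]mulrAC -mulrDl ler_wpM2r.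
have et : t^-1 * fine (err A) <= t.
  by rewrite mulrC ler_pdivrMr // -expr2 -lee_fin fineK // ge0_fin_numE // err_ge0.
move: (Rintegral _ _ _) (fine _) et => I E et h.
have : B * (t * K + t^-1 * E) <= B * (t * (K + 1)).
  by apply: ler_wpM2l => //; rewrite mulrDr mulr1 lerD2l.
have : t * (2 * (B + 1) * (K + 1)) = e.
  by rewrite /t divfK // gt_eqF // !mulr_gt0 // ltr_wpDl.
have : 0 <= t * (K + 1) by rewrite mulr_ge0 ?ltW // ltr_wpDl.
move: h; move: (t * K + _) => w; move: (K + 1) => k h h1 h2 h3; nra.
Qed.

End Coefficients.

(** * Bounded operators on square summable functions *)

Section SquareSummable.
Variables (R : realType) (X : choiceType).
Implicit Types (f g : X -> R[i]) (A B : {fset X}).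

(** Small tails make the net of finite sums Cauchy, so the limit behind [summability.sum] exists. *)
Lemma sum_near (u : X -> R) :
  (forall e : R, 0 < e -> exists A : {fset X}, forall B : {fset X},
    (forall x, x \in B -> x \notin A) ->
    `|\sum_(x <- B) u x| <= e) ->
  forall e : R, 0 < e -> \forall A \near (@summability.totally X),
    `|\sum_(x <- (A : {fset X})) u x - summability.sum u| <= e.
Proof.
move=> tail.
have pE A : summability.partial_sum u A = \sum_(x <- A) u x by rewrite big_seq_fsetE.
have cu : cvg (summability.partial_sum u @ summability.totally).
  apply/cauchy_cvgP; apply: cauchy_exP => e e0.
  have [A AP] := tail _ (divr_gt0 e0 (ltr0Sn R 1)).
  exists (\sum_(x <- A) u x); exists A => // B AB; rewrite /= /ball /= pE.
  rewrite (big_fsetID _ (mem A) B) /=.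
  have -> : [fset x in B | x \in A]%fset = A.
    by apply/fsetP => x; rewrite !inE /= andbC; case xA: (x \in A); rewrite //= (fsubsetP AB).
  rewrite opprD addNKr normrN; apply: le_lt_trans (AP _ _) _; last by lra.
  by move=> x; rewrite !inE => /andP[].
move=> e e0; move/cvgrPdist_le : (cu) => /(_ e e0); apply: filterS => A /=.
by rewrite pE distrC.
Qed.

(** Termwise from [0 <= t^-1 * (a - t * b)^2]. The parameter lets a small [sqsum f A] compensate a
    merely bounded [sqsum g A]. *)
Lemma normc_sum_conj_le f g A (t : R) : 0 < t ->
  normc (\sum_(x <- A) f x * conjc (g x)) <= t^-1 * sqsum f A + t * sqsum g A.
Proof.
move=> t0; rewrite /sqsum !mulr_sumr -big_split /=.
elim/big_ind2: _ => [|z r z' r' zr zr'|x _]; first by rewrite normc0.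
  exact: le_trans (le_normcD _ _) (lerD zr zr').
rewrite normcM normcJ; move: (normc (f x)) (normc (g x)) (normc_ge0 (f x)) => a b a0.
have : 0 <= t^-1 * (a - t * b) ^+ 2 by rewrite mulr_ge0 ?sqr_ge0 ?invr_ge0 ?ltW.
have -> : t^-1 * (a - t * b) ^+ 2 = t^-1 * a ^+ 2 + t * b ^+ 2 - 2 * (a * b).
  by field; rewrite gt_eqF.
have : 0 <= t^-1 * a ^+ 2 + t * b ^+ 2.
  by rewrite addr_ge0 // mulr_ge0 ?sqr_ge0 ?invr_ge0 ?ltW.
by move: (a * b) (_ + _) => ab s; lra.
Qed.

Lemma inner_near f g (e : R) : L2 f -> L2 g -> 0 < e ->
  \forall A \near (@summability.totally X),
    normc (\sum_(x <- (A : {fset X})) f x * conjc (g x) - inner f g) <= e.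
Proof.
move=> f2 g2 e0.
have tail (e' : R) : 0 < e' -> exists A : {fset X}, forall B : {fset X},
    (forall x, x \in B -> x \notin A) ->
    normc (\sum_(x <- B) f x * conjc (g x)) <= e'.
  move=> e'0; have e2 := divr_gt0 e'0 (ltr0Sn R 1).
  have [Af AfP] := sqnorm_tail f2 e2; have [Ag AgP] := sqnorm_tail g2 e2.
  exists (Af `|` Ag)%fset => B BA; apply: le_trans (normc_sum_conj_le _ _ _ ltr01) _.
  have fB : sqsum f B <= e' / 2.
    by apply: AfP => x /BA; rewrite inE negb_or => /andP[].
  have gB : sqsum g B <= e' / 2.
    by apply: AgP => x /BA; rewrite inE negb_or => /andP[].
  by rewrite invr1 !mul1r; move: fB gB; move: (sqsum f B) (sqsum g B) => ? ?; lra.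
have ReS B : complex.Re (\sum_(x <- B) f x * conjc (g x)) =
    \sum_(x <- B) complex.Re (f x * conjc (g x)) 
  by apply: (big_morph (@complex.Re R)) => // -[? ?] [].
have ImS B : complex.Im (\sum_(x <- B) f x * conjc (g x)) =
    \sum_(x <- B) complex.Im (f x * conjc (g x)) 
  by apply: (big_morph (@complex.Im R)) => // -[? ?] [].
have hr := @sum_near (fun x => complex.Re (f x * conjc (g x))).
have hi := @sum_near (fun x => complex.Im (f x * conjc (g x))).
have e2 := divr_gt0 e0 (ltr0Sn R 1).
have [tr ti] : (forall e', 0 < e' -> exists A : {fset X}, forall B : {fset X},
      (forall x, x \in B -> x \notin A) ->
      `|\sum_(x <- B) complex.Re (f x * conjc (g x))| <= e') /\
    (forall e', 0 < e' -> exists A : {fset X}, forall B : {fset X},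
      (forall x, x \in B -> x \notin A) ->
      `|\sum_(x <- B) complex.Im (f x * conjc (g x))| <= e').
  split=> e' /tail[A AP]; exists A => B BA; rewrite -?ReS -?ImS.
    exact: le_trans (ler_Re_normc _) (AP B BA).
  exact: le_trans (ler_Im_normc _) (AP B BA).
apply: filterS (filterI (hr tr _ e2) (hi ti _ e2)) => A []; rewrite -ReS -ImS.
rewrite /inner /csum; move: (summability.sum _) (summability.sum _) => a b.
move: (\sum_(x <- A) _) => [c d] ca db; apply: le_trans (normc_le_ReIm _) _.
by rewrite (splitr e); apply: lerD.
Qed.

Lemma inner_conj f g : L2 f -> L2 g -> conjc (inner f g) = inner g f.
Proof.
move=> f2 g2; apply: normc_small_eq => e e0; have e2 := divr_gt0 e0 (ltr0Sn R 1).
have [A [h1 h2]] := filter_ex (filterI (inner_near f2 g2 e2) (inner_near g2 f2 e2)).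
have E : conjc (\sum_(x <- A) f x * conjc (g x)) = \sum_(x <- A) g x * conjc (f x).
  rewrite (rmorph_sum conjc); apply: eq_bigr => x _ /=.
  by rewrite conjcM conjcK mulrC.
move: h1 h2; rewrite -E -normcJ conjcB.
move: (conjc (inner f g)) (inner g f) (conjc _) => a b c ha hb.
rewrite -[a - b](subrKA c) (splitr e); apply: le_trans (le_normcD _ _) _.
by rewrite lerD // -normcN opprB.
Qed.

Definition delta (y : X) : X -> R[i] := fun x => (x == y)%:R.

Definition restrict (P : pred X) f : X -> R[i] := fun x => if P x then f x else 0.

Lemma sqsum_restrict P f B : sqsum (restrict P f) B = sqsum f [fset x in B | P x]%fset.
Proof.
rewrite /sqsum -(@big_fset_condE _ _ _ _ B P) [RHS]big_mkcond; apply: eq_bigr => x _.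
by rewrite /restrict; case: (P x) => //; rewrite normc0 expr0n.
Qed.

Lemma sqnorm_fin f : L2 f -> sqnorm f \is a fin_num.
Proof. by move=> f2; rewrite ge0_fin_numE // esum_ge0 // => x _; rewrite lee_fin sqr_ge0. Qed.

Lemma sqnorm_le f (M : R) : (forall B, sqsum f B <= M) -> (sqnorm f <= M%:E)%E.
Proof.
move=> h; apply: ge_ereal_sup => _ [S [fS _] <-].
by rewrite fsbig_finite //= sumEFin lee_fin; exact: h.
Qed.

Lemma L2_sqsum f (M : R) : (forall B, sqsum f B <= M) -> L2 f.
Proof. by move=> h; apply: le_lt_trans (sqnorm_le h) _; exact: ltry. Qed.

Lemma sqsum_le_fine f B : L2 f -> sqsum f B <= fine (sqnorm f).
Proof. by move=> f2; rewrite -lee_fin fineK ?sqnorm_fin // sqsum_le_sqnorm. Qed.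

Lemma L2_conj f : L2 f -> L2 (fun x => conjc (f x)).
Proof.
move=> f2; apply: (@L2_sqsum _ (fine (sqnorm f))) => B.
by rewrite /sqsum; under eq_bigr do rewrite normcJ; exact: sqsum_le_fine.
Qed.

Lemma L2_restrict P f : L2 f -> L2 (restrict P f).
Proof.
move=> f2; apply: (@L2_sqsum _ (fine (sqnorm f))) => B.
by rewrite sqsum_restrict sqsum_le_fine.
Qed.

Lemma L2_delta y : L2 (delta y).
Proof.
apply: (@L2_sqsum _ 1) => B; rewrite /sqsum.
case: (boolP (y \in B)) => yB; last first.
  rewrite big_seq big1 // => x xB; rewrite /delta.
  by case: eqVneq yB => [<-|_ _]; [rewrite xB|rewrite normc0 expr0n].
rewrite (big_fsetD1 y) //= /delta eqxx big_seq big1 ?addr0.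
  by rewrite normc1 expr1n.
by move=> x; rewrite !inE => /andP[/negbTE -> _]; rewrite normc0 expr0n.
Qed.

Lemma inner_delta f y : L2 f -> inner f (delta y) = f y.
Proof.
move=> f2; apply: normc_small_eq => e e0.
have yA : \forall A \near (@summability.totally X), y \in A.
  by exists [fset y]%fset => // A; rewrite /= fsub1set.
have [A [h1 h2]] := filter_ex (filterI (inner_near f2 (L2_delta y) e0) yA).
rewrite -normcN opprB; move: h1; rewrite (big_fsetD1 y) //= /delta eqxx conjc1 mulr1.
rewrite big_seq big1 ?addr0 // => x; rewrite !inE => /andP[/negbTE -> _].
by rewrite conjc0 mulr0.
Qed.

End SquareSummable.

Section BoundedOperator.
Variables (R : realType) (X : choiceType).
Variable T : (X -> R[i]) -> X -> R[i].
Hypothesis bT : bounded_operator T.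
Implicit Types (f g : X -> R[i]) (A B : {fset X}).

Lemma bounded_operator_split f A x : L2 f ->
  T f x = \sum_(y <- A) f y * T (delta R y) x + T (restrict (fun y => y \notin A) f) x.
Proof.
move=> f2; have [_ lin _] := bT.
suff H (s : seq X) : uniq s ->
    T f x = \sum_(y <- s) f y * T (delta R y) x + T (restrict (fun y => y \notin s) f) x.
  exact: H (fset_uniq A).
elim: s => [_|y s IH /= /andP[ys us]].
  by rewrite big_nil add0r; congr (T _ x); apply/funext => y.
rewrite big_cons -addrA addrCA IH //; congr (_ + _).
rewrite -lin; [|exact: L2_delta|exact: L2_restrict].
congr (T _ x); apply/funext => z; rewrite /delta /restrict inE negb_or.
by case: eqVneq => [->|_] /=; rewrite ?ys ?mulr1 ?mulr0 ?addr0 ?add0r.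
Qed.

Lemma sqsum_bounded_operator : exists2 M : R, 0 <= M &
  forall f (e : R), L2 f -> (forall B, sqsum f B <= e) -> forall B, sqsum (T f) B <= M * e.
Proof.
have [T2 _ [M TM]] := bT; exists (M ^+ 2); first exact: sqr_ge0.
move=> f e f2 fe B; apply: le_trans (sqsum_le_fine B (T2 f f2)) _.
have n0 (h : X -> R[i]) : L2 h -> 0 <= fine (sqnorm h).
  by move=> h2; apply: le_trans (sqsum_le_fine fset0 h2); exact: sqsum_ge0.
have fe' : fine (sqnorm f) <= e by rewrite -lee_fin fineK ?sqnorm_fin // sqnorm_le.
have := TM f f2; rewrite /norm2 => h.
rewrite -(sqr_sqrtr (n0 _ (T2 f f2))).
apply: le_trans (_ : M ^+ 2 * fine (sqnorm f) <= _); last by rewrite ler_wpM2l ?sqr_ge0.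
rewrite -[in leRHS](sqr_sqrtr (n0 _ f2)) -exprMn ler_pXn2r // nnegrE ?sqrtr_ge0 //.
exact: le_trans (sqrtr_ge0 _) h.
Qed.

(** Cutting [f] down to [A] costs only the pairing of [g] with the image of the tail of [f]. Both
    sums run over the same [A], so that the comparison in [self_adjoint_kernel] merely exchanges two
    finite sums. *)
Lemma kernel_sum_near f g (e : R) : L2 f -> L2 g -> 0 < e ->
  \forall A \near (@summability.totally X),
    normc (\sum_(x <- (A : {fset X})) \sum_(y <- A) f y * T (delta R y) x * conjc (g x) -
           inner (T f) g) <= e.
Proof.
move=> f2 g2 e0; have [T2 _ _] := bT; have [M M0 TM] := sqsum_bounded_operator.
have e2 := divr_gt0 e0 (ltr0Sn R 1).
(* Together with the tail bound [e / 4 * t / (M + 1)] below, this makes each of the two terms of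
   [normc_sum_conj_le] at most [e / 4]. *)
pose G := fine (sqnorm g); pose t := e / 4 / (G + 1).
have G0 : 0 <= G by apply: le_trans (sqsum_le_fine fset0 g2); exact: sqsum_ge0.
have t0 : 0 < t by rewrite !divr_gt0 // ltr_wpDl.
have M1 : 0 < M + 1 by rewrite ltr_wpDl.
have d0 : 0 < e / 4 * t / (M + 1) by rewrite divr_gt0 // mulr_gt0 // divr_gt0.
have [A0 A0P] := sqnorm_tail f2 d0.
have A0A : \forall A \near (@summability.totally X), (A0 `<=` A)%fset by exists A0.
apply: filterS (filterI (inner_near (T2 f f2) g2 e2) A0A) => A [hA AA].
set h := restrict (fun y => y \notin A) f.
have h2 : L2 h by exact: L2_restrict.
have -> : \sum_(x <- A) \sum_(y <- A) f y * T (delta R y) x * conjc (g x) =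
    \sum_(x <- A) T f x * conjc (g x) - \sum_(x <- A) T h x * conjc (g x).
  rewrite -sumrB; apply: eq_bigr => x _; rewrite (bounded_operator_split A x f2).
  by rewrite -mulrBl addrK mulr_suml.
have hs : sqsum (T h) A <= e / 4 * t.
  apply: le_trans (TM h _ h2 _ A) (_ : M * (e / 4 * t / (M + 1)) <= _) => [B|].
    rewrite sqsum_restrict; apply: A0P => x; rewrite !inE => /andP[_].
    by apply: contra; exact: (fsubsetP AA).
  rewrite mulrA ler_pdivrMr ?ltr_wpDl // mulrC ler_wpM2l ?lerDl //.
  by apply: mulr_ge0; [apply: divr_ge0 => //|]; exact: ltW.
have gs : sqsum g A <= G + 1.
  by apply: le_trans (sqsum_le_fine A g2) _; rewrite lerDl.
have := normc_sum_conj_le (T h) g A t0.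
have b1 : t^-1 * sqsum (T h) A <= e / 4 by rewrite mulrC ler_pdivrMr.
have b2 : t * sqsum g A <= e / 4.
  apply: le_trans (ler_wpM2l (ltW t0) gs) _.
  by rewrite /t divfK // gt_eqF // ltr_wpDl.
move: b1 b2 hA; move: (t^-1 * _) (t * _) (\sum_(x <- A) T h x * _) => u v s b1 b2 hA hs'.
rewrite addrAC; apply: le_trans (le_normcD _ _) _; rewrite normcN.
by move: hA hs' b1 b2; move: (normc _) (normc _) => ? ?; lra.
Qed.

Lemma self_adjoint_kernel : self_adjoint T <->
  forall x y, T (delta R y) x = conjc (T (delta R x) y).
Proof.
have [T2 _ _] := bT; have d2 := @L2_delta R X; split=> [sa x y|K f g f2 g2].
  have Ty := T2 _ (d2 y); have Tx := T2 _ (d2 x).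
  rewrite -[LHS](inner_delta x Ty) (sa _ _ (d2 y) (d2 x)) -(inner_conj Tx (d2 y)).
  by congr conjc; rewrite inner_delta.
apply: normc_small_eq => e e0; have e2 := divr_gt0 e0 (ltr0Sn R 1).
rewrite -(inner_conj (T2 g g2) f2).
have [A [h1 h2]] := filter_ex (filterI (kernel_sum_near f2 g2 e2) (kernel_sum_near g2 f2 e2)).
move: h2; rewrite -normcJ conjcB.
have -> : conjc (\sum_(x <- A) \sum_(y <- A) g y * T (delta R y) x * conjc (f x)) =
    \sum_(x <- A) \sum_(y <- A) f y * T (delta R y) x * conjc (g x).
  rewrite (rmorph_sum conjc) exchange_big /=; apply: eq_bigr => x _.
  rewrite (rmorph_sum conjc); apply: eq_bigr => y _ /=.
  by rewrite !conjcM conjcK -K mulrC [_ * T _ _]mulrC mulrA.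
move: h1; move: (\sum_(x <- A) _) (inner _ _) (conjc _) => s a b sa sb.
rewrite -[a - b](subrKA s) (splitr e); apply: le_trans (le_normcD _ _) _.
by rewrite lerD // -normcN opprB.
Qed.

End BoundedOperator.

(** * The kernel of a pseudo-differential operator *)

Section SymbolKernel.
Variables (R : realType) (q : nat) (X : homTree q) (o : X).
Variable nu : probability (Omega o) R.
Local Notation OT := (@OmegaTau R q X o).
Local Notation m := (base_measure nu).
Local Notation density := (plancherel_density q).
Let mOT : measurable OT := measurable_OmegaTau.

Lemma helgason_delta y (w : Omega o) (s : R) :
  helgason (delta R y) w s = wave_plus w s y.
Proof.
rewrite /helgason (@fsbigTE _ _ _ _ [fset y]%fset) => [|x].
  by rewrite big_seq_fset1 /delta eqxx mul1r.
by rewrite inE /delta => /negbTE ->; rewrite mul0r.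
Qed.

(** The wave at [y] stands last, so that the kernel is a fixed function for given [x], paired with
    the waves as in [wave_orthogonal]. *)
Lemma psido_kernel sigma T x y : is_psido nu sigma T ->
  let F p := wave_minus p.1 p.2 x * sigma x p.1 p.2 * (density p.2)%:C *
    wave_plus p.1 p.2 y in
  cintegrable m OT F /\ T (delta R y) x = cintegral m OT F.
Proof.
move=> Ts F; have fd : finite_set [set x | delta R y x != 0].
  apply: (@sub_finite_set _ _ [set y]) => // z.
  by rewrite /delta /=; have [->|_] := eqVneq z y; rewrite ?eqxx.
have [I ->] := Ts _ fd x.
have E p : psido_integrand sigma (delta R y) x p.1 p.2 * (density p.2)%:C = F p.
  by rewrite /psido_integrand helgason_delta mulrAC.
split; first by apply: eq_cintegrable I.
by apply: eq_cintegral.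
Qed.

Lemma ae_density_gt0 : {ae m, forall p, OT p -> 0 < density p.2 :> R}.
Proof.
exists (setT `*` ([set 0] `|` [set tau R q])); split.
- by apply: measurableX => //; apply: measurableU; exact: measurable_set1.
- rewrite base_measureX //; last by apply: measurableU; exact: measurable_set1.
  by rewrite countable_lebesgue_measure0 ?mule0 //; exact: finite_set_countable.
move=> [w s] /= h; split=> //=; have [s0|s0] := eqVneq s 0; first by left.
have [st|st] := eqVneq s (tau R q); first by right.
case: h => -[_ /=]; rewrite in_itv /= => /andP[s1 s2].
by apply: (plancherel_density_gt0 X); rewrite !lt_neqAle eq_sym s0 st s1 s2.
Qed.

End SymbolKernel.

Theorem corollary5p3 (R : realType) (q : nat) (X : homTree q) (o : X)
    (nu : probability (Omega o) R)
    (nuE : forall x : X, x != o ->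
       nu (through o x) = (q%:R / ((q.+1)%:R * q%:R ^+ dist o x))%:E)
    (sigma : X -> Omega o -> R -> R[i]) (sigma_meas : measurable_symbol sigma)
    (T : (X -> R[i]) -> X -> R[i])
    (T_sigma : is_psido nu sigma T) (T_nuclear : nuclear T) :
  self_adjoint T <->
  forall y : X, exists2 S : Omega o -> R -> R[i],
    L2_series_sum nu
      (fun x w1 s1 => wave_minus w1 s1 x *
         nu_mu_integral nu (fun w s =>
           conjc (sigma x w s) * wave_plus w s x * wave_minus w s y))
      S &
    {ae base_measure nu, forall p, OmegaTau p ->
      sigma y p.1 p.2 = (wave_minus p.1 p.2 y)^-1 * S p.1 p.2}.
Proof.
have [bT _] := T_nuclear; have [T2 _ _] := bT.
have mOT := @measurable_OmegaTau R q X o.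
rewrite (self_adjoint_kernel bT).
(* The density is real, so conjugating the kernel integral exchanges the two kinds of waves and
   conjugates the symbol. *)
have coefE y : (fun x w1 s1 => wave_minus w1 s1 x * nu_mu_integral nu (fun w s =>
      conjc (sigma x w s) * wave_plus w s x * wave_minus w s y)) =
    (fun x w1 s1 => wave_minus w1 s1 x * conjc (T (delta R y) x)).
  apply/funext => x; have [I ->] := psido_kernel x y T_sigma.
  rewrite -cintegralJ //; apply/funext => w1; apply/funext => s1; congr (_ * _).
  apply: eq_cintegral => p _; rewrite -(conjc_wave_minus p.1 p.2 x) -(conjc_wave_plus p.1 p.2 y).
  move: (wave_minus _ _ _) (wave_plus _ _ _) => a b.
  by rewrite !conjcM conjc_real; ring.
pose Phi y (p : Omega o * measurableTypeR R) :=
  wave_minus p.1 p.2 y * sigma y p.1 p.2 * (plancherel_density q p.2)%:C.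
(* The kernel is taken at the root, where the wave is 1. *)
have IPhi y : cintegrable (base_measure nu) (@OmegaTau R q X o) (Phi y).
  have [I _] := psido_kernel y o T_sigma; apply: eq_cintegrable I => // p _.
  by rewrite wave_plus_root mulr1.
split=> [K y|H x y].
  have c2 : L2 (fun x => conjc (T (delta R y) x)).
    by apply/L2_conj/T2; exact: L2_delta.
  have [S cS] := riesz_fischer nuE c2; exists S; rewrite ?coefE //.
  have IS := cintegrable_series_sum cS.
  (* The difference pairs with the wave at [x] to [T (delta x) y - conjc (T (delta y) x)], which is
     0 by the symmetry of the kernel. *)
  have wS : wave_orthogonal nu (fun p => Phi y p - S p.1 p.2 * (plancherel_density q p.2)%:C).
    split=> [|x]; first exact: cintegrableB.
    have [I1 e1] := psido_kernel y x T_sigma.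
    have [mw bw] := bmeasurable_wave_plus R o x.
    have I2 := cintegrableMr mOT IS mw bw.
    have -> : 0 = T (delta R x) y - conjc (T (delta R y) x) by rewrite (K y x) subrr.
    rewrite e1 -(cintegral_series_sum nuE cS) -cintegralB //.
    by apply: eq_cintegral => p _; rewrite mulrBl.
  have := wave_complete wS; have := ae_density_gt0 nu.
  apply: filterS2 => p d0 z Dp; have := z Dp; rewrite /Phi -mulrBl.
  move/eqP; rewrite mulf_eq0 realc_eq0 (gt_eqF (d0 Dp)) orbF subr_eq0 => /eqP <-.
  by rewrite mulKf // wave_minus_neq0.
(* Conversely, the identity for [sigma x] is integrated against the wave at [y]: its left side gives
   the kernel at [x, y], its right side the coefficient at [y], the conjugate of the kernel at
   [y, x]. *)
have [S] := H x; rewrite coefE => cS aeS.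
have [I ->] := psido_kernel x y T_sigma.
have := cintegral_series_sum nuE cS y => <-.
have IS := cintegrable_series_sum cS; have [mw bw] := bmeasurable_wave_plus R o y.
apply: ae_eq_cintegral => //; first exact: cintegrable_cmeasurable I.
  exact: cintegrable_cmeasurable (cintegrableMr mOT IS mw bw).
apply: filterS aeS => p h Dp; by rewrite (h Dp) mulVKf // wave_minus_neq0.
Qed.
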